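(* There exists an absolute constant $C$ such that the following holds. Let $N_1,N_2,L_1,L_2>0$, let $\pm_1,\pm_2\in\{+,-\}$ be arbitrary signs, let $r>0$, and let $B\subset\mathbb R^3$ be a ball of radius $r$ with arbitrary center. Let $u_1,u_2\in L^2(\mathbb R^{1+3})$ satisfy $\operatorname{supp}\widehat{u_j}\subset K^{\pm_j}_{N_j,L_j}$ for $j=1,2$. Then $$\bigl\|\mathfrak B_{\sqrt{\theta_{12}}}(\mathbf P_{\mathbb R\times B}u_1,u_2)\bigr\|\le C\,(r^2L_1L_2)^{1/2}\,\|u_1\|\,\|u_2\|.$$
   Context: Points of $\mathbb R^{1+3}$ are written $X=(\tau,\xi)$ with $\tau\in\mathbb R$, $\xi\in\mathbb R^3$ (Fourier variables of $(t,x)$); $\|\cdot\|$ is the norm of $L^2(\mathbb R^{1+3})$; $\widehat u=\mathcal Fu$ is the space-time Fourier transform. For $N,L>0$ and a sign $\pm$, $$K^{\pm}_{N,L}=\Bigl\{(\tau,\xi)\in\mathbb R^{1+3}:\ \tfrac N2<|\xi|\le N,\ \bigl|-\tau\pm|\xi|\bigr|\le L\Bigr\}.$$ The statement $\operatorname{supp}\widehat u\subset A$ means that $\widehat u$ vanishes almost everywhere outside $A$. For measurable $A\subset\mathbb R^{1+3}$, $\mathbf P_A$ is the Fourier multiplier with symbol $\chi_A$. For nonzero $a,b\in\mathbb R^3$, $\theta(a,b)\in[0,\pi]$ is the angle between $a$ and $b$. With $X_j=(\tau_j,\xi_j)$ and $\theta_{12}=\theta(\pm_1\xi_1,\pm_2\xi_2)$,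 the bilinear operator $\mathfrak B_{\sqrt{\theta_{12}}}$ is defined by $$\mathcal F\bigl(\mathfrak B_{\sqrt{\theta_{12}}}(u_1,u_2)\bigr)(X_0)=\iint\sqrt{\theta_{12}}\,\widehat{u_1}(X_1)\widehat{u_2}(X_2)\,\delta(X_0-X_1-X_2)\,dX_1\,dX_2,$$ i.e. the integral over $X_1\in\mathbb R^{1+3}$ with $X_2=X_0-X_1$. *)

(* Defs.v *)
From HB Require Import structures.
From mathcomp Require Import all_boot all_order all_algebra.
From mathcomp Require Import all_classical all_reals all_analysis.
From mathcomp.real_closed Require Import complex.

Set Implicit Arguments.
Unset Strict Implicit.
Unset Printing Implicit Defensive.
Import Order.TTheory GRing.Theory Num.Theory.
Import numFieldNormedType.Exports.
Local Open Scope classical_set_scope.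
Local Open Scope ring_scope.
Local Open Scope complex_scope.

(* R^3 and R^{1+3} as products of copies of the Borel line, so that they carry
   the product sigma-algebra. The norm instance on products is the sup norm,
   hence the separate Euclidean norm below. *)
Notation space3 R :=
  (measurableTypeR R * measurableTypeR R * measurableTypeR R)%type.
Notation spacetime R := (measurableTypeR R * space3 R)%type.

Section geometry.
Context {R : realType}.
Implicit Types (a b : space3 R) (X Y : spacetime R).

Definition dot a b : R := a.1.1 * b.1.1 + a.1.2 * b.1.2 + a.2 * b.2.
Definition enorm a : R := Num.sqrt (dot a a).
Definition scale3 (c : R) a : space3 R := (c * a.1.1, c * a.1.2, c * a.2).
Definition sub3 a b : space3 R := (a.1.1 - b.1.1, a.1.2 - b.1.2, a.2 - b.2).
Definition sub4 X Y : spacetime R := (X.1 - Y.1, sub3 X.2 Y.2).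
Definition dot4 X Y : R := X.1 * Y.1 + dot X.2 Y.2.

(* the angle in [0, pi]; meaningful for nonzero a and b only *)
Definition angle a b : R := acos (dot a b / (enorm a * enorm b)).

Definition eball (c : space3 R) (r : R) : set (space3 R) :=
  [set x | enorm (sub3 x c) < r].

(* signs are booleans, with true for + and false for - *)
Definition pm (s : bool) : R := if s then 1 else -1.

Definition Kset (s : bool) (N L : R) : set (spacetime R) :=
  [set X | N / 2 < enorm X.2 <= N /\ `| - X.1 + pm s * enorm X.2 | <= L].

End geometry.

(* A copy of m1 \x m2: the library's \x, applied to sigma-finite measures, is
   only inferred to be a measure, so products cannot be iterated with it. *)
Section product_measure.
Context d1 d2 (T1 : measurableType d1) (T2 : measurableType d2) (R : realType).
Variables (m1 : {sigma_finite_measure set T1 -> \bar R})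
          (m2 : {sigma_finite_measure set T2 -> \bar R}).

Definition sf_product : set (T1 * T2) -> \bar R := (m1 \x m2)%E.

HB.instance Definition _ := Measure.on sf_product.

Lemma sf_product_sigma_finite : sigma_finite setT sf_product.
Proof.
have /sigma_finiteP[F [TF ndF Foo]] := sigma_finiteT m1.
have /sigma_finiteP[G [TG ndG Goo]] := sigma_finiteT m2.
exists (fun n => F n `*` G n).
  rewrite -setXTT TF TG predeqE => -[x y]; split.
    move=> [/= [n _ Fnx] [k _ Gky]]; exists (maxn n k) => //; split.
    - by move: x Fnx; exact/subsetPset/ndF/leq_maxl.
    - by move: y Gky; exact/subsetPset/ndG/leq_maxr.
  by move=> [n _ []/= ? ?]; split; exists n.
move=> k; have [? ?] := Foo k; have [? ?] := Goo k.
split; first exact: measurableX.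
by rewrite /sf_product product_measure1E// lte_mul_pinfty// ge0_fin_numE.
Qed.

HB.instance Definition _ :=
  Measure_isSigmaFinite.Build _ _ _ sf_product sf_product_sigma_finite.

End product_measure.

Definition lebesgue4 (R : realType) :
    {sigma_finite_measure set (spacetime R) -> \bar R} :=
  let mu : {sigma_finite_measure set (measurableTypeR R) -> \bar R} :=
    @lebesgue_measure R in
  sf_product mu (sf_product (sf_product mu mu) mu).

Section L2.
Context {R : realType}.
Implicit Types (f g u v : spacetime R -> R[i]) (X : spacetime R).

Definition cmeasurable f :=
  measurable_fun setT (fun X => complex.Re (f X)) /\
  measurable_fun setT (fun X => complex.Im (f X)).

Definition cintegral f : R[i] :=
  (\int[lebesgue4 R]_X complex.Re (f X))%R +i*
  (\int[lebesgue4 R]_X complex.Im (f X))%R.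

Definition cintegrable f :=
  (lebesgue4 R).-integrable setT (fun X => (complex.Re (f X))%:E) /\
  (lebesgue4 R).-integrable setT (fun X => (complex.Im (f X))%:E).

Definition L2norm f : \bar R :=
  'N[lebesgue4 R]_2%:E [(fun X => (Normc.normc (f X))%:E)]%E.

Definition inL2 f := cmeasurable f /\ (L2norm f < +oo)%E.

Definition expi (t : R) : R[i] := cos t +i* sin t.

Definition fourierL1 f X : R[i] :=
  cintegral (fun Y => expi (- dot4 X Y) * f Y).

(* The Fourier transform on L2 is the extension by continuity of the integral
   transform from L1 \cap L2, so its graph is the L2-closure of the graph of the
   latter. It is a relation between functions because u and g are only
   representatives of classes modulo almost everywhere equality. *)
Definition is_fourier u g :=
  [/\ inL2 u, inL2 g &
    exists f_ : nat -> spacetime R -> R[i],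
      [/\ forall n, cintegrable (f_ n) /\ inL2 (f_ n),
          (fun n => L2norm (fun X => f_ n X - u X)) @ \oo --> 0%E &
          (fun n => L2norm (fun X => fourierL1 (f_ n) X - g X)) @ \oo
            --> 0%E]].

Definition fourier_supp u (A : set (spacetime R)) :=
  exists2 g, is_fourier u g &
    {ae lebesgue4 R, forall X, ~ A X -> g X = 0}.

(* v = P_A u, the Fourier multiplier with symbol the indicator of A *)
Definition is_multiplier (A : set (spacetime R)) u v :=
  exists2 g, is_fourier u g & is_fourier v (fun X => (\1_A X)%:C * g X).

(* the integral over X1, with X2 = X0 - X1, for Fourier transforms g1, g2 *)
Definition bilinear_integral (s1 s2 : bool) g1 g2 (X0 : spacetime R) : R[i] :=
  cintegral (fun X1 =>
    let X2 := sub4 X0 X1 in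
    let theta12 := angle (scale3 (pm s1) X1.2) (scale3 (pm s2) X2.2) in
    (Num.sqrt theta12)%:C * g1 X1 * g2 X2).

(* v = B_{sqrt theta12} (u1, u2) *)
Definition is_bilinear (s1 s2 : bool) u1 u2 v :=
  exists g1 g2, [/\ is_fourier u1 g1, is_fourier u2 g2 &
    is_fourier v (bilinear_integral s1 s2 g1 g2)].

End L2.

(* Main.v *)
(* By Plancherel, and by Cauchy-Schwarz in X1 together with Tonelli, it suffices to
   bound, uniformly in X0 = (tau0, xi0), the integral over X1 of theta12 on the set
   where xi1 is in B, X1 in K1 and X0 - X1 in K2. The integral in tau1 costs
   2 min(L1, L2), and leaves the condition |phi(xi1) - tau0| <= d := L1 + L2,
   where phi(xi) = +-|xi| +- |xi0 - xi|. The gradient of phi is the difference of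
   the two unit vectors whose angle is theta12, hence theta12 is at most
   4 sum_i |d_i phi|. On a line parallel to the i-th axis d_i phi has the sign of
   an affine function, so that the integral of |d_i phi| where |phi - tau0| <= d is
   bounded by the variation of 2 d atan((phi - tau0) / d), that is by O(d); the two
   other coordinates of xi1 stay in intervals of length 2 r. Since
   min(L1, L2) (L1 + L2) <= 2 L1 L2, this gives O(r^2 L1 L2).

   Plancherel's identity on the line comes from Fejer means: damping the transform
   by 2 (1 - cos (h x)) / (h x)^2 and inverting is a convolution with a tent, so that
   Schur's test and Fatou's lemma give one inequality, and Lebesgue's
   differentiation theorem the other. It passes to products by Fubini, and makes
   the L2 closure of the transform a function, onto because the adjoint transform
   provides preimages. *)

Require Import Defs.
From mathcomp Require Import all_boot all_order all_algebra.
From mathcomp Require Import all_classical all_reals all_analysis.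
From mathcomp.real_closed Require Import complex.
From mathcomp Require Import measurable_realfun ring lra.
Import Order.TTheory GRing.Theory Num.Theory.
Import numFieldNormedType.Exports.
Set Implicit Arguments.
Unset Strict Implicit.
Unset Printing Implicit Defensive.
Local Open Scope classical_set_scope.
Local Open Scope ring_scope.
Local Open Scope complex_scope.

(** Functions stand for classes, and the transform, the multiplier and the bilinear operator are
    relations, so the result has two halves: some [Pu1] and [v] exist, and every choice obeys the
    bound. Existence needs preimages under the transform. The adjoint integral supplies them only
    for data in both L1 and L2; this is enough, because the sets [Kset] have finite measure and a
    convolution of L1 functions is in L1. Norms are handled through squared integrals and |z + w|^2
    <= 2 |z|^2 + 2 |w|^2. Passing to the L2 closure then costs a factor 4 each time, which the
    absolute constant absorbs. The kernel bound must not see the frequencies N1 and N2. Hence the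
    derivative of the phase is integrated along coordinate lines against a weight that gives a
    bounded primitive: only the number of sign changes counts, and not the size of second
    derivatives. The lines through the singular points 0 and xi0 of the phase have transverse
    coordinates in a null set. *)

Notation Re := complex.Re.
Notation Im := complex.Im.
Notation normc := Normc.normc.

(** * Complex-valued integrands *)

Section complex_facts.
Context {R : realType}.
Implicit Types z w : R[i].

(** A polynomial in the two parts, which keeps the L2 computations free of square roots and within
    reach of [ring] and [nra]. *)
Definition sqn z : R := Re z ^+ 2 + Im z ^+ 2.

Lemma sqn_ge0 z : 0 <= sqn z.
Proof. by rewrite addr_ge0 ?sqr_ge0. Qed.

Lemma normcE2 z : normc z = Num.sqrt (sqn z).
Proof. by case: z. Qed.

Lemma normc_ge0 z : 0 <= normc z.
Proof. by rewrite normcE2 sqrtr_ge0. Qed.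

Lemma sqr_normc z : normc z ^+ 2 = sqn z.
Proof. by rewrite normcE2 sqr_sqrtr// sqn_ge0. Qed.

Lemma ReD z w : Re (z + w) = Re z + Re w.
Proof. by case: z; case: w. Qed.

Lemma ImD z w : Im (z + w) = Im z + Im w.
Proof. by case: z; case: w. Qed.

Lemma ReN z : Re (- z) = - Re z.
Proof. by case: z. Qed.

Lemma ImN z : Im (- z) = - Im z.
Proof. by case: z. Qed.

Lemma ReM z w : Re (z * w) = Re z * Re w - Im z * Im w.
Proof. by case: z; case: w. Qed.

Lemma ImM z w : Im (z * w) = Re z * Im w + Im z * Re w.
Proof. by case: z; case: w. Qed.

Lemma ReJ z : Re (conjc z) = Re z.
Proof. by case: z. Qed.

Lemma ImJ z : Im (conjc z) = - Im z.
Proof. by case: z. Qed.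

Definition reimE := (ReD, ImD, ReN, ImN, ReM, ImM, ReJ, ImJ).

Lemma eqc z w : Re z = Re w -> Im z = Im w -> z = w.
Proof. by case: z => a b; case: w => c d /= -> ->. Qed.

Lemma sqnM z w : sqn (z * w) = sqn z * sqn w.
Proof. by rewrite /sqn !reimE; ring. Qed.

Lemma sqnJ z : sqn (conjc z) = sqn z.
Proof. by rewrite /sqn !reimE; ring. Qed.

Lemma sqnN z : sqn (- z) = sqn z.
Proof. by rewrite /sqn !reimE; ring. Qed.

Lemma sqn_real (a : R) : sqn a%:C = a ^+ 2.
Proof. by rewrite /sqn/= expr0n addr0. Qed.

Lemma sqn0 : sqn (0 : R[i]) = 0.
Proof. by rewrite /sqn/= expr0n addr0. Qed.

Lemma sqnD_le z w : sqn (z + w) <= 2 * sqn z + 2 * sqn w.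
Proof.
rewrite /sqn !reimE.
have := sqr_ge0 (Re z - Re w); have := sqr_ge0 (Im z - Im w); nra.
Qed.

Lemma sqn_eq0 z : (sqn z == 0) = (z == 0).
Proof.
rewrite /sqn paddr_eq0 ?sqr_ge0// !sqrf_eq0.
by case: z => a b; rewrite eq_complex.
Qed.

Lemma normc_Re z : `|Re z| <= normc z.
Proof. by rewrite normcE2 -sqrtr_sqr ler_sqrt ?sqn_ge0// lerDl sqr_ge0. Qed.

Lemma normc_Im z : `|Im z| <= normc z.
Proof. by rewrite normcE2 -sqrtr_sqr ler_sqrt ?sqn_ge0// lerDr sqr_ge0. Qed.

Lemma normc_le z : normc z <= `|Re z| + `|Im z|.
Proof.
rewrite normcE2 -[leRHS]ger0_norm ?addr_ge0// -sqrtr_sqr ler_sqrt ?sqr_ge0//.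
rewrite /sqn -(real_normK (num_real (Re z))) -(real_normK (num_real (Im z))).
have := mulr_ge0 (normr_ge0 (Re z)) (normr_ge0 (Im z)); nra.
Qed.

Lemma normc_real (a : R) : normc a%:C = `|a|.
Proof. by rewrite normcE2 sqn_real sqrtr_sqr. Qed.

Lemma normcJ z : normc (conjc z) = normc z.
Proof. by rewrite !normcE2 sqnJ. Qed.

Lemma expi_normc (t : R) : normc (expi t) = 1.
Proof. by rewrite normcE2 /sqn/= cos2Dsin2 sqrtr1. Qed.

Lemma expiD (s t : R) : expi (s + t) = expi s * expi t.
Proof. by apply: eqc; rewrite reimE /= ?cosD ?sinD; ring. Qed.

Lemma expiJ (t : R) : conjc (expi t) = expi (- t).
Proof. by apply: eqc; rewrite reimE /= ?cosN ?sinN. Qed.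

Lemma conjM z w : conjc (z * w) = conjc z * conjc w.
Proof. by apply: eqc; rewrite !reimE; ring. Qed.

Lemma mulJ z : z * conjc z = (sqn z)%:C.
Proof. by apply: eqc; rewrite reimE /= /sqn ?reimE; ring. Qed.

End complex_facts.

(** * Measurability of complex-valued functions *)

Section complex_measurable.
Context d (T : measurableType d) {R : realType}.
Implicit Types f g : T -> R[i].

Definition cmeas f :=
  measurable_fun setT (fun x => Re (f x)) /\
  measurable_fun setT (fun x => Im (f x)).

Lemma cmeasD f g : cmeas f -> cmeas g -> cmeas (fun x => f x + g x).
Proof.
move=> [fr fi] [gr gi]; split.
  by under eq_fun do rewrite ReD; exact: measurable_funD.
by under eq_fun do rewrite ImD; exact: measurable_funD.
Qed.

Lemma cmeasN f : cmeas f -> cmeas (fun x => - f x).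
Proof.
move=> [fr fi]; split.
  by under eq_fun do rewrite ReN; exact: measurableT_comp.
by under eq_fun do rewrite ImN; exact: measurableT_comp.
Qed.

Lemma cmeasB f g : cmeas f -> cmeas g -> cmeas (fun x => f x - g x).
Proof. by move=> mf mg; apply: cmeasD => //; exact: cmeasN. Qed.

Lemma cmeasM f g : cmeas f -> cmeas g -> cmeas (fun x => f x * g x).
Proof.
move=> [fr fi] [gr gi]; split.
  under eq_fun do rewrite ReM.
  by apply: measurable_funB; exact: measurable_funM.
under eq_fun do rewrite ImM.
by apply: measurable_funD; exact: measurable_funM.
Qed.

Lemma cmeasJ f : cmeas f -> cmeas (fun x => conjc (f x)).
Proof.
move=> [fr fi]; split.
  by under eq_fun do rewrite ReJ.
by under eq_fun do rewrite ImJ; exact: measurableT_comp.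
Qed.

Lemma cmeas_cst (c : R[i]) : cmeas (fun=> c).
Proof. by split; exact: measurable_cst. Qed.

Lemma cmeas_real (h : T -> R) :
  measurable_fun setT h -> cmeas (fun x => (h x)%:C).
Proof. by move=> mh; split => //=; exact: measurable_cst. Qed.

Lemma cmeas_expi (h : T -> R) :
  measurable_fun setT h -> cmeas (fun x => expi (h x)).
Proof.
move=> mh; split => /=.
  by apply: measurableT_comp => //; apply: continuous_measurable_fun;
    exact: continuous_cos.
by apply: measurableT_comp => //; apply: continuous_measurable_fun;
  exact: continuous_sin.
Qed.

Lemma measurable_sqn f : cmeas f -> measurable_fun setT (fun x => sqn (f x)).
Proof.
by move=> [fr fi]; apply: measurable_funD; apply: measurable_funX.
Qed.

Lemma measurable_normc f : cmeas f ->
  measurable_fun setT (fun x => normc (f x)).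
Proof.
move=> mf; under eq_fun do rewrite normcE2.
apply: measurableT_comp; last exact: measurable_sqn.
by apply: continuous_measurable_fun; exact: sqrt_continuous.
Qed.

Lemma cmeas_indic (A : set T) f : measurable A -> cmeas f ->
  cmeas (fun x => (\1_A x)%:C * f x).
Proof. by move=> mA mf; apply: cmeasM => //; exact: cmeas_real. Qed.

End complex_measurable.

Lemma cmeas_comp d1 d2 (T1 : measurableType d1) (T2 : measurableType d2)
    (R : realType) (f : T2 -> R[i]) (h : T1 -> T2) :
  measurable_fun setT h -> cmeas f -> cmeas (fun x => f (h x)).
Proof.
by move=> mh [fr fi]; split; [exact: measurableT_comp fr mh|exact: measurableT_comp fi mh].
Qed.

Section measurable_real.
Context d (T : measurableType d) {R : realType}.
Implicit Types h : T -> R.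

Lemma measurable_cosc h : measurable_fun setT h ->
  measurable_fun setT (fun x => cos (h x)).
Proof.
move=> mh; apply: measurableT_comp => //.
by apply: continuous_measurable_fun; exact: continuous_cos.
Qed.

Lemma measurable_sqrtc h : measurable_fun setT h ->
  measurable_fun setT (fun x => Num.sqrt (h x)).
Proof.
move=> mh; apply: measurableT_comp => //.
by apply: continuous_measurable_fun; exact: sqrt_continuous.
Qed.

(** Inversion is discontinuous at 0, so measurability comes from the power function of exponent -1;
    on nonnegative values the two agree, 0 included, where both are 0. *)
Lemma measurable_invr_ge0 h : measurable_fun setT h -> (forall x, 0 <= h x) ->
  measurable_fun setT (fun x => (h x)^-1).
Proof.
move=> mh h0; under eq_fun do rewrite -powR_inv1//.
exact: (measurableT_comp (measurable_powR (-1))).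
Qed.

End measurable_real.

Ltac mproj := repeat first
  [ exact: measurable_id | exact: measurable_fst | exact: measurable_snd
  | exact: measurable_cst
  | apply: measurable_fun_pair
  | apply: (measurableT_comp measurable_fst)
  | apply: (measurableT_comp measurable_snd) ].

(** * Integrals of nonnegative real functions *)

Section ge0_integral_facts.
Context d (T : measurableType d) {R : realType}.
Variable mu : {measure set T -> \bar R}.
Local Open Scope ereal_scope.

Lemma ge0_intZl (k : R) (h : T -> R) : (0 <= k)%R -> (forall x, 0 <= h x)%R ->
  measurable_fun setT h ->
  \int[mu]_x (k * h x)%:E = k%:E * \int[mu]_x (h x)%:E.
Proof.
move=> k0 h0 mh; under eq_integral do rewrite EFinM.
by rewrite ge0_integralZl_EFin//; [move=> x _; rewrite lee_fin|exact/measurable_EFinP].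
Qed.

Lemma ge0_intD (h k : T -> R) : (forall x, 0 <= h x)%R ->
  (forall x, 0 <= k x)%R -> measurable_fun setT h -> measurable_fun setT k ->
  \int[mu]_x (h x + k x)%:E = \int[mu]_x (h x)%:E + \int[mu]_x (k x)%:E.
Proof.
move=> h0 k0 mh mk; under eq_integral do rewrite EFinD.
by rewrite ge0_integralD//; try (by move=> x _; rewrite lee_fin);
  exact/measurable_EFinP.
Qed.

Lemma ge0_int_le (h k : T -> R) : (forall x, 0 <= h x)%R ->
  (forall x, h x <= k x)%R -> measurable_fun setT h -> measurable_fun setT k ->
  \int[mu]_x (h x)%:E <= \int[mu]_x (k x)%:E.
Proof.
move=> h0 hk mh mk; apply: ge0_le_integral => //.
- by move=> x _; rewrite lee_fin.
- exact/measurable_EFinP.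
- exact/measurable_EFinP.
- by move=> x _; rewrite lee_fin.
Qed.

Lemma int_ge0 (h : T -> R) : (forall x, 0 <= h x)%R ->
  0 <= \int[mu]_x (h x)%:E.
Proof. by move=> h0; apply: integral_ge0 => x _; rewrite lee_fin. Qed.

Lemma integrable_ge0P (h : T -> R) : (forall x, 0 <= h x)%R ->
  measurable_fun setT h -> \int[mu]_x (h x)%:E < +oo ->
  mu.-integrable setT (EFin \o h).
Proof.
move=> h0 mh hoo; apply/integrableP; split; first exact/measurable_EFinP.
by under eq_integral do rewrite /= ger0_norm//.
Qed.

Lemma integrable_le_ge0 (h k : T -> R) : measurable_fun setT h ->
  measurable_fun setT k ->
  (forall x, `|h x| <= k x)%R -> \int[mu]_x (k x)%:E < +oo ->
  mu.-integrable setT (EFin \o h).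
Proof.
move=> mh mk hk koo; apply/integrableP; split; first exact/measurable_EFinP.
apply: le_lt_trans koo; apply: ge0_int_le => //.
exact: measurableT_comp.
Qed.

Lemma Rint_fineK (h : T -> R) : (forall x, 0 <= h x)%R ->
  \int[mu]_x (h x)%:E < +oo ->
  (\int[mu]_x h x)%R%:E = \int[mu]_x (h x)%:E.
Proof. by move=> h0 hoo; rewrite /Rintegral fineK// ge0_fin_numE// int_ge0. Qed.

End ge0_integral_facts.

(** * Integrals of complex-valued functions *)

Section complex_integral.
Context d (T : measurableType d) {R : realType}.
Variable mu : {measure set T -> \bar R}.
Implicit Types f g : T -> R[i].

Definition cint f : R[i] :=
  (\int[mu]_x Re (f x))%R +i* (\int[mu]_x Im (f x))%R.

Definition cL1 f := mu.-integrable setT (fun x => (Re (f x))%:E) /\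
  mu.-integrable setT (fun x => (Im (f x))%:E).

Definition sqint f : \bar R := (\int[mu]_x (sqn (f x))%:E)%E.

Definition absint f : \bar R := (\int[mu]_x (normc (f x))%:E)%E.

Lemma sqint_ge0 f : (0 <= sqint f)%E.
Proof. by apply: int_ge0 => x; exact: sqn_ge0. Qed.

Lemma absint_ge0 f : (0 <= absint f)%E.
Proof. by apply: int_ge0 => x; exact: normc_ge0. Qed.

Lemma cL1_meas f : cL1 f -> cmeas f.
Proof. by move=> [/measurable_int/measurable_EFinP ? /measurable_int/measurable_EFinP]. Qed.

Lemma cL1P f : cL1 f <-> cmeas f /\ (absint f < +oo)%E.
Proof.
split=> [fL|[mf foo]]; last first.
  by split; apply: (@integrable_le_ge0 _ _ _ _ _ (fun x => normc (f x))) foo;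
    [exact mf.1|exact: measurable_normc|move=> x; exact: normc_Re|
     exact mf.2|exact: measurable_normc|move=> x; exact: normc_Im].
have mf := cL1_meas fL; split=> //.
have /integrableP[_ roo] := fL.1; have /integrableP[_ ioo] := fL.2.
apply: (@le_lt_trans _ _ (\int[mu]_x (`|Re (f x)| + `|Im (f x)|)%:E)%E).
  apply: ge0_int_le => //.
  - by move=> x; exact: normc_ge0.
  - by move=> x; exact: normc_le.
  - exact: measurable_normc.
  - by apply: measurable_funD; apply: measurableT_comp => //; [exact mf.1|exact mf.2].
rewrite ge0_intD//.
- exact: lte_add_pinfty.
- by apply: measurableT_comp => //; exact mf.1.
- by apply: measurableT_comp => //; exact mf.2.
Qed.

Lemma cL1_le f (h : T -> R) : cmeas f -> measurable_fun setT h ->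
  (forall x, normc (f x) <= h x) -> (\int[mu]_x (h x)%:E < +oo)%E -> cL1 f.
Proof.
move=> mf mh fh hoo; apply/cL1P; split=> //; apply: le_lt_trans hoo.
apply: ge0_int_le => //; last exact: measurable_normc.
by move=> x; exact: normc_ge0.
Qed.

Lemma cL1D f g : cL1 f -> cL1 g -> cL1 (fun x => f x + g x).
Proof.
move=> [fr fi] [gr gi]; split.
  by under eq_fun do rewrite ReD EFinD; exact: integrableD.
by under eq_fun do rewrite ImD EFinD; exact: integrableD.
Qed.

Lemma cL1N f : cL1 f -> cL1 (fun x => - f x).
Proof.
move=> [fr fi]; split.
  by under eq_fun do rewrite ReN EFinN; exact: integrableN.
by under eq_fun do rewrite ImN EFinN; exact: integrableN.
Qed.

Lemma cL1B f g : cL1 f -> cL1 g -> cL1 (fun x => f x - g x).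
Proof. by move=> ? ?; apply: cL1D => //; exact: cL1N. Qed.

Lemma cL1J f : cL1 f -> cL1 (fun x => conjc (f x)).
Proof.
move=> [fr fi]; split.
  by under eq_fun do rewrite ReJ.
by under eq_fun do rewrite ImJ EFinN; exact: integrableN.
Qed.

Lemma cL1_bM (k : T -> R[i]) f (M : R) : cmeas k -> (forall x, normc (k x) <= M) ->
  cL1 f -> cL1 (fun x => k x * f x).
Proof.
move=> mk kM /cL1P[mf foo].
have M0 : 0 <= M by exact: le_trans (normc_ge0 _) (kM point).
apply: (@cL1_le _ (fun x => M * normc (f x))).
- exact: cmeasM.
- by apply: measurable_funM => //; exact: measurable_normc.
- by move=> x; rewrite Normc.normcM ler_wpM2r// normc_ge0.
- rewrite ge0_intZl//; last 2 first.
    by move=> x; exact: normc_ge0.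
    exact: measurable_normc.
  by rewrite lte_mul_pinfty// fin_numE.
Qed.

Lemma cL1Z (c : R[i]) f : cL1 f -> cL1 (fun x => c * f x).
Proof. by apply: (@cL1_bM (fun=> c) _ (normc c)) => //; exact: cmeas_cst. Qed.

Lemma cintD f g : cL1 f -> cL1 g -> cint (fun x => f x + g x) = cint f + cint g.
Proof.
move=> [fr fi] [gr gi]; apply: eqc; rewrite reimE /cint/=.
  by under eq_Rintegral do rewrite ReD; rewrite RintegralD.
by under eq_Rintegral do rewrite ImD; rewrite RintegralD.
Qed.

Lemma cintZ (c : R[i]) f : cL1 f -> cint (fun x => c * f x) = c * cint f.
Proof.
move=> [fr fi].
have Z (a : R) (h : T -> R) : mu.-integrable setT (EFin \o h) ->
    mu.-integrable setT (EFin \o (fun x => a * h x)).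
  by move=> ih; rewrite (_ : _ \o _ = fun x => (a%:E * (h x)%:E)%E)//; exact: integrableZl.
apply: eqc; rewrite reimE /cint/=.
  under eq_Rintegral do rewrite ReM.
  by rewrite RintegralB ?RintegralZl//; exact: Z.
under eq_Rintegral do rewrite ImM.
by rewrite RintegralD ?RintegralZl//; exact: Z.
Qed.

Lemma cintZr (c : R[i]) f : cL1 f -> cint (fun x => f x * c) = cint f * c.
Proof. by move=> fL; rewrite mulrC -cintZ//; congr cint; apply/funext => x; exact: mulrC. Qed.

Lemma cintN f : cL1 f -> cint (fun x => - f x) = - cint f.
Proof.
move=> fL; rewrite -mulN1r -cintZ//.
by congr cint; apply/funext => x; rewrite mulN1r.
Qed.

Lemma cintB f g : cL1 f -> cL1 g -> cint (fun x => f x - g x) = cint f - cint g.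
Proof. by move=> fL gL; rewrite cintD ?cintN//; exact: cL1N. Qed.

Lemma cintJ f : cL1 f -> cint (fun x => conjc (f x)) = conjc (cint f).
Proof.
move=> [fr fi]; rewrite /cint /=; congr (_ +i* _).
  by apply: eq_Rintegral => x _; rewrite ReJ.
rewrite -mulN1r -RintegralZl//; apply: eq_Rintegral => x _.
by rewrite ImJ mulN1r.
Qed.

Lemma eq_cint f g : (forall x, f x = g x) -> cint f = cint g.
Proof. by move=> /funext ->. Qed.

Lemma cint_real (h : T -> R) : cint (fun x => (h x)%:C) = (\int[mu]_x h x)%R%:C.
Proof.
by rewrite /cint/=; congr (_ +i* _); rewrite /Rintegral/= integral0.
Qed.

(* rotate the integral onto the positive real axis *)
Lemma normc_cint_le f : cmeas f -> ((normc (cint f))%:E <= absint f)%E.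
Proof.
move=> mf; have [foo|] := ltP (absint f) +oo%E; last first.
  by rewrite leye_eq => /eqP ->; rewrite leey.
have fL : cL1 f by exact/cL1P.
rewrite /absint -Rint_fineK//; last by move=> x; exact: normc_ge0.
rewrite lee_fin; set A := (\int[mu]_x _)%R.
have A0 : 0 <= A by apply: Rintegral_ge0 => x _; exact: normc_ge0.
have [z0|z0] := eqVneq (normc (cint f)) 0; first by rewrite z0.
have zp : 0 < normc (cint f) by rewrite lt_neqAle eq_sym z0 normc_ge0.
rewrite -(ler_pM2l zp) -expr2 sqr_normc.
set z := cint f.
have -> : sqn z = (\int[mu]_x Re (conjc z * f x))%R.
  have : cint (fun x => conjc z * f x) = conjc z * z by rewrite cintZ.
  by move/(congr1 (@complex.Re R)); rewrite mulrC mulJ /= => ->.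
have iN : mu.-integrable setT (EFin \o (fun x => normc (f x))).
  by apply: integrable_ge0P => //;
    [move=> x; exact: normc_ge0|exact: measurable_normc].
rewrite -RintegralZl//; apply: le_Rintegral => //.
- exact: (cL1Z (conjc z) fL).1.
- by rewrite (_ : _ \o _ = fun x => ((normc z)%:E * (normc (f x))%:E)%E)//; exact: integrableZl.
- move=> x _; apply: le_trans (ler_norm _) _; apply: le_trans (normc_Re _) _.
  by rewrite Normc.normcM normcJ.
Qed.

Lemma cint_ae f g : cmeas f -> cmeas g -> {ae mu, forall x, f x = g x} ->
  cint f = cint g.
Proof.
move=> mf mg fg; rewrite /cint; congr (_ +i* _); congr fine;
  apply: ae_eq_integral => //; try (by apply/measurable_EFinP; apply mf);
  try (by apply/measurable_EFinP; apply mg);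
  by apply: filterS fg => x ->.
Qed.

Lemma sqint_ae f g : cmeas f -> cmeas g -> {ae mu, forall x, f x = g x} ->
  sqint f = sqint g.
Proof.
move=> mf mg fg; apply: ae_eq_integral => //;
  try (by apply/measurable_EFinP; exact: measurable_sqn).
by apply: filterS fg => x ->.
Qed.

(** On A one has |f| <= 1 + |f|^2, and both terms on the right are integrable there. *)
Lemma cL1_fin_supp f (A : set T) : measurable A -> (mu A < +oo)%E -> cmeas f ->
  (sqint f < +oo)%E -> cL1 (fun x => (\1_A x)%:C * f x).
Proof.
move=> mA Aoo mf foo.
apply: (@cL1_le _ (fun x => \1_A x + sqn (f x))).
- exact: cmeas_indic.
- by apply: measurable_funD; [exact: measurable_indic|exact: measurable_sqn].
- move=> x; rewrite Normc.normcM normc_real indicE -sqr_normc.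
  have := normc_ge0 (f x); case: (x \in A) => /= ?.
    by rewrite normr1; have := sqr_ge0 (normc (f x) - 1); nra.
  by rewrite normr0; have := sqr_ge0 (normc (f x)); nra.
- rewrite ge0_intD//.
  + rewrite integral_indic// setIT; exact: lte_add_pinfty.
  + by move=> x; exact: sqn_ge0.
  + exact: measurable_sqn.
Qed.

End complex_integral.

(** * Fubini and Tonelli for complex-valued functions *)

Section complex_fubini.
Context d1 d2 (T1 : measurableType d1) (T2 : measurableType d2) {R : realType}.
Variables (m1 : {sigma_finite_measure set T1 -> \bar R})
          (m2 : {sigma_finite_measure set T2 -> \bar R}).
Implicit Types F : T1 * T2 -> R[i].

(** The extended integral is the difference of two Tonelli integrals, each measurable, and [fine]
    preserves measurability, whatever happens on slices where the integral is infinite or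
    undefined. *)
Lemma measurable_int2 (h : T1 * T2 -> R) : measurable_fun setT h ->
  measurable_fun setT (fun x => \int[m2]_y h (x, y))%R.
Proof.
move=> mh; apply: measurableT_comp => //.
have mE : measurable_fun setT (EFin \o h) by exact/measurable_EFinP.
rewrite [X in measurable_fun _ X](_ : _ = (fun x => fubini_F m2 (EFin \o h)^\+ x -
    fubini_F m2 (EFin \o h)^\- x)%E); last first.
  apply/funext => x; rewrite integralE /fubini_F.
  by congr (_ - _)%E; apply: eq_integral => y _; rewrite ?(funeposE, funenegE).
by apply: emeasurable_funB; apply: measurable_fun_fubini_tonelli_F => //;
  [exact: measurable_funepos|exact: measurable_funeneg].
Qed.

Lemma measurable_int1 (h : T1 * T2 -> R) : measurable_fun setT h ->
  measurable_fun setT (fun y => \int[m1]_x h (x, y))%R.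
Proof.
move=> mh; apply: measurableT_comp => //.
have mE : measurable_fun setT (EFin \o h) by exact/measurable_EFinP.
rewrite [X in measurable_fun _ X](_ : _ = (fun x => fubini_G m1 (EFin \o h)^\+ x -
    fubini_G m1 (EFin \o h)^\- x)%E); last first.
  apply/funext => x; rewrite integralE /fubini_G.
  by congr (_ - _)%E; apply: eq_integral => y _; rewrite ?(funeposE, funenegE).
by apply: emeasurable_funB; apply: measurable_fun_fubini_tonelli_G => //;
  [exact: measurable_funepos|exact: measurable_funeneg].
Qed.

Lemma cmeas_cint2 F : cmeas F -> cmeas (fun x => cint m2 (fun y => F (x, y))).
Proof. by move=> [Fr Fi]; split; [exact: measurable_int2 Fr|exact: measurable_int2 Fi]. Qed.

Lemma cmeas_cint1 F : cmeas F -> cmeas (fun y => cint m1 (fun x => F (x, y))).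
Proof. by move=> [Fr Fi]; split; [exact: measurable_int1 Fr|exact: measurable_int1 Fi]. Qed.

Lemma cmeas_pair1 F x : cmeas F -> cmeas (fun y => F (x, y)).
Proof. by move=> mF; apply: (cmeas_comp (h := pair x) _ mF). Qed.

Lemma cmeas_pair2 F y : cmeas F -> cmeas (fun x => F (x, y)).
Proof. by move=> mF; apply: (cmeas_comp (h := pair^~ y) _ mF). Qed.

End complex_fubini.

Section product_integrals.
Context d1 d2 (T1 : measurableType d1) (T2 : measurableType d2) {R : realType}.
Variables (m1 : {sigma_finite_measure set T1 -> \bar R})
          (m2 : {sigma_finite_measure set T2 -> \bar R}).
Implicit Types F : T1 * T2 -> R[i].

(** The real and the extended inner integral may differ on slices where the latter is infinite; they
    agree on almost every slice, which is all that the outer integral sees. *)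
Lemma Rint_prod12 (h : T1 * T2 -> R) :
  (m1 \x m2)%E.-integrable setT (EFin \o h) ->
  (\int[(m1 \x m2)%E]_z h z = \int[m1]_x \int[m2]_y h (x, y))%R.
Proof.
move=> ih; rewrite {1}/Rintegral -(integral12_prod_meas1 ih) /Rintegral /fubini_F.
have mh : measurable_fun setT h by apply/measurable_EFinP; exact: measurable_int ih.
congr fine; apply: ae_eq_integral => //.
- exact: measurable_fubini_F ih.
- by apply/measurable_EFinP; exact: measurable_int2.
- apply: filterS (ae_integrable1 ih) => x ix _ /=.
  by rewrite /Rintegral fineK//; exact: integrable_fin_num.
Qed.

Lemma Rint_prod21 (h : T1 * T2 -> R) :
  (m1 \x m2)%E.-integrable setT (EFin \o h) ->
  (\int[(m1 \x m2)%E]_z h z = \int[m2]_y \int[m1]_x h (x, y))%R.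
Proof.
move=> ih; rewrite {1}/Rintegral -(integral21_prod_meas1 ih) /Rintegral /fubini_G.
have mh : measurable_fun setT h by apply/measurable_EFinP; exact: measurable_int ih.
congr fine; apply: ae_eq_integral => //.
- exact: measurable_fubini_G ih.
- by apply/measurable_EFinP; exact: measurable_int1.
- apply: filterS (ae_integrable2 ih) => x ix _ /=.
  by rewrite /Rintegral fineK//; exact: integrable_fin_num.
Qed.

Lemma cint_prod12 F : cL1 (m1 \x m2)%E F ->
  cint (m1 \x m2)%E F = cint m1 (fun x => cint m2 (fun y => F (x, y))).
Proof.
by move=> [Fr Fi]; rewrite /cint/=; congr (_ +i* _); exact: Rint_prod12.
Qed.

Lemma cint_prod21 F : cL1 (m1 \x m2)%E F ->
  cint (m1 \x m2)%E F = cint m2 (fun y => cint m1 (fun x => F (x, y))).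
Proof.
by move=> [Fr Fi]; rewrite /cint/=; congr (_ +i* _); exact: Rint_prod21.
Qed.

Lemma absint_prod12 F : cmeas F ->
  absint (m1 \x m2)%E F = (\int[m1]_x absint m2 (fun y => F (x, y)))%E.
Proof.
move=> mF; rewrite /absint fubini_tonelli1//.
- by apply/measurable_EFinP; exact: measurable_normc.
- by move=> x; rewrite lee_fin normc_ge0.
Qed.

Lemma absint_prod21 F : cmeas F ->
  absint (m1 \x m2)%E F = (\int[m2]_y absint m1 (fun x => F (x, y)))%E.
Proof.
move=> mF; rewrite /absint fubini_tonelli2//.
- by apply/measurable_EFinP; exact: measurable_normc.
- by move=> x; rewrite lee_fin normc_ge0.
Qed.

Lemma sqint_prod12 F : cmeas F ->
  sqint (m1 \x m2)%E F = (\int[m1]_x sqint m2 (fun y => F (x, y)))%E.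
Proof.
move=> mF; rewrite /sqint fubini_tonelli1//.
- by apply/measurable_EFinP; exact: measurable_sqn.
- by move=> x; rewrite lee_fin sqn_ge0.
Qed.

Lemma sqint_prod21 F : cmeas F ->
  sqint (m1 \x m2)%E F = (\int[m2]_y sqint m1 (fun x => F (x, y)))%E.
Proof.
move=> mF; rewrite /sqint fubini_tonelli2//.
- by apply/measurable_EFinP; exact: measurable_sqn.
- by move=> x; rewrite lee_fin sqn_ge0.
Qed.

Lemma cL1_prod12 F : cmeas F ->
  (\int[m1]_x absint m2 (fun y => F (x, y)) < +oo)%E -> cL1 (m1 \x m2)%E F.
Proof. by move=> mF Foo; apply/cL1P; split=> //; rewrite absint_prod12. Qed.

Lemma cint_swap F : cL1 (m1 \x m2)%E F ->
  cint m1 (fun x => cint m2 (fun y => F (x, y))) =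
  cint m2 (fun y => cint m1 (fun x => F (x, y))).
Proof. by move=> FL; rewrite -cint_prod12// cint_prod21. Qed.

Lemma ae_cL1_2 F : cL1 (m1 \x m2)%E F ->
  {ae m2, forall y, cL1 m1 (fun x => F (x, y))}.
Proof.
move=> [Fr Fi]; apply: filterS2 (ae_integrable2 Fr) (ae_integrable2 Fi).
by move=> y; split.
Qed.

Lemma measurable_sqint1 F : cmeas F ->
  measurable_fun setT (fun y => sqint m1 (fun x => F (x, y))).
Proof.
move=> mF; apply: (measurable_fun_fubini_tonelli_G (fun z => (sqn (F z))%:E)).
  by apply/measurable_EFinP; exact: measurable_sqn.
by move=> z; rewrite lee_fin sqn_ge0.
Qed.

Lemma measurable_sqint2 F : cmeas F ->
  measurable_fun setT (fun x => sqint m2 (fun y => F (x, y))).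
Proof.
move=> mF; apply: (measurable_fun_fubini_tonelli_F (fun z => (sqn (F z))%:E)).
  by apply/measurable_EFinP; exact: measurable_sqn.
by move=> z; rewrite lee_fin sqn_ge0.
Qed.

End product_integrals.

(* Plancherel's identity for the kernel e^{-i b(x, xi)}, stated for all of L1:
   both sides may be infinite. *)
Definition phase_ft d (T : measurableType d) (R : realType)
    (mu : {measure set T -> \bar R}) (b : T -> T -> R) (f : T -> R[i]) (xi : T) :=
  cint mu (fun x => expi (- b xi x) * f x).

Definition plancherel d (T : measurableType d) (R : realType)
    (mu : {measure set T -> \bar R}) (b : T -> T -> R) (k : R) :=
  forall f, cL1 mu f -> (sqint mu (phase_ft mu b f) = k%:E * sqint mu f)%E.

(** * Plancherel's identity for product measures *)

Section tensor.
Context d1 d2 (T1 : measurableType d1) (T2 : measurableType d2) {R : realType}.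
Variables (m1 : {sigma_finite_measure set T1 -> \bar R})
          (m2 : {sigma_finite_measure set T2 -> \bar R}).
Variables (b1 : T1 -> T1 -> R) (b2 : T2 -> T2 -> R) (k1 k2 : R).
Hypothesis mb1 : measurable_fun setT (fun z : T1 * T1 => b1 z.1 z.2).
Hypothesis mb2 : measurable_fun setT (fun z : T2 * T2 => b2 z.1 z.2).
Hypotheses (k1_ge0 : 0 <= k1) (k2_ge0 : 0 <= k2).

Let b (z w : T1 * T2) : R := b1 z.1 w.1 + b2 z.2 w.2.

(** [P1] is applied in the first variable at fixed x2, then [P2] in the second variable at fixed
    xi1. Slices of an L1 function are in L1 for almost every point but need not be in L2, which is
    why [plancherel] is an identity between possibly infinite quantities on all of L1. *)
Lemma plancherel_tensor : plancherel m1 b1 k1 -> plancherel m2 b2 k2 ->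
  plancherel (sf_product m1 m2) b (k1 * k2).
Proof.
move=> P1 P2 f fL.
have mf := cL1_meas fL.
(* partial transform in the first variable, at (xi1, x2) *)
pose h (z : T1 * T2) := cint m1 (fun x1 => expi (- b1 z.1 x1) * f (x1, z.2)).
pose K1 (p : T1 * (T1 * T2)) := expi (- b1 p.2.1 p.1) * f (p.1, p.2.2).
have mK1 : cmeas K1.
  apply: cmeasM.
    apply: cmeas_expi; apply: measurableT_comp => //.
    by apply: (measurableT_comp mb1 (g := fun p => (p.2.1, p.1))); mproj.
  by apply: (cmeas_comp (h := fun p => (p.1, p.2.2)) _ mf); mproj.
have mh : cmeas h by exact: (cmeas_cint1 m1 mK1).
have me2 : cmeas (fun p : (T1 * T2) * T2 => expi (- b2 p.1.2 p.2)).
  apply: cmeas_expi; apply: measurableT_comp => //.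
  by apply: (measurableT_comp mb2 (g := fun p => (p.1.2, p.2))); mproj.
pose K2 (p : (T1 * T2) * T2) := expi (- b2 p.1.2 p.2) * h (p.1.1, p.2).
have mK2 : cmeas K2.
  apply: cmeasM => //.
  by apply: (cmeas_comp (h := fun p => (p.1.1, p.2)) _ mh); mproj.
have mb : measurable_fun setT (fun z : (T1 * T2) * (T1 * T2) => b z.1 z.2).
  apply: measurable_funD.
    by apply: (measurableT_comp mb1 (g := fun p => (p.1.1, p.2.1))); mproj.
  by apply: (measurableT_comp mb2 (g := fun p => (p.1.2, p.2.2))); mproj.
have mbz z : measurable_fun setT (b z).
  by apply: (measurableT_comp mb (g := fun p => (z, p))); mproj.
(* Only almost every slice of f at fixed x2 is integrable, so identities in x2 that involve [h] hold
   up to a null set. *)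
have slices := ae_cL1_2 fL.
have FT2 z : phase_ft (sf_product m1 m2) b f z =
    cint m2 (fun x2 => K2 (z, x2)).
  rewrite /phase_ft.
  have eL : cL1 (m1 \x m2)%E (fun x => expi (- b z x) * f x).
    apply: (@cL1_bM _ _ _ _ (fun x => expi (- b z x)) _ 1) => //.
      by apply: cmeas_expi; exact: measurableT_comp.
    by move=> x; rewrite expi_normc.
  rewrite [LHS](cint_prod21 eL); apply: cint_ae.
  - exact: (cmeas_cint1 m1 (cL1_meas eL)).
  - exact: cmeas_pair1 mK2.
  - apply: filterS slices => x2 fx2.
    rewrite /K2/= /h/= -cintZ; last first.
      apply: (@cL1_bM _ _ _ _ (fun x => expi (- b1 z.1 x)) _ 1) => //.
        apply: cmeas_expi; apply: measurableT_comp => //.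
        by apply: (measurableT_comp mb1 (g := fun p => (z.1, p))); mproj.
      by move=> x; rewrite expi_normc.
    by apply: eq_cint => x1; rewrite mulrA -expiD /b opprD addrC.
(* This holds at every frequency [x1]: the modulus of [h (x1, x2)] is at most the L1 norm of the
   slice at x2, which is integrable in x2. *)
have hL x1 : cL1 m2 (fun x2 => h (x1, x2)).
  apply/cL1P; split; first exact: cmeas_pair1 mh.
  have /cL1P[_] := fL; rewrite [absint _ _](absint_prod21 m1 m2 mf).
  apply: le_lt_trans; apply: ge0_le_integral => //.
  - by move=> x2 _; rewrite lee_fin normc_ge0.
  - by apply/measurable_EFinP/measurable_normc; exact: cmeas_pair1 mh.
  - apply: (measurable_fun_fubini_tonelli_G (fun z => (normc (f z))%:E)).
      by apply/measurable_EFinP; exact: measurable_normc.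
    by move=> z; rewrite lee_fin normc_ge0.
  - move=> x2 _; apply: le_trans (normc_cint_le _ _) _.
      exact: (cmeas_pair2 (x1, x2) mK1).
    rewrite le_eqVlt; apply/orP; left; apply/eqP.
    by apply: eq_integral => y _; rewrite Normc.normcM expi_normc mul1r.
have -> : sqint (sf_product m1 m2) (phase_ft (sf_product m1 m2) b f) =
    (\int[m1]_x1 (k2%:E * sqint m2 (fun x2 => h (x1, x2))))%E.
  have -> : phase_ft (sf_product m1 m2) b f = fun z => cint m2 (fun x2 => K2 (z, x2)).
    exact/funext.
  rewrite [LHS](sqint_prod12 m1 m2); last exact: (cmeas_cint2 m2 mK2).
  by apply: eq_integral => x1 _; rewrite -P2.
rewrite ge0_integralZl_EFin//; last 2 first.
  - by move=> x _; exact: sqint_ge0.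
  - exact: measurable_sqint2.
rewrite -sqint_prod12// sqint_prod21//.
rewrite (_ : (\int[m2]_y _ = k1%:E * sqint (sf_product m1 m2) f)%E); last first.
  rewrite [X in (_ * X)%E](sqint_prod21 m1 m2 mf) -ge0_integralZl_EFin//; last 2 first.
  - by move=> x _; exact: sqint_ge0.
  - exact: measurable_sqint1.
  apply: ae_eq_integral => //.
  - exact: measurable_sqint1.
  - by apply: measurable_funeM; exact: measurable_sqint1.
  - by apply: filterS slices => x2 fx2 _; rewrite -P1.
by rewrite muleA -EFinM mulrC.
Qed.

End tensor.

(** * Measure-preserving maps *)

Section measure_preserving.
Context d (T : measurableType d) {R : realType}.
Variable mu : {measure set T -> \bar R}.

Definition mpres (phi : T -> T) :=
  measurable_fun setT phi /\
  forall A, measurable A -> mu (phi @^-1` A) = mu A.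

Variable phi : T -> T.
Hypothesis mp : mpres phi.

Lemma mpres_ge0_int (f : T -> \bar R) : measurable_fun setT f ->
  (forall x, 0 <= f x)%E -> (\int[mu]_x f (phi x) = \int[mu]_x f x)%E.
Proof.
move=> mf f0; have [mphi mE] := mp.
transitivity (\int[pushforward mu phi]_x f x)%E.
  by rewrite ge0_integral_pushforward//; apply: eq_integral.
by apply: eq_measure_integral => A mA _; exact: mE.
Qed.

(** Both sides are differences of integrals of the positive and negative parts, so the nonnegative
    case settles it even when these are infinite. *)
Lemma mpres_int (f : T -> \bar R) : measurable_fun setT f ->
  (\int[mu]_x f (phi x) = \int[mu]_x f x)%E.
Proof.
move=> mf; rewrite integralE [RHS]integralE.
have -> : (\int[mu]_x (f^\+)%E x = \int[mu]_x (f^\+)%E (phi x))%E.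
  by rewrite mpres_ge0_int//; exact: measurable_funepos.
have -> : (\int[mu]_x (f^\-)%E x = \int[mu]_x (f^\-)%E (phi x))%E.
  by rewrite mpres_ge0_int//; exact: measurable_funeneg.
by congr (_ - _)%E; apply: eq_integral => y _; rewrite ?(funeposE, funenegE).
Qed.

Lemma mpres_ae (P : T -> Prop) : {ae mu, forall x, P x} ->
  {ae mu, forall x, P (phi x)}.
Proof.
move=> [N [mN N0 PN]]; have [mphi mE] := mp.
exists (phi @^-1` N); split.
- by rewrite -[X in measurable X]setTI; exact: mphi.
- by have /= -> := mE _ mN.
- by move=> x /= nPx; apply: PN.
Qed.

End measure_preserving.

Section product_preserving.
Context d1 d2 (T1 : measurableType d1) (T2 : measurableType d2) {R : realType}.
Variables (m1 : {sigma_finite_measure set T1 -> \bar R})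
          (m2 : {sigma_finite_measure set T2 -> \bar R}).

(** The product measure integrates the measures of sections: [mE2] treats each section, and
    invariance of [m1] the integral over the sections. *)
Lemma mpres_prod (phi1 : T1 -> T1) (phi2 : T2 -> T2) :
  mpres m1 phi1 -> mpres m2 phi2 ->
  mpres (sf_product m1 m2) (fun z => (phi1 z.1, phi2 z.2)).
Proof.
move=> mp1 mp2; have [mphi1 mE1] := mp1; have [mphi2 mE2] := mp2.
have mphi : measurable_fun setT (fun z : T1 * T2 => (phi1 z.1, phi2 z.2)).
  by apply: measurable_fun_pair; [apply: (measurableT_comp mphi1)|apply: (measurableT_comp mphi2)].
split=> // A mA.
rewrite /sf_product/= /product_measure1.
apply: etrans (mpres_ge0_int mp1 (f := m2 \o xsection A) _ _); last 2 first.
- exact: measurable_fun_xsection.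
- by move=> x; exact: measure_ge0.
apply: eq_integral => x _ /=; rewrite -[RHS]mE2; last exact: measurable_xsection.
by congr (m2 _); apply/seteqP; split => y; rewrite /= /xsection/= !inE.
Qed.

End product_preserving.

Section lebesgue_affine.
Context {R : realType}.
Notation mu := (@lebesgue_measure R).
Let Rm := measurableTypeR R.

(** Lebesgue measure is determined by its values on half-open intervals, and the image measure has
    the right ones. *)
Lemma mpres_shift (c : R) : mpres mu ((fun x => x - c) : Rm -> Rm).
Proof.
have mphi : measurable_fun setT ((fun x => x - c) : Rm -> Rm).
  by apply: measurable_funB => //; exact: measurable_id.
split=> // A mA; apply/esym.
pose m := pushforward mu ((fun x => x - c) : Rm -> Rm).
have : mu A = m A; last by [].
apply: lebesgue_measure_unique => //= _ [[a b]] _ <-.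
rewrite /m /pushforward.
rewrite (_ : _ @^-1` _ = `]a + c, b + c]%classic); last first.
  by apply/seteqP; split => x /=; rewrite !in_itv/= ltrBrDr lerBlDr.
rewrite !lebesgue_measure_itv/= !lte_fin ltrD2r; case: ifP => // _.
by rewrite -!EFinB; congr EFin; ring.
Qed.

Lemma mpres_opp : mpres mu (-%R : Rm -> Rm).
Proof. by split=> // A mA; exact: lebesgue_measureN. Qed.

Lemma mpres_csub (c : R) : mpres mu ((fun x => c - x) : Rm -> Rm).
Proof.
have [m1 h1] := mpres_opp; have [m2 h2] := mpres_shift (- c).
split; first by apply: measurable_funB => //; exact: measurable_id.
move=> A mA; rewrite -[RHS](h2 A mA) -[RHS]h1; last first.
  by rewrite -[X in measurable X]setTI; exact: m2.
by congr (mu _); apply/seteqP; split => x /=; rewrite opprK addrC.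
Qed.

Lemma ge0_int_scale (a : R) (f : R -> \bar R) : 0 < a ->
  measurable_fun (setT : set Rm) f -> (forall x, 0 <= f x)%E ->
  (\int[mu]_x f x = a%:E * \int[mu]_x f (a * x)%R)%E.
Proof.
move=> a0 mf f0.
pose phi : Rm -> Rm := fun x => a * x.
have mphi : measurable_fun setT phi.
  by apply: measurable_funM => //; exact: measurable_id.
have mE (A : set Rm) : measurable A ->
    mu A = pushforward (mscale (NngNum (ltW a0)) mu) phi A.
  move=> mA; apply: lebesgue_measure_unique => //= _ [[u v]] _ <-.
  rewrite /pushforward /mscale/=.
  rewrite (_ : _ @^-1` _ = `]u / a, v / a]%classic); last first.
    apply/seteqP; split => x /=; rewrite !in_itv/= /phi.
      by rewrite ltr_pdivrMr// ler_pdivlMr// ![x * a]mulrC.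
    by rewrite ltr_pdivrMr// ler_pdivlMr// ![x * a]mulrC.
  rewrite !lebesgue_measure_itv/= !lte_fin ltr_pM2r ?invr_gt0//.
  case: ifP => _; last by rewrite mule0.
  by rewrite -!EFinB -EFinM; congr EFin; field; rewrite gt_eqF.
transitivity (\int[pushforward (mscale (NngNum (ltW a0)) mu) phi]_x f x)%E; last first.
  rewrite ge0_integral_pushforward// preimage_setT ge0_integral_mscale//.
    exact: (measurableT_comp mf mphi).
  by move=> x _; exact: f0.
by apply: eq_measure_integral => A mA _; exact: mE.
Qed.

End lebesgue_affine.

(** * Fatou's lemma *)

Section fatou_le.
Context d (T : measurableType d) {R : realType}.
Variable mu : {measure set T -> \bar R}.

(** The form in which both inequalities of Plancherel on the line are obtained, once with the
    damping tending to 1 and once with the tent tending to a point mass. [M] may be infinite. *)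
Lemma fatou_cvg_le (h : (T -> R)^nat) (g : T -> R) (M : \bar R) :
  (forall n, measurable_fun setT (h n)) -> (forall n x, 0 <= h n x) ->
  measurable_fun setT g ->
  {ae mu, forall x, h ^~ x @ \oo --> g x} ->
  (forall n, \int[mu]_x (h n x)%:E <= M)%E -> (\int[mu]_x (g x)%:E <= M)%E.
Proof.
move=> mh h0 mg hg hM.
have mhE n : measurable_fun setT (fun x => (h n x)%:E) by exact/measurable_EFinP.
have -> : (\int[mu]_x (g x)%:E = \int[mu]_x limn_einf (fun n => (h n x)%:E))%E.
  apply: ae_eq_integral => //; first exact/measurable_EFinP.
  - rewrite (_ : (fun x => _) =
        fun x => - limn_esup (fun n => - (h n x)%:E))%E; last first.
      apply/funext => x; rewrite -limn_einfN; congr limn_einf.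
      by apply/funext => n /=; rewrite opprK.
    apply: measurableT_comp => //; apply: measurable_fun_limn_esup => n.
    exact: measurableT_comp.
  - apply: filterS hg => x hx _ /=.
    have hE : (fun n => (h n x)%:E) @ \oo --> (g x)%:E.
      by apply: cvg_EFin => //; exact: nearW.
    rewrite is_cvg_limn_einfE; last by apply/cvg_ex; exists (g x)%:E.
    by apply/esym/cvg_lim.
apply: le_trans (fatou _ measurableT mhE _) _.
  by move=> n x _; rewrite lee_fin.
rewrite limn_einf_lim; apply: lime_le; first exact: is_cvg_einfs.
apply: nearW => n; apply: le_trans (hM n).
by apply: ereal_inf_lbound; exists n => /=.
Qed.

End fatou_le.

(** * The transform of an L1 function and its adjoint *)

Section adjoint.
Context d (T : measurableType d) {R : realType}.
Variable mu : {sigma_finite_measure set T -> \bar R}.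
Variable b : T -> T -> R.
Hypothesis mb : measurable_fun setT (fun z : T * T => b z.1 z.2).

Lemma measurable_phase1 xi : measurable_fun setT (b xi).
Proof. by apply: (measurableT_comp mb (g := fun p => (xi, p))); mproj. Qed.

Lemma measurable_phase2 x : measurable_fun setT (b ^~ x).
Proof. by apply: (measurableT_comp mb (g := fun p => (p, x))); mproj. Qed.

Lemma cmeas_expi_phase : cmeas (fun z : T * T => expi (- b z.1 z.2)).
Proof. by apply: cmeas_expi; exact: measurableT_comp. Qed.

Lemma cL1_expi f xi : cL1 mu f -> cL1 mu (fun x => expi (- b xi x) * f x).
Proof.
apply: (@cL1_bM _ _ _ _ (fun x => expi (- b xi x)) _ 1).
  exact: (cmeas_pair1 xi cmeas_expi_phase).
by move=> x; rewrite expi_normc.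
Qed.

Lemma cmeas_phase_ft f : cmeas f -> cmeas (phase_ft mu b f).
Proof.
move=> mf; apply: (cmeas_cint2 mu (F := fun z => expi (- b z.1 z.2) * f z.2)).
apply: cmeasM; first exact: cmeas_expi_phase.
by apply: (cmeas_comp _ mf); mproj.
Qed.

Lemma phase_ft_le f xi : cmeas f ->
  ((normc (phase_ft mu b f xi))%:E <= absint mu f)%E.
Proof.
move=> mf; apply: le_trans (normc_cint_le _ _) _.
  by apply: cmeasM => //; exact: (cmeas_pair1 xi cmeas_expi_phase).
rewrite le_eqVlt; apply/orP; left; apply/eqP.
by apply: eq_integral => y _; rewrite Normc.normcM expi_normc mul1r.
Qed.

Lemma phase_ftB f g xi : cL1 mu f -> cL1 mu g ->
  phase_ft mu b (fun x => f x - g x) xi = phase_ft mu b f xi - phase_ft mu b g xi.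
Proof.
move=> fL gL; rewrite /phase_ft -cintB; [|exact: cL1_expi..].
by apply: eq_cint => x; rewrite mulrBr.
Qed.

(** Fubini on the product: the modulus of [F] is |f| |g|, which is integrable because f and g are.
    The adjoint kernel is the conjugate one with its arguments exchanged. *)
Lemma phase_ft_adjoint f g : cL1 mu f -> cL1 mu g ->
  cint mu (fun xi => phase_ft mu b f xi * conjc (g xi)) =
  cint mu (fun x => f x * conjc (phase_ft mu (fun x xi => - b xi x) g x)).
Proof.
move=> fL gL; have mf := cL1_meas fL; have mg := cL1_meas gL.
pose F (z : T * T) := expi (- b z.1 z.2) * f z.2 * conjc (g z.1).
have mF : cmeas F.
  apply: cmeasM; last first.
    by apply: cmeasJ; apply: (cmeas_comp _ mg); mproj.
  by apply: cmeasM; [exact: cmeas_expi_phase|apply: (cmeas_comp _ mf); mproj].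
have FL : cL1 (mu \x mu)%E F.
  apply: cL1_prod12 => //.
  have E xi : absint mu (fun y => F (xi, y)) = ((normc (g xi))%:E * absint mu f)%E.
    rewrite /absint -ge0_integralZl_EFin//.
    - by apply: eq_integral => x _; rewrite /F !Normc.normcM expi_normc mul1r normcJ mulrC EFinM.
    - by move=> x _; rewrite lee_fin normc_ge0.
    - exact/measurable_EFinP/measurable_normc.
    - exact: normc_ge0.
  under eq_integral do rewrite E.
  have /cL1P[_ foo] := fL; have /cL1P[_ goo] := gL.
  rewrite ge0_integralZr//.
  - by apply: lte_mul_pinfty => //; [exact: absint_ge0|rewrite ge0_fin_numE//; exact: absint_ge0].
  - exact/measurable_EFinP/measurable_normc.
  - by move=> x _; rewrite lee_fin normc_ge0.
  - exact: absint_ge0.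
transitivity (cint mu (fun xi => cint mu (fun x => F (xi, x)))).
  by apply: eq_cint => xi; rewrite /F /= cintZr//; exact: cL1_expi.
rewrite cint_swap//; apply: eq_cint => x.
have eL : cL1 mu (fun xi => expi (b xi x) * g xi).
  apply: (@cL1_bM _ _ _ _ (fun xi => expi (b xi x)) _ 1) => //.
    by apply: cmeas_expi; exact: measurable_phase2.
  by move=> xi; rewrite expi_normc.
have -> : phase_ft mu (fun x xi => - b xi x) g x =
    cint mu (fun xi => expi (b xi x) * g xi).
  by apply: eq_cint => xi; rewrite opprK.
rewrite -(cintJ eL) -cintZ; last exact: cL1J.
apply: eq_cint => xi; rewrite /F conjM expiJ; ring.
Qed.

Lemma sqint_phase_ftN f : cL1 mu f ->
  sqint mu (phase_ft mu (fun x xi => - b x xi) f) =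
  sqint mu (phase_ft mu b (fun x => conjc (f x))).
Proof.
move=> fL; apply: eq_integral => xi _; congr EFin; rewrite -[LHS]sqnJ; congr sqn.
rewrite /phase_ft -cintJ.
  by apply: eq_cint => x; rewrite conjM expiJ opprK.
apply: (@cL1_bM _ _ _ _ (fun x => expi (- - b xi x)) _ 1) => //.
  by apply: cmeas_expi; do 2 apply: measurableT_comp => //; exact: measurable_phase1.
by move=> x; rewrite expi_normc.
Qed.

Lemma sqintJ f : sqint mu (fun x => conjc (f x)) = sqint mu f.
Proof. by apply: eq_integral => x _; rewrite sqnJ. Qed.

Lemma plancherel_conj k : plancherel mu b k -> plancherel mu (fun x xi => - b x xi) k.
Proof.
by move=> P f fL; rewrite sqint_phase_ftN// P ?sqintJ//; exact: cL1J.
Qed.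

End adjoint.

(** * Plancherel's identity on the line *)

Section fejer.
Context {R : realType}.
Notation mu := (@lebesgue_measure R).
Implicit Types x t h : R.

Lemma sin_le x : 0 <= x -> sin x <= x.
Proof.
rewrite le_eqVlt => /predU1P[<-|x0]; first by rewrite sin0.
have [|c _] := @MVT R sin cos 0 x x0 (fun y _ => is_derive_sin y).
  by apply: continuous_subspaceT => y; exact: continuous_sin.
by rewrite sin0 !subr0 => ->; rewrite ler_piMl ?cos_le1// ltW.
Qed.

Lemma norm_sin_le x : `|sin x| <= `|x|.
Proof.
wlog x0 : x / 0 <= x.
  move=> H; have [|x0] := leP 0 x; first exact: H.
  by rewrite -normrN -sinN -[`|x|]normrN; apply: H; rewrite oppr_ge0 ltW.
rewrite (ger0_norm x0) ler_norml sin_le// andbT.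
have [xpi|pix] := leP x pi.
  have s0 : 0 <= sin x by apply: sin_ge0_pi; rewrite x0 xpi.
  by apply: le_trans s0; rewrite oppr_le0.
have := sin_geN1 x; have := pi_ge2 R; lra.
Qed.

Lemma cos_double x : 1 - cos x = 2 * sin (x / 2) ^+ 2.
Proof. by rewrite {1}(splitr x) cosD -!expr2 cos2sin2; ring. Qed.

Lemma onemcos_le x : 1 - cos x <= x ^+ 2 / 2.
Proof.
rewrite cos_double.
have := norm_sin_le (x / 2); rewrite -ler_sqr ?nnegrE// !real_normK ?num_real//.
by lra.
Qed.

(** At 0 the convention for division gives 0 in place of the limit 1/2. Hence the later statements
    on the limit of the damping leave out that point. *)
Definition qcos x : R := (1 - cos x) / x ^+ 2.

Lemma qcos_ge0 x : 0 <= qcos x.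
Proof. by rewrite divr_ge0 ?sqr_ge0// subr_ge0 cos_le1. Qed.

Lemma qcos_le x : qcos x <= 2^-1.
Proof.
have [->|x0] := eqVneq x 0; first by rewrite /qcos expr0n invr0 mulr0.
rewrite ler_pdivrMr; last by rewrite exprn_even_gt0.
by have := onemcos_le x; lra.
Qed.

(** After clearing denominators, 1 - cos x <= x^2 / 2 and x^2 (1 - cos x) <= 2 x^2 add up to 5/2
    x^2; the 4 leaves room. *)
Lemma qcos_le_oneDsqr x : qcos x <= 4 * (oneDsqr x)^-1.
Proof.
have [->|x0] := eqVneq x 0.
  by rewrite /qcos expr0n invr0 mulr0 mulr_ge0// invr_ge0 (le_trans ler01)// oneDsqr_ge1.
have x20 : 0 < x ^+ 2 by rewrite exprn_even_gt0.
rewrite ler_pdivrMr// mulrAC ler_pdivlMr ?(lt_le_trans ltr01 (oneDsqr_ge1 _))//.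
rewrite /oneDsqr.
have := onemcos_le x; have := cos_geN1 x; have := cos_le1 x; nra.
Qed.

Lemma measurable_qcos : measurable_fun setT qcos.
Proof.
apply: measurable_funM.
  by apply: measurable_funB => //; exact: measurable_cosc.
apply: measurable_invr_ge0; last by move=> x; exact: sqr_ge0.
exact: measurable_funX.
Qed.

End fejer.

(** * The Fejer factor and its transform, the tent *)

Section fejer_integrals.
Context {R : realType}.
Notation mu := (@lebesgue_measure R).
Implicit Types x t h : R.

Lemma int_oneDsqrV : (\int[mu]_x (oneDsqr x)^-1%:E = pi%:E)%E.
Proof.
rewrite (@ge0_symfun_integralT R (fun x => (oneDsqr x)^-1)).
- by rewrite -set_itvcy integral0y_oneDsqr -EFinM mulrC divfK.
- by move=> x; rewrite invr_ge0 (le_trans ler01)// oneDsqr_ge1.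
- exact: continuous_oneDsqrV.
- by move=> x; rewrite /oneDsqr /= sqrrN.
Qed.

Lemma qcosN x : qcos (- x) = qcos x.
Proof. by rewrite /qcos cosN sqrrN. Qed.

Lemma int_qcos_lty : (\int[mu]_x (qcos x)%:E < +oo)%E.
Proof.
have mo : measurable_fun setT (fun x : R => (oneDsqr x)^-1).
  by apply: continuous_measurable_fun; exact: continuous_oneDsqrV.
apply: (@le_lt_trans _ _ (\int[mu]_x (4 * (oneDsqr x)^-1)%:E)%E).
  apply: ge0_int_le => //.
  - exact: qcos_ge0.
  - exact: qcos_le_oneDsqr.
  - exact: measurable_qcos.
  - by apply: measurable_funM.
by rewrite ge0_intZl ?int_oneDsqrV ?ltry//.
Qed.

(** Classically this is pi. The value is never computed: finiteness and positivity are what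
    Plancherel's identity requires of it. *)
Definition qint : R := (\int[mu]_x qcos x)%R.

Lemma qintE : (qint%:E = \int[mu]_x (qcos x)%:E)%E.
Proof. by rewrite /qint Rint_fineK//; [exact: qcos_ge0|exact: int_qcos_lty]. Qed.

(** A vanishing integral would make [qcos] vanish almost everywhere, whereas it is positive on ]0,
    2[. *)
Lemma qint_gt0 : 0 < qint.
Proof.
rewrite lt_neqAle; apply/andP; split; last first.
  by apply: Rintegral_ge0 => x _; exact: qcos_ge0.
apply/eqP => q0.
have : (\int[mu]_x `|(qcos x)%:E| = 0)%E.
  rewrite -[RHS]/(0%:E) q0 qintE; apply: eq_integral => x _.
  by rewrite gee0_abs// lee_fin qcos_ge0.
move/(ae_eq_integral_abs mu measurableT) => [].
  by apply/measurable_EFinP; exact: measurable_qcos.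
move=> N [mN N0 sub].
have : (mu (`]0%R, 2%R[%classic : set R) <= mu N)%E.
  apply: le_measure; rewrite ?inE//.
  move=> x /=; rewrite in_itv/= => /andP[x0 x2]; apply: sub => /= /(_ I) [].
  apply/eqP; rewrite gt_eqF// /qcos divr_gt0 ?exprn_gt0// subr_gt0.
  have := sin2_gt0 (_ : 0 < x < 2); rewrite x0 x2 => /(_ isT) s0.
  by have := cos2Dsin2 x; have := cos_le1 x; nra.
by rewrite lebesgue_measure_itv/= lte_fin ltr0n/= N0 -EFinB subr0 lee_fin lern0.
Qed.

(** By scaling its integral is |t| [qint]. Damped cosines are combinations of such functions, so
    their integrals are combinations of absolute values: this is the origin of the formula for
    [tent]. *)
Definition ccos t x : R := (1 - cos (t * x)) / x ^+ 2.

Lemma ccosE t x : t != 0 -> ccos t x = t ^+ 2 * qcos (t * x).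
Proof.
move=> t0; rewrite /ccos /qcos exprMn (invfM (t ^+ 2)).
by rewrite [RHS]mulrCA mulVKf// expf_neq0.
Qed.

Lemma ccos_ge0 t x : 0 <= ccos t x.
Proof. by rewrite divr_ge0 ?sqr_ge0// subr_ge0 cos_le1. Qed.

Lemma ccosN t x : ccos (- t) x = ccos t x.
Proof. by rewrite /ccos mulNr cosN. Qed.

Lemma measurable_ccos t : measurable_fun setT (ccos t).
Proof.
apply: measurable_funM.
  apply: measurable_funB => //; apply: measurable_cosc.
  by apply: measurable_funM => //; exact: measurable_id.
apply: measurable_invr_ge0; last by move=> x; exact: sqr_ge0.
exact: measurable_funX.
Qed.

Lemma int_ccos t : (\int[mu]_x (ccos t x)%:E = (`|t| * qint)%:E)%E.
Proof.
wlog t0 : t / 0 <= t.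
  move=> H; have [|t0] := leP 0 t; first exact: H.
  have := H (- t); rewrite normrN => <-; last by rewrite oppr_ge0 ltW.
  by apply: eq_integral => x _; rewrite ccosN.
rewrite ger0_norm//; move: t0; rewrite le_eqVlt => /predU1P[<-|t0].
  rewrite mul0r; under eq_integral do rewrite /ccos mul0r cos0 subrr mul0r.
  by rewrite integral0.
under eq_integral do rewrite ccosE ?gt_eqF//.
rewrite ge0_intZl ?sqr_ge0//; last 2 first.
- by move=> x; exact: qcos_ge0.
- apply: (measurableT_comp measurable_qcos).
  by apply: measurable_funM => //; exact: measurable_id.
rewrite [in RHS]EFinM qintE (@ge0_int_scale R t (fun x => (qcos x)%:E))//.
- by rewrite muleA -EFinM expr2.
- by apply/measurable_EFinP; exact: measurable_qcos.
- by move=> x; rewrite lee_fin qcos_ge0.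
Qed.

Lemma integrable_ccos t : mu.-integrable setT (EFin \o ccos t).
Proof.
apply: integrable_ge0P; [exact: ccos_ge0|exact: measurable_ccos|].
by rewrite int_ccos ltry.
Qed.

Lemma Rint_ccos t : (\int[mu]_x ccos t x)%R = `|t| * qint.
Proof. by rewrite /Rintegral int_ccos. Qed.

(* the triangular kernel max(h - |t|, 0) / h^2 *)
Definition tent h t : R := (`|h + t| / 2 + `|h - t| / 2 - `|t|) / h ^+ 2.

(** The factor 2 normalizes the damping to values in [0, 1] with limit 1 as h x tends to 0. *)
Definition fejer h x : R := 2 * qcos (h * x).

Lemma fejer_ge0 h x : 0 <= fejer h x.
Proof. by rewrite mulr_ge0// qcos_ge0. Qed.

Lemma fejer_le1 h x : fejer h x <= 1.
Proof. by have := qcos_le (h * x); rewrite /fejer; lra. Qed.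

Lemma measurable_fejer h : measurable_fun setT (fejer h).
Proof.
apply: measurable_funM => //; apply: (measurableT_comp measurable_qcos).
by apply: measurable_funM => //; exact: measurable_id.
Qed.

Lemma fejerE h x : h != 0 -> fejer h x = 2 / h ^+ 2 * ccos h x.
Proof.
move=> h0; rewrite /fejer ccosE// [RHS]mulrA mulfVK//.
by rewrite expf_neq0.
Qed.

Lemma int_fejer_lty h : h != 0 -> (\int[mu]_x (fejer h x)%:E < +oo)%E.
Proof.
move=> h0; under eq_integral do rewrite fejerE//.
rewrite ge0_intZl ?int_ccos ?ltry//.
- by rewrite divr_ge0// sqr_ge0.
- by move=> x; exact: ccos_ge0.
- exact: measurable_ccos.
Qed.

Lemma cos_cos x y : cos x * cos y = (cos (x + y) + cos (x - y)) / 2.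
Proof. by rewrite cosD cosB; field. Qed.

(** 2 (1 - cos (h x)) cos (t x) is the sum of 1 - cos ((h + t) x) and 1 - cos ((h - t) x) minus
    twice 1 - cos (t x), so that after division by x^2 each term is integrable on its own. *)
Lemma Rint_fejer_cos h t : h != 0 ->
  (\int[mu]_x (fejer h x * cos (t * x)))%R = 2 * qint * tent h t.
Proof.
move=> h0.
have Z (a s : R) : mu.-integrable setT (EFin \o (fun x => a * ccos s x)).
  rewrite (_ : _ \o _ = fun x => (a%:E * (ccos s x)%:E)%E)//.
  by apply: integrableZl => //; exact: integrable_ccos.
have E x : fejer h x * cos (t * x) =
    1 / h ^+ 2 * ccos (h + t) x + 1 / h ^+ 2 * ccos (h - t) x
    - 2 / h ^+ 2 * ccos t x.
  rewrite fejerE// /ccos.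
  have := cos_cos (h * x) (t * x); rewrite -mulrDl -mulrBl => C.
  have -> : cos ((h + t) * x) = 2 * (cos (h * x) * cos (t * x)) - cos ((h - t) * x).
    by rewrite C; field.
  by ring.
under eq_Rintegral do rewrite E.
rewrite RintegralB//; last first.
  rewrite (_ : _ \o _ = fun x => ((1 / h ^+ 2 * ccos (h + t) x)%:E + (1 / h ^+ 2 * ccos (h - t) x)%:E)%E)//.
  by apply: integrableD => //; exact: Z.
rewrite RintegralD//; [|exact: Z..].
rewrite !RintegralZl//; [|exact: integrable_ccos..].
rewrite !Rint_ccos /tent; field; exact: h0.
Qed.

Lemma Rint_odd (g : R -> R) : mu.-integrable setT (EFin \o g) ->
  (forall x, g (- x) = - g x) -> (\int[mu]_x g x)%R = 0.
Proof.
move=> ig gN.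
have mg := measurable_int _ ig.
have : (\int[mu]_x g x)%R = (\int[mu]_x (-1 * g x))%R.
  rewrite /Rintegral -(mpres_int mpres_opp mg).
  by congr fine; apply: eq_integral => x _ /=; rewrite gN mulN1r.
rewrite RintegralZl//; lra.
Qed.

Lemma integrable_fejerM h (g : R -> R) : h != 0 -> measurable_fun setT g ->
  (forall x, `|g x| <= 1) -> mu.-integrable setT (EFin \o (fun x => fejer h x * g x)).
Proof.
move=> h0 mg g1.
apply: (@integrable_le_ge0 _ (measurableTypeR R) R mu _ (fejer h)).
- by apply: measurable_funM => //; exact: measurable_fejer.
- exact: measurable_fejer.
- by move=> x; rewrite normrM (ger0_norm (fejer_ge0 _ _)) ler_piMr// fejer_ge0.
- exact: int_fejer_lty.
Qed.

Lemma cint_fejer h t : h != 0 ->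
  cint mu (fun x => expi (t * x) * (fejer h x)%:C) = (2 * qint * tent h t)%:C.
Proof.
move=> h0; rewrite -[RHS]/(_ +i* 0) /cint; congr (_ +i* _).
  rewrite -Rint_fejer_cos//; apply: eq_Rintegral => x _.
  by rewrite reimE /=; ring.
transitivity (\int[mu]_x (fejer h x * sin (t * x)))%R.
  by apply: eq_Rintegral => x _; rewrite reimE /=; ring.
apply: Rint_odd.
  apply: integrable_fejerM => //; last by move=> x; exact: sin_max.
  apply: measurableT_comp.
    by apply: continuous_measurable_fun; exact: continuous_sin.
  by apply: measurable_funM => //; exact: measurable_id.
by move=> x; rewrite /fejer !mulrN qcosN sinN mulrN.
Qed.

Lemma cL1_fejer h : h != 0 -> cL1 mu (fun x => (fejer h x)%:C).
Proof. move=> h0; split => /=; last exact: integrable0.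
by apply: integrable_ge0P; [exact: fejer_ge0|exact: measurable_fejer|exact: int_fejer_lty]. Qed.

Lemma tentN h t : tent h (- t) = tent h t.
Proof. by rewrite /tent normrN opprK [`|h + t| / 2 + _]addrC. Qed.

Lemma tent_ge0 h t : 0 <= tent h t.
Proof.
rewrite divr_ge0 ?sqr_ge0//.
have := ler_normB (h + t) (h - t).
rewrite (_ : h + t - (h - t) = t * 2); last by ring.
by rewrite normrM (normr_nat _ 2); lra.
Qed.

Lemma tentE h t : 0 <= t -> t <= h -> tent h t = (h - t) / h ^+ 2.
Proof.
move=> t0 th; rewrite /tent (ger0_norm t0) !ger0_norm ?subr_ge0//; last first.
  by rewrite addr_ge0// (le_trans t0).
by congr (_ / _); field.
Qed.

Lemma tent_out h t : 0 < h -> h <= `|t| -> tent h t = 0.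
Proof.
move=> h0; wlog t0 : t / 0 <= t.
  move=> H; have [|t0] := leP 0 t; first exact: H.
  by rewrite -normrN -tentN; apply: H; rewrite oppr_ge0 ltW.
rewrite /tent (ger0_norm t0) => th.
rewrite ger0_norm ?addr_ge0 ?(ltW h0)// ler0_norm ?subr_le0//.
by rewrite (_ : _ - _ = 0) ?mul0r//; field.
Qed.

Lemma tent_le h t : 0 < h -> tent h t <= h^-1.
Proof.
move=> h0; rewrite /tent ler_pdivrMr ?exprn_gt0// expr2 mulKf ?gt_eqF//.
have := ler_normD h t; have := ler_normB h t; rewrite (gtr0_norm h0); lra.
Qed.

Lemma continuous_tent h : continuous (tent h).
Proof.
move=> t; apply: cvgM; last exact: cvg_cst.
apply: cvgB; last by apply: cvg_norm.
by apply: cvgD; apply: cvgM; try exact: cvg_cst; apply: cvg_norm;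
  [apply: cvgD|apply: cvgB]; try exact: cvg_cst; exact: cvg_id.
Qed.

Lemma measurable_tent h : measurable_fun setT (tent h).
Proof. by apply: continuous_measurable_fun; exact: continuous_tent. Qed.

Lemma int_tent h : 0 < h -> (\int[mu]_t (tent h t)%:E = 1)%E.
Proof.
move=> h0; rewrite ge0_symfun_integralT; last 3 first.
- exact: tent_ge0.
- exact: continuous_tent.
- by move=> x /=; rewrite tentN.
have -> : (\int[mu]_(x in [set x | (0 <= x)%R]) (tent h x)%:E =
    \int[mu]_(x in `[0%R, h]) ((h - x) / h ^+ 2)%:E)%E.
  rewrite -set_itvcy integral_mkcond [RHS]integral_mkcond.
  apply: eq_integral => x _; rewrite !patchE.
  have [/set_mem/=|/negP] := boolP (x \in `[0, +oo[%classic).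
    rewrite in_itv/= andbT => x0; case: ifPn => [/set_mem/=|].
      by rewrite in_itv/= => /andP[_ xh]; rewrite tentE.
    rewrite notin_setE/= in_itv/= x0/= => /negP; rewrite -ltNge => hx.
    by rewrite tent_out// ger0_norm// ltW.
  case: ifPn => // /set_mem/=; rewrite in_itv/= => /andP[x0 xh] []//.
  by rewrite mem_setE/= in_itv/= x0.
(* The primitive of (h - x) / h^2; it gains 1/2 on [0, h], half of the mass of the even function
   [tent h]. *)
pose F x : R := (h * x - x ^+ 2 / 2) / h ^+ 2.
have dF x : is_derive x 1 F ((h - x) / h ^+ 2).
  rewrite /F; apply: is_derive_eq.
  by rewrite /GRing.scale/=; field; rewrite gt_eqF.
rewrite (@continuous_FTC2 R _ F 0 h)//.
- rewrite -EFinB -EFinM /F; congr EFin; field; rewrite gt_eqF//.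
- apply: continuous_subspaceT => x; apply: cvgM; last exact: cvg_cst.
  by apply: cvgB; [exact: cvg_cst|exact: cvg_id].
- split.
  + by move=> x _; apply: ex_derive.
  + apply: cvg_at_right_filter; apply: differentiable_continuous.
    by apply/derivable1_diffP; apply: ex_derive.
  + apply: cvg_at_left_filter; apply: differentiable_continuous.
    by apply/derivable1_diffP; apply: ex_derive.
- by move=> x _; rewrite derive1E; apply: derive_val.
Qed.

End fejer_integrals.

(** * The tent as an approximate identity *)

Section approximate_identity.
Context {R : realType}.
Notation mu := (@lebesgue_measure R).
Notation Rm := (measurableTypeR R).

Lemma int_tent_shift (h x : R) : 0 < h -> (\int[mu]_y (tent h (x - y))%:E = 1)%E.
Proof.
move=> h0; rewrite (mpres_int (mpres_csub x) (f := fun y : Rm => (tent h y)%:E)) ?int_tent//.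
by apply/measurable_EFinP; exact: measurable_tent.
Qed.

Lemma measurable_tent_shift (h x : R) :
  measurable_fun (setT : set Rm) (fun y => tent h (x - y)).
Proof.
apply: (measurableT_comp (measurable_tent h)).
by apply: measurable_funB => //; exact: measurable_id.
Qed.

Lemma integrable_tentM (h x : R) (g : R -> R) : 0 < h ->
  mu.-integrable (setT : set Rm) (EFin \o g) ->
  mu.-integrable (setT : set Rm) (EFin \o (fun y => g y * tent h (x - y))).
Proof.
move=> h0 ig; have mg : measurable_fun (setT : set Rm) g.
  by apply/measurable_EFinP; exact: measurable_int ig.
have /integrableP[_ goo] := ig.
apply: (@integrable_le_ge0 _ Rm R mu _ (fun y => h^-1 * `|g y|)).
- by apply: measurable_funM => //; exact: measurable_tent_shift.
- by apply: measurable_funM => //; exact: measurableT_comp.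
- move=> y; rewrite normrM mulrC ler_wpM2r// ger0_norm ?tent_ge0//.
  exact: tent_le.
- rewrite ge0_intZl//; last 2 first.
    by rewrite invr_ge0 ltW.
    exact: measurableT_comp.
  by apply: lte_mul_pinfty => //; rewrite lee_fin invr_ge0 ltW.
Qed.

(** The tent has integral 1, height at most 1 / h and vanishes outside the ball of radius h. That
    ball has measure 2 h, so the height is twice the weight in the average; hence the 2. *)
Lemma tent_davg_le (h x : R) (g : R -> R) : 0 < h ->
  mu.-integrable (setT : set Rm) (EFin \o g) ->
  (`|(\int[mu]_y (g y * tent h (x - y)))%R - g x|%:E <= 2%:E * davg g x h)%E.
Proof.
move=> h0 ig; have mg : measurable_fun (setT : set Rm) g.
  by apply/measurable_EFinP; exact: measurable_int ig.
have it : mu.-integrable (setT : set Rm) (EFin \o (fun y => tent h (x - y))).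
  apply: integrable_ge0P => //; first by move=> y; exact: tent_ge0.
    exact: measurable_tent_shift.
  by rewrite int_tent_shift// ltry.
have -> : (\int[mu]_y (g y * tent h (x - y)))%R - g x =
    (\int[mu]_y ((g y - g x) * tent h (x - y)))%R.
  have {1}-> : g x = (\int[mu]_y (g x * tent h (x - y)))%R.
    by rewrite RintegralZl// /Rintegral int_tent_shift// mulr1.
  rewrite -RintegralB//; last 2 first.
  - exact: integrable_tentM.
  - rewrite (_ : _ \o _ = fun y => ((g x)%:E * (tent h (x - y))%:E)%E)//.
    exact: integrableZl.
  by apply: eq_Rintegral => y _; rewrite mulrBl.
have mgx : measurable_fun (setT : set Rm) (fun y => (g y - g x) * tent h (x - y)).
  by apply: measurable_funM; [exact: measurable_funB|exact: measurable_tent_shift].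
apply: (@le_trans _ _ (\int[mu]_y `|((g y - g x) * tent h (x - y))%:E|)%E).
  rewrite /Rintegral.
  (* The real integral is [fine] of the extended one: if the latter is infinite, the left side is
     0. *)
  have [f|] := boolP ((\int[mu]_y ((g y - g x) * tent h (x - y))%:E)%E \is a fin_num).
    rewrite -[leLHS]/(`|(fine _)%:E|)%E fineK//.
    by apply: le_abse_integral => //; exact/measurable_EFinP.
  by rewrite fin_numE negb_and !negbK => /orP[] /eqP -> /=; rewrite normr0 integral_ge0.
have mB : measurable (ball x h : set Rm) by exact: measurable_ball.
have mgB : measurable_fun (setT : set Rm) (fun y => (g y - g x)%:E).
  by apply/measurable_EFinP; exact: measurable_funB.
rewrite /davg /iavg (@lebesgue_measure_ball R x h (ltW h0)).
apply: (@le_trans _ _ (\int[mu]_(y in ball x h) ((h^-1)%:E * `|(g y - g x)%:E|))%E).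
  rewrite [leRHS]integral_mkcond; apply: ge0_le_integral => //.
  - by apply: measurableT_comp => //; exact/measurable_EFinP.
  - apply/(measurable_restrictT _ mB); apply: measurable_funTS.
    by apply: measurable_funeM; exact: measurableT_comp.
  - move=> y _; rewrite patchE; case: ifPn => [_|].
      rewrite -EFinM lee_fin normrM mulrC ler_wpM2r// ger0_norm ?tent_ge0//.
      exact: tent_le.
    rewrite notin_setE /ball/= => /negP; rewrite -leNgt => hy.
    by rewrite tent_out// mulr0 normr0.
rewrite ge0_integralZl_EFin//; last 2 first.
- by apply: measurable_funTS; exact: measurableT_comp.
- by rewrite invr_ge0 ltW.
rewrite inver mulrn_eq0/= gt_eqF// muleA -EFinM.
by rewrite -[h *+ 2]mulr_natr invfM mulrCA divff// mulr1.
Qed.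

Lemma cvg_tent (x : R) (g : R -> R) :
  mu.-integrable (setT : set Rm) (EFin \o g) -> lebesgue_pt g x ->
  (fun n => \int[mu]_y (g y * tent n.+1%:R^-1 (x - y)))%R @ \oo --> g x.
Proof.
move=> ig gx.
have gn : (fun n => davg g x n.+1%:R^-1) @ \oo --> 0%E.
  apply: (cvg_comp (fun n => n.+1%:R^-1 : R) (davg g x) _ gx) => P P0.
  have : \forall n \near \oo, 0 < @harmonic R n -> P (@harmonic R n).
    exact: (@cvg_harmonic R (fun r => 0 < r -> P r) P0).
  by apply: (@filterS _ \oo) => n /= Pn; apply: Pn; exact: harmonic_gt0.
have g2 : (fun n => 2%:E * davg g x n.+1%:R^-1)%E @ \oo --> 0%E.
  by rewrite -[X in _ --> X](mule0 2%:E); apply: cvgeZl.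
have H : (fun n => `|(\int[mu]_y (g y * tent n.+1%:R^-1 (x - y)))%R - g x|%:E)%E @ \oo --> 0%E.
  apply: (squeeze_cvge _ _ g2 (f := fun=> 0%E)); last exact: cvg_cst.
  by apply: nearW => n; rewrite lee_fin normr_ge0/=; apply: tent_davg_le.
have H1 := fine_cvg H.
by apply: cvg_zero; apply: norm_cvg0; exact: H1.
Qed.

End approximate_identity.

(** * Inversion of the damped transform and Schur's test *)

Section plancherel1.
Context {R : realType}.
Let Rm := measurableTypeR R.
Notation mu := (@lebesgue_measure R).

Definition phase1 (xi x : R) : R := xi * x.

Let b : Rm -> Rm -> R := phase1.

Lemma measurable_phase1d : measurable_fun setT (fun z : Rm * Rm => b z.1 z.2).
Proof. by apply: measurable_funM; mproj. Qed.

Let mb := measurable_phase1d.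

Lemma cmeas_tent (f : Rm -> R[i]) h : cmeas f ->
  cmeas (fun z : Rm * Rm => f z.2 * (2 * qint * tent h (z.1 - z.2))%:C).
Proof.
move=> mf; apply: cmeasM; first by apply: (cmeas_comp _ mf); mproj.
apply: cmeas_real; apply: measurable_funM => //.
by apply: (measurableT_comp (measurable_tent h)); apply: measurable_funB; mproj.
Qed.

Let h_neq0 h : 0 < h -> h != 0 :> R. Proof. by move=> ?; rewrite gt_eqF. Qed.

(** Pair the transform of f with a damped exponential and move everything onto f by the adjoint
    relation. The damping makes that exponential integrable. *)
Lemma fejer_inversion (f : Rm -> R[i]) h x : 0 < h -> cL1 mu f ->
  phase_ft mu (fun x xi => - b xi x) (fun xi => (fejer h xi)%:C * phase_ft mu b f xi) x
  = cint mu (fun y => f y * (2 * qint * tent h (x - y))%:C).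
Proof.
move=> h0 fL; have mf := cL1_meas fL.
pose g xi := expi (- (xi * x)) * (fejer h xi)%:C.
have gL : cL1 mu g.
  apply: (@cL1_bM _ _ _ _ (fun xi : Rm => expi (- (xi * x))) _ 1).
  - apply: cmeas_expi; apply: measurableT_comp => //.
    by apply: measurable_funM => //; exact: measurable_id.
  - by move=> xi; rewrite expi_normc.
  - by apply: cL1_fejer; exact: h_neq0.
transitivity (cint mu (fun xi => phase_ft mu b f xi * conjc (g xi))).
  apply: eq_cint => xi; rewrite /g conjM expiJ conjc_real /b /phase1 opprK; ring.
rewrite (phase_ft_adjoint mb)//; apply: eq_cint => y; congr (_ * _).
have -> : phase_ft mu (fun x xi => - b xi x) g y =
    cint mu (fun xi => expi ((y - x) * xi) * (fejer h xi)%:C).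
  apply: eq_cint => xi; rewrite /g mulrA -expiD /b /phase1.
  by congr (expi _ * _); ring.
by rewrite cint_fejer ?h_neq0// conjc_real -tentN opprB.
Qed.

Let two_qint_ge0 : 0 <= 2 * qint :> R.
Proof. by rewrite mulr_ge0// ltW// qint_gt0. Qed.

Lemma measurable_normc2_tent (f : Rm -> R[i]) h : cmeas f ->
  measurable_fun setT (fun z : Rm * Rm =>
    normc (f z.1) * normc (f z.2) * tent h (z.1 - z.2)).
Proof.
move=> mf; apply: measurable_funM.
  apply: measurable_funM.
    by apply: (measurableT_comp (measurable_normc mf)); mproj.
  by apply: (measurableT_comp (measurable_normc mf)); mproj.
by apply: (measurableT_comp (measurable_tent h)); apply: measurable_funB; mproj.
Qed.

(* Schur's test for the convolution with the tent, whose integral is 1 *)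
Lemma tent_schur (f : Rm -> R[i]) h : 0 < h -> cmeas f ->
  (\int[mu]_x \int[mu]_y (normc (f x) * normc (f y) * tent h (x - y))%:E
   <= sqint mu f)%E.
Proof.
move=> h0 mf.
have mt : measurable_fun setT (fun z : Rm * Rm => tent h (z.1 - z.2)).
  by apply: (measurableT_comp (measurable_tent h)); apply: measurable_funB; mproj.
have m1 : measurable_fun setT (fun z : Rm * Rm => sqn (f z.1) / 2 * tent h (z.1 - z.2)).
  apply: measurable_funM => //; apply: measurable_funM => //.
  by apply: (measurableT_comp (measurable_sqn mf)); mproj.
have m2 : measurable_fun setT (fun z : Rm * Rm => sqn (f z.2) / 2 * tent h (z.1 - z.2)).
  apply: measurable_funM => //; apply: measurable_funM => //.
  by apply: (measurableT_comp (measurable_sqn mf)); mproj.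
have m0 := measurable_normc2_tent h mf.
have I1 : (\int[mu \x mu]_z (sqn (f z.1) / 2 * tent h (z.1 - z.2))%:E = 2^-1%:E * sqint mu f)%E.
  rewrite fubini_tonelli1; last 2 first.
  - exact/measurable_EFinP.
  - by move=> z; rewrite lee_fin mulr_ge0 ?tent_ge0// divr_ge0 ?sqn_ge0.
  rewrite -ge0_integralZl_EFin//; last 2 first.
  - by move=> x _; rewrite lee_fin sqn_ge0.
  - exact/measurable_EFinP/measurable_sqn.
  apply: eq_integral => x _; rewrite /fubini_F /=.
  rewrite ge0_intZl ?divr_ge0 ?sqn_ge0// ?int_tent_shift// ?mule1 -?EFinM; last 2 first.
  - by move=> y; exact: tent_ge0.
  - exact: measurable_tent_shift.
  by rewrite mulrC.
have I2 : (\int[mu \x mu]_z (sqn (f z.2) / 2 * tent h (z.1 - z.2))%:E = 2^-1%:E * sqint mu f)%E.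
  rewrite fubini_tonelli2; last 2 first.
  - exact/measurable_EFinP.
  - by move=> z; rewrite lee_fin mulr_ge0 ?tent_ge0// divr_ge0 ?sqn_ge0.
  rewrite -ge0_integralZl_EFin//; last 2 first.
  - by move=> x _; rewrite lee_fin sqn_ge0.
  - exact/measurable_EFinP/measurable_sqn.
  apply: eq_integral => y _; rewrite /fubini_G /=.
  have E x : tent h (x - y) = tent h (y - x) by rewrite -tentN opprB.
  under eq_integral do rewrite E.
  rewrite ge0_intZl ?divr_ge0 ?sqn_ge0// ?int_tent_shift// ?mule1 -?EFinM; last 2 first.
  - by move=> x; exact: tent_ge0.
  - exact: measurable_tent_shift.
  by rewrite mulrC.
have -> : sqint mu f = (2^-1%:E * sqint mu f + 2^-1%:E * sqint mu f)%E.
  rewrite -ge0_muleDl ?lee_fin//.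
  by rewrite -EFinD (_ : 2^-1 + 2^-1 = 1 :> R) ?mul1e//; lra.
rewrite -{1}I1 -I2 -ge0_intD//; last 2 first.
- by move=> z; rewrite mulr_ge0 ?tent_ge0// divr_ge0 ?sqn_ge0.
- by move=> z; rewrite mulr_ge0 ?tent_ge0// divr_ge0 ?sqn_ge0.
rewrite -(fubini_tonelli1 (m1 := mu) (m2 := mu)
  (fun z => (normc (f z.1) * normc (f z.2) * tent h (z.1 - z.2))%:E)); last 2 first.
- exact/measurable_EFinP.
- by move=> z; rewrite lee_fin mulr_ge0 ?tent_ge0// mulr_ge0 ?normc_ge0.
apply: ge0_int_le => //; last exact: measurable_funD.
- by move=> z; rewrite mulr_ge0 ?tent_ge0// mulr_ge0 ?normc_ge0.
- move=> z; rewrite -mulrDl ler_wpM2r ?tent_ge0// -!sqr_normc.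
  have := sqr_ge0 (normc (f z.1) - normc (f z.2)); lra.
Qed.

End plancherel1.

Section plancherel1_truncated.
Context {R : realType}.
Let Rm := measurableTypeR R.
Notation mu := (@lebesgue_measure R).
Let b : Rm -> Rm -> R := phase1.
Let mb := @measurable_phase1d R.
Let h_neq0 h : 0 < h -> h != 0 :> R. Proof. by move=> ?; rewrite gt_eqF. Qed.
Let two_qint_ge0 : 0 <= 2 * qint :> R.
Proof. by rewrite mulr_ge0// ltW// qint_gt0. Qed.

Lemma tent_conv_le (f : Rm -> R[i]) h x : cmeas f ->
  ((normc (f x * conjc (cint mu (fun y => f y * (2 * qint * tent h (x - y))%:C))))%:E
  <= (2 * qint)%:E *
     \int[mu]_y (normc (f x) * normc (f y) * tent h (x - y))%:E)%E.
Proof.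
move=> mf; have mt := cmeas_pair1 x (cmeas_tent h mf).
have E y : normc (f x) * normc (f y * (2 * qint * tent h (x - y))%:C) =
    2 * qint * (normc (f x) * normc (f y) * tent h (x - y)).
  rewrite Normc.normcM normc_real (ger0_norm (mulr_ge0 two_qint_ge0 (tent_ge0 _ _))); ring.
rewrite -ge0_intZl//; last 2 first.
- by move=> y; rewrite mulr_ge0 ?tent_ge0// mulr_ge0 ?normc_ge0.
- apply: measurable_funM; last exact: measurable_tent_shift.
  by apply: measurable_funM => //; exact: measurable_normc.
under eq_integral do rewrite -E.
rewrite ge0_intZl ?normc_ge0//; last 2 first.
- by move=> y; exact: normc_ge0.
- exact: (measurable_normc mt).
rewrite Normc.normcM normcJ EFinM lee_wpmul2l ?lee_fin ?normc_ge0//.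
exact: (normc_cint_le mu mt).
Qed.

(** The purpose of the damping: the transform of an L1 function is only known to be bounded, and its
    product with the integrable Fejer factor is in L1. *)
Lemma cL1_fejer_ft (f : Rm -> R[i]) h : 0 < h -> cL1 mu f ->
  cL1 mu (fun xi => (fejer h xi)%:C * phase_ft mu b f xi).
Proof.
move=> h0 fL; have mf := cL1_meas fL; have /cL1P[_ foo] := fL.
have bT xi : normc (phase_ft mu b f xi) <= fine (absint mu f).
  rewrite -lee_fin fineK ?ge0_fin_numE ?absint_ge0//.
  exact: (@phase_ft_le _ Rm R mu b mb f xi mf).
have := @cL1_bM _ Rm R mu _ _ _ (cmeas_phase_ft mu mb mf) bT (cL1_fejer (h_neq0 h0)).
by congr (cL1 _ _); apply/funext => xi; rewrite mulrC.
Qed.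

(** The left side pairs the transform of f with its damped version. The adjoint relation and the
    inversion turn it into the pairing of f with its convolution with the tent, which Schur's test
    bounds. *)
Lemma fejer_sqint_le (f : Rm -> R[i]) h : 0 < h -> cL1 mu f ->
  (\int[mu]_xi (fejer h xi * sqn (phase_ft mu b f xi))%:E
   <= (2 * qint)%:E * sqint mu f)%E.
Proof.
move=> h0 fL; have mf := cL1_meas fL.
have mTf := cmeas_phase_ft mu mb mf.
have TfL := cL1_fejer_ft h0 fL.
pose I : R := (\int[mu]_xi (fejer h xi * sqn (phase_ft mu b f xi)))%R.
have mI : measurable_fun setT (fun xi => fejer h xi * sqn (phase_ft mu b f xi)).
  apply: measurable_funM; first exact: measurable_fejer.
  exact: measurable_sqn.
(* Finiteness, from the sup bound on the transform, lets a real integral replace the extended one,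
   and the complex identities apply to it. *)
have Ioo : (\int[mu]_xi (fejer h xi * sqn (phase_ft mu b f xi))%:E < +oo)%E.
  have /cL1P[_ foo] := fL.
  apply: (@le_lt_trans _ _ (\int[mu]_xi (fine (absint mu f) ^+ 2 * fejer h xi)%:E)%E).
    apply: ge0_int_le => //.
    - by move=> xi; rewrite mulr_ge0 ?fejer_ge0 ?sqn_ge0.
    - move=> xi; rewrite mulrC ler_wpM2r ?fejer_ge0// -sqr_normc.
      rewrite ler_sqr ?nnegrE ?normc_ge0//; last first.
        by rewrite fine_ge0// absint_ge0.
      rewrite -lee_fin fineK ?ge0_fin_numE ?absint_ge0//.
      exact: (@phase_ft_le _ Rm R mu b mb f xi mf).
    - by apply: measurable_funM => //; exact: measurable_fejer.
  rewrite ge0_intZl ?sqr_ge0//.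
  - apply: lte_mul_pinfty => //; first by rewrite lee_fin sqr_ge0.
    by apply: int_fejer_lty; exact: h_neq0.
  - exact: fejer_ge0.
  - exact: measurable_fejer.
have IE : (I%:C = cint mu (fun x => f x *
    conjc (cint mu (fun y => f y * (2 * qint * tent h (x - y))%:C)))).
  transitivity (cint mu (fun xi => phase_ft mu b f xi *
      conjc ((fejer h xi)%:C * phase_ft mu b f xi))).
    rewrite /I -cint_real; apply: eq_cint => xi.
    by rewrite conjM conjc_real mulrCA mulJ -rmorphM.
  rewrite (phase_ft_adjoint mb fL TfL); apply: eq_cint => x.
  by rewrite (fejer_inversion x h0 fL).
have I0 : 0 <= I.
  by apply: Rintegral_ge0 => x _; rewrite mulr_ge0 ?fejer_ge0 ?sqn_ge0.
rewrite -Rint_fineK//; last first.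
  by move=> x; rewrite mulr_ge0 ?fejer_ge0 ?sqn_ge0.
rewrite -/I -(ger0_norm I0) -normc_real IE.
have mG := cmeas_cint2 mu (cmeas_tent h mf).
apply: le_trans (normc_cint_le _ _) _.
  exact: (cmeasM mf (cmeasJ mG)).
have mK : measurable_fun setT (fun x : Rm =>
    (\int[mu]_y (normc (f x) * normc (f y) * tent h (x - y))%:E)%E).
  apply: (measurable_fun_fubini_tonelli_F (fun z : Rm * Rm =>
      (normc (f z.1) * normc (f z.2) * tent h (z.1 - z.2))%:E)).
    by apply/measurable_EFinP; exact: (measurable_normc2_tent h mf).
  by move=> z; rewrite lee_fin mulr_ge0 ?tent_ge0// mulr_ge0 ?normc_ge0.
have K0 x : (0 <= \int[mu]_y (normc (f x) * normc (f y) * tent h (x - y))%:E)%E.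
  by apply: int_ge0 => y; rewrite mulr_ge0 ?tent_ge0// mulr_ge0 ?normc_ge0.
apply: (@le_trans _ _ ((2 * qint)%:E * \int[mu]_x
    \int[mu]_y (normc (f x) * normc (f y) * tent h (x - y))%:E)%E); last first.
  by rewrite lee_wpmul2l ?lee_fin//; exact: tent_schur.
rewrite -ge0_integralZl_EFin//.
apply: ge0_le_integral => //.
- by move=> x _; rewrite lee_fin normc_ge0.
- apply/measurable_EFinP/measurable_normc.
  exact: (cmeasM mf (cmeasJ mG)).
- exact: measurable_funeM.
- by move=> x _; exact: tent_conv_le.
Qed.

End plancherel1_truncated.

(** * The two inequalities of Plancherel's identity *)

Section plancherel1_end.
Context {R : realType}.
Let Rm := measurableTypeR R.
Notation mu := (@lebesgue_measure R).
Let b : Rm -> Rm -> R := phase1.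
Let mb := @measurable_phase1d R.

Lemma sin_ge (y : R) : 0 <= y -> y * (1 - y ^+ 2 / 2) <= sin y.
Proof.
rewrite le_eqVlt => /predU1P[<-|y0]; first by rewrite sin0 mul0r.
have [|c] := @MVT R sin cos 0 y y0 (fun z _ => is_derive_sin z).
  by apply: continuous_subspaceT => z; exact: continuous_sin.
rewrite in_itv/= => /andP[c0 cy]; rewrite sin0 !subr0 => ->.
rewrite mulrC ler_wpM2r ?(ltW y0)//.
have := onemcos_le c; have : c ^+ 2 <= y ^+ 2 by rewrite ler_sqr ?nnegrE ltW.
by lra.
Qed.

(** With y = h x / 2 the damping is (sin y / y)^2, at least (1 - y^2 / 2)^2 if y^2 < 1; for y^2 >= 1
    the left side is not positive. *)
Lemma fejer_ge h x : h * x != 0 -> 1 - (h * x / 2) ^+ 2 <= fejer h x :> R.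
Proof.
rewrite /fejer; move: (h * x) => {h x} z.
wlog z0 : z / 0 < z.
  move=> H z0; have [zp|zn|z00] := ltgtP z 0; last by rewrite z00 eqxx in z0.
    have := H (- z); rewrite oppr_gt0 oppr_eq0 qcosN mulNr sqrrN; exact.
  exact: H.
move=> _; rewrite /qcos cos_double; set y := z / 2.
have -> : z = 2 * y by rewrite /y mulrC divfK.
have y0 : 0 < y by rewrite /y divr_gt0.
have [y1|y1] := leP 1 (y ^+ 2).
  by apply: (@le_trans _ _ 0); [lra|rewrite mulr_ge0// divr_ge0 ?sqr_ge0// mulr_ge0 ?sqr_ge0].
have sy := sin_ge (ltW y0).
have s0 : 0 <= y * (1 - y ^+ 2 / 2) by rewrite mulr_ge0 ?ltW//; lra.
rewrite mulrA ler_pdivlMr; last by rewrite exprn_gt0// mulr_gt0.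
have : (y * (1 - y ^+ 2 / 2)) ^+ 2 <= sin y ^+ 2.
  by rewrite ler_sqr ?nnegrE// (le_trans s0).
(* The slack: (y (1 - y^2 / 2))^2 - y^2 (1 - y^2) = y^6 / 4. *)
have : 0 <= y ^+ 6 by rewrite exprn_ge0// ltW.
move: (sin y) => s; nra.
Qed.

Lemma cvg_fejer (x : R) : x != 0 ->
  (fun n => fejer n.+1%:R^-1 x) @ \oo --> (1 : R).
Proof.
move=> x0.
apply: (@squeeze_cvgr _ _ _ _ (fun n => 1 - (n.+1%:R^-1 * x / 2) ^+ 2) (fun=> 1)).
- apply: nearW => n; rewrite fejer_le1 andbT; apply: fejer_ge.
  by rewrite mulf_neq0// invr_neq0// pnatr_eq0.
- rewrite -[X in _ --> X]subr0; apply: cvgB; first exact: cvg_cst.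
  rewrite [X in _ --> X](_ : 0 = (0 * x / 2) * (0 * x / 2)); last by rewrite !mul0r.
  under eq_fun do rewrite expr2.
  have H : (fun n => n.+1%:R^-1 * x / 2 : R) @ \oo --> 0 * x / 2.
    by apply: cvgMl; apply: cvgMl; exact: cvg_harmonic.
  exact: cvgM.
- exact: cvg_cst.
Qed.

Lemma phase_ft1_le (f : Rm -> R[i]) : cL1 mu f ->
  (sqint mu (phase_ft mu b f) <= (2 * qint)%:E * sqint mu f)%E.
Proof.
move=> fL; have mf := cL1_meas fL.
have mT := cmeas_phase_ft mu mb mf.
apply: (@fatou_cvg_le _ _ _ mu
  (fun n xi => fejer n.+1%:R^-1 xi * sqn (phase_ft mu b f xi))).
- move=> n; apply: measurable_funM; first exact: measurable_fejer.
  exact: measurable_sqn.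
- by move=> n xi; rewrite mulr_ge0 ?fejer_ge0 ?sqn_ge0.
- exact: measurable_sqn.
- exists [set 0]; split.
  + exact: measurable_set1.
  + exact: lebesgue_measure_set1.
  + move=> xi /= H; apply: contrapT => /eqP xi0; apply: H.
    rewrite -[X in _ --> X]mul1r; apply: cvgMl; exact: cvg_fejer.
- by move=> n; apply: fejer_sqint_le => //; rewrite invr_gt0.
Qed.

Lemma phase_ft1N_le (f : Rm -> R[i]) : cL1 mu f ->
  (sqint mu (phase_ft mu (fun x xi => (- b xi x)%R) f) <= (2 * qint)%:E * sqint mu f)%E.
Proof.
move=> fL.
have -> : (fun x xi => - b xi x) = (fun x xi => - b x xi).
  by apply/funext => x; apply/funext => xi; rewrite /b /phase1 mulrC.
rewrite (sqint_phase_ftN mb fL).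
by apply: le_trans (phase_ft1_le (cL1J fL)) _; rewrite sqintJ.
Qed.

Lemma ae_lebesgue_pt (g : R -> R) : mu.-integrable (setT : set Rm) (EFin \o g) ->
  {ae mu, forall x, lebesgue_pt g x}.
Proof.
move=> ig; apply: lebesgue_differentiation.
exact: open_integrable_locally openT ig.
Qed.

(** For the lower bound let c = 2 [qint] and let T be the transform. The adjoint of T, applied to
    the damped Tf, tends to c f at Lebesgue points, and by the upper bound for the adjoint its
    squared norm is at most c times that of Tf. Fatou bounds c^2 times the squared norm of f by c
    times that of Tf, and c cancels. *)
Lemma plancherel1 : plancherel mu b (2 * qint).
Proof.
move=> f fL; have mf := cL1_meas fL; have mT := cmeas_phase_ft mu mb mf.
have q0 : 0 < 2 * qint :> R by rewrite mulr_gt0// qint_gt0.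
apply/eqP; rewrite eq_le phase_ft1_le//=.
suff : ((2 * qint)%:E * ((2 * qint)%:E * sqint mu f) <=
        (2 * qint)%:E * sqint mu (phase_ft mu b f))%E.
  by rewrite lee_pmul2l.
have n0 n : 0 < n.+1%:R^-1 :> R by rewrite invr_gt0.
rewrite muleA -EFinM /sqint -ge0_integralZl_EFin//; last 3 first.
- by move=> x _; rewrite lee_fin sqn_ge0.
- exact/measurable_EFinP/measurable_sqn.
- by rewrite mulr_ge0// ltW.
under eq_integral do rewrite -EFinM.
pose G n x := cint mu (fun y => f y * (2 * qint * tent n.+1%:R^-1 (x - y))%:C).
apply: (@fatou_cvg_le _ _ _ mu (fun n x => sqn (G n x))).
- move=> n; apply: measurable_sqn.
  exact: (cmeas_cint2 mu (cmeas_tent n.+1%:R^-1 mf)).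
- by move=> n x; exact: sqn_ge0.
- by apply: measurable_funM => //; exact: measurable_sqn.
- have key (g : R -> R) x : mu.-integrable (setT : set Rm) (EFin \o g) -> lebesgue_pt g x ->
      (fun n => \int[mu]_y (g y * (2 * qint * tent n.+1%:R^-1 (x - y))))%R @ \oo
        --> 2 * qint * g x.
    move=> ig gx.
    have -> : (fun n => \int[mu]_y (g y * (2 * qint * tent n.+1%:R^-1 (x - y))))%R =
        (fun n => 2 * qint * (\int[mu]_y (g y * tent n.+1%:R^-1 (x - y))))%R.
      apply/funext => n; rewrite -RintegralZl//; last exact: integrable_tentM.
      by apply: eq_Rintegral => y _; ring.
    by apply: cvgMr; exact: cvg_tent.
  apply: (@filterS2 _ _ (ae_filter_ringOfSetsType mu) _ _ _ _
    (ae_lebesgue_pt fL.1) (ae_lebesgue_pt fL.2)) => x fr fi.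
  have GE n : sqn (G n x) =
     (\int[mu]_y (Re (f y) * (2 * qint * tent n.+1%:R^-1 (x - y))))%R ^+ 2 +
     (\int[mu]_y (Im (f y) * (2 * qint * tent n.+1%:R^-1 (x - y))))%R ^+ 2.
    rewrite /sqn /G /cint/=; congr (_ ^+ 2 + _ ^+ 2); apply: eq_Rintegral => y _.
      by rewrite ReM/= mulr0 subr0.
    by rewrite ImM/= mulr0 add0r.
  under eq_fun do rewrite GE.
  have -> : 2 * qint * (2 * qint) * sqn (f x) =
      (2 * qint * Re (f x)) * (2 * qint * Re (f x)) +
      (2 * qint * Im (f x)) * (2 * qint * Im (f x)).
    by rewrite /sqn; ring.
  by apply: cvgD; apply: cvgM; apply: key => //; [exact: fL.1|exact: fL.1|exact: fL.2|exact: fL.2].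
- move=> n; have TL := cL1_fejer_ft (n0 n) fL.
  have H1 := phase_ft1N_le TL.
  have H2 : (sqint mu (fun xi => ((fejer n.+1%:R^-1 xi)%:C * phase_ft mu b f xi)%R) <=
      sqint mu (phase_ft mu b f))%E.
    apply: ge0_int_le.
    + by move=> xi; exact: sqn_ge0.
    + move=> xi; rewrite sqnM sqn_real ler_piMl ?sqn_ge0//.
      by rewrite -[leRHS](expr1n _ 2) ler_sqr ?nnegrE ?fejer_ge0 ?fejer_le1.
    + exact: measurable_sqn (cL1_meas TL).
    + exact: measurable_sqn.
  apply: le_trans (le_trans H1 (lee_wpmul2l _ H2)); last by rewrite lee_fin ltW.
  rewrite le_eqVlt; apply/orP; left; apply/eqP; apply: eq_integral => x _.
  by rewrite /G -(fejer_inversion x (n0 n) fL).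
Qed.

End plancherel1_end.

(** * The closure of the Fourier transform in L2 *)

Section ereal_cvg0.
Context {R : realType}.
Local Open Scope ereal_scope.

Lemma ecvg0P (u : nat -> \bar R) : (forall n, 0 <= u n) ->
  u @ \oo --> 0 <-> forall e, (0 < e)%R -> \forall n \near \oo, u n <= e%:E.
Proof.
move=> u0; split=> [/fine_cvgP[ufin uc] e e0|H].
  have uc' := @cvgr0_norm_le _ _ _ _ _ _ uc e e0.
  near=> n.
  have fn : u n \is a fin_num by near: n; exact: ufin.
  have une : (`|fine (u n)| <= e)%R by near: n; exact: uc'.
  by rewrite -(fineK fn) lee_fin (le_trans (ler_norm _)).
apply/fine_cvgP; split.
  apply: filterS (H 1%R ltr01) => n un.
  by rewrite ge0_fin_numE// (le_lt_trans un)// ltry.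
apply/cvgr0Pnorm_le => e e0; apply: filterS (H e e0) => n un /=.
rewrite ger0_norm ?fine_ge0// -lee_fin fineK//.
by rewrite ge0_fin_numE// (le_lt_trans un)// ltry.
Unshelve. all: by end_near. Qed.

End ereal_cvg0.

Section sqint_facts.
Context d (T : measurableType d) {R : realType}.
Variable mu : {measure set T -> \bar R}.
Implicit Types f g : T -> R[i].

Definition cL2 f := cmeas f /\ (sqint mu f < +oo)%E.

Lemma sqintD_le f g : cmeas f -> cmeas g ->
  (sqint mu (fun x => (f x + g x)%R) <= 2%:E * sqint mu f + 2%:E * sqint mu g)%E.
Proof.
move=> mf mg; have mf2 := measurable_sqn mf; have mg2 := measurable_sqn mg.
rewrite /sqint -!ge0_intZl//; try (by move=> x; exact: sqn_ge0).
rewrite -ge0_intD//; first last.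
- exact: measurable_funM.
- exact: measurable_funM.
- by move=> x; rewrite mulr_ge0 ?sqn_ge0.
- by move=> x; rewrite mulr_ge0 ?sqn_ge0.
apply: ge0_int_le.
- by move=> x; exact: sqn_ge0.
- by move=> x; exact: sqnD_le.
- exact: measurable_sqn (cmeasD mf mg).
- by apply: measurable_funD; exact: measurable_funM.
Qed.

Lemma sqintB_le f g : cmeas f -> cmeas g ->
  (sqint mu (fun x => (f x - g x)%R) <= 2%:E * sqint mu f + 2%:E * sqint mu g)%E.
Proof.
move=> mf mg; apply: le_trans (sqintD_le mf (cmeasN mg)) _.
rewrite (_ : sqint mu (fun x => - g x) = sqint mu g)//.
by apply: eq_integral => x _; rewrite sqnN.
Qed.

Lemma sqint_sub_le f g h : cmeas f -> cmeas g -> cmeas h ->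
  (sqint mu (fun x => (f x - h x)%R) <=
   2%:E * sqint mu (fun x => (f x - g x)%R) + 2%:E * sqint mu (fun x => (g x - h x)%R))%E.
Proof.
move=> mf mg mh.
have := sqintD_le (cmeasB mf mg) (cmeasB mg mh).
by under [X in (sqint mu X <= _)%E -> _]eq_fun do rewrite addrA subrK.
Qed.

Lemma sqint_le_sub f g : cmeas f -> cmeas g ->
  (sqint mu f <= 2%:E * sqint mu (fun x => (f x - g x)%R) + 2%:E * sqint mu g)%E.
Proof.
move=> mf mg; have := sqintD_le (cmeasB mf mg) mg.
by under [X in (sqint mu X <= _)%E -> _]eq_fun do rewrite subrK.
Qed.

Lemma sqint_subC f g :
  sqint mu (fun x => (f x - g x)%R) = sqint mu (fun x => (g x - f x)%R).
Proof. by apply: eq_integral => x _; rewrite -sqnN opprB. Qed.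

Lemma sqint_eq0 f : cmeas f -> sqint mu f = 0%E -> {ae mu, forall x, f x = 0}.
Proof.
move=> mf f0.
have : (\int[mu]_x `|(sqn (f x))%:E| = 0)%E.
  by rewrite -[RHS]f0; apply: eq_integral => x _; rewrite gee0_abs// lee_fin sqn_ge0.
move/(ae_eq_integral_abs mu measurableT) => H.
have /H : measurable_fun setT (fun x => (sqn (f x))%:E).
  by apply/measurable_EFinP; exact: measurable_sqn.
apply: filterS => x /(_ I)/= [] /eqP; rewrite sqn_eq0 => /eqP; exact.
Qed.

Lemma cL1_mulJ f g : cL2 f -> cL2 g -> cL1 mu (fun x => f x * conjc (g x)).
Proof.
move=> [mf foo] [mg goo].
apply: (@cL1_le _ _ _ mu _ (fun x => sqn (f x) + sqn (g x))).
- by apply: cmeasM => //; exact: cmeasJ.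
- by apply: measurable_funD; exact: measurable_sqn.
- move=> x; rewrite Normc.normcM normcJ -!sqr_normc.
  have := sqr_ge0 (normc (f x) - normc (g x)).
  have := sqr_ge0 (normc (f x)); have := sqr_ge0 (normc (g x)); nra.
- rewrite ge0_intD//; first exact: lte_add_pinfty.
  + by move=> x; exact: sqn_ge0.
  + by move=> x; exact: sqn_ge0.
  + exact: measurable_sqn.
  + exact: measurable_sqn.
Qed.

Lemma sqintB_expand f g : cL2 f -> cL2 g ->
  (sqint mu (fun x => (f x - g x)%R) =
   (fine (sqint mu f) - 2 * Re (cint mu (fun x => f x * conjc (g x))) +
    fine (sqint mu g))%R%:E)%E.
Proof.
move=> fL gL; have [mf foo] := fL; have [mg goo] := gL.
have Boo : (sqint mu (fun x => (f x - g x)%R) < +oo)%E.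
  apply: le_lt_trans (sqintB_le mf mg) _.
  by apply: lte_add_pinfty; apply: lte_mul_pinfty.
have int_sq h : cL2 h -> mu.-integrable setT (EFin \o (fun x => sqn (h x))).
  by move=> [mh hoo]; apply: integrable_ge0P => //;
    [move=> x; exact: sqn_ge0|exact: measurable_sqn].
rewrite -[LHS]fineK; last by rewrite ge0_fin_numE// sqint_ge0.
congr EFin.
have [ir ii] := cL1_mulJ fL gL.
have -> : Re (cint mu (fun x => f x * conjc (g x))) =
  (\int[mu]_x Re (f x * conjc (g x)))%R by [].
have i2 : mu.-integrable setT (EFin \o (fun x => 2 * Re (f x * conjc (g x)))).
  rewrite (_ : _ \o _ = fun x => (2%:E * (Re (f x * conjc (g x)))%:E)%E)//.
  exact: integrableZl.
have i3 : mu.-integrable setT (EFin \o (fun x => sqn (f x) - 2 * Re (f x * conjc (g x)))).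
  rewrite (_ : _ \o _ = fun x => ((sqn (f x))%:E - (2 * Re (f x * conjc (g x)))%:E)%E)//.
  by apply: integrableB => //; exact: int_sq.
rewrite -RintegralZl// -RintegralB//; last exact: int_sq.
rewrite -RintegralD//; last exact: int_sq.
by apply: eq_Rintegral => x _; rewrite /sqn !reimE; ring.
Qed.

End sqint_facts.

Section fourier_graph.
Context d (T : measurableType d) {R : realType}.
Variable mu : {sigma_finite_measure set T -> \bar R}.
Variable b : T -> T -> R.
Hypothesis mb : measurable_fun setT (fun z : T * T => b z.1 z.2).
Hypothesis bC : forall x y, b x y = b y x.
Variable k : R.
Hypothesis k0 : 0 < k.
Hypothesis bP : plancherel mu b k.
Implicit Types f g u : T -> R[i].

Let ft := phase_ft mu b.

(** [is_fourier] with squared integrals in place of norms and an arbitrary phase in place of [dot4],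
    so that the closure argument sees only Plancherel, measurability and symmetry. *)
Definition ft_graph u g := [/\ cL2 mu u, cL2 mu g &
  exists f_ : nat -> T -> R[i],
    [/\ forall n, cL1 mu (f_ n) /\ cL2 mu (f_ n),
        (fun n => sqint mu (fun x => f_ n x - u x)) @ \oo --> 0%E &
        (fun n => sqint mu (fun x => ft (f_ n) x - g x)) @ \oo --> 0%E]].

(** The norm bounds and the uniqueness below draw on the approximating sequence only through one
    sufficiently good member. *)
Lemma ft_graph_near u g : ft_graph u g -> forall e : R, 0 < e ->
  exists f, [/\ cL1 mu f, cL2 mu f, cmeas (ft f),
    (sqint mu (fun x => (f x - u x)%R) <= e%:E)%E &
    (sqint mu (fun x => (ft f x - g x)%R) <= e%:E)%E].
Proof.
move=> [_ _ [f_ [fL /ecvg0P fu /ecvg0P fg]]] e e0.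
have fu1 := fu (fun n => sqint_ge0 _ _) e e0.
have fg1 := fg (fun n => sqint_ge0 _ _) e e0.
have [n [H1 H2]] := filter_ex (filterI fu1 fg1).
exists (f_ n); split => //; [exact: (fL n).1|exact: (fL n).2|].
exact: (cmeas_phase_ft mu mb (fL n).2.1).
Qed.

(** The sharp constant is k. The quadratic triangle inequality is used twice, between g and the
    transform of f and between f and u, and each use costs a factor 2. *)
Lemma ft_graph_le u g : ft_graph u g -> (sqint mu g <= (4 * k)%:E * sqint mu u)%E.
Proof.
move=> ug; have [[mu_ uoo] [mg goo] _] := ug.
apply/lee_addgt0Pr => e e0.
(* The errors add up to 2 e' + 4 k e', which this choice makes equal to e. *)
have e1 : 0 < e / (2 + 4 * k) by rewrite divr_gt0// addr_gt0// mulr_gt0.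
have [f [fL [mf foo] mF fu fg]] := ft_graph_near ug e1.
apply: le_trans (sqint_le_sub mu mg mF) _.
rewrite sqint_subC (bP fL).
set e' := e / _ in e1 fu fg.
have -> : e = 2 * e' + 2 * k * (2 * e').
  by rewrite /e'; field; rewrite gt_eqF// addr_gt0// mulr_gt0.
have fle : (sqint mu f <= (2 * e')%:E + 2%:E * sqint mu u)%E.
  apply: le_trans (sqint_le_sub mu mf mu_) _.
  by rewrite EFinM leeD2r// lee_wpmul2l.
apply: (@le_trans _ _ ((2 * e')%:E + (2 * k)%:E * ((2 * e')%:E + 2%:E * sqint mu u))%E).
  apply: leeD; first by rewrite EFinM lee_wpmul2l.
  by rewrite muleA -EFinM lee_wpmul2l// lee_fin mulr_ge0// ltW.
rewrite ge0_muleDr ?mule_ge0 ?sqint_ge0//; last by rewrite lee_fin mulr_ge0// ltW.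
rewrite !muleA -!EFinM addeA -EFinD addeC (_ : 2 * k * 2 = 4 * k)//; ring.
Qed.

Lemma ft_graph_ge u g : ft_graph u g -> (k%:E * sqint mu u <= 4%:E * sqint mu g)%E.
Proof.
move=> ug; have [[mu_ uoo] [mg goo] _] := ug.
apply/lee_addgt0Pr => e e0.
have e1 : 0 < e / (4 + 2 * k) by rewrite divr_gt0// addr_gt0// mulr_gt0.
have [f [fL [mf foo] mF fu fg]] := ft_graph_near ug e1.
set e' := e / _ in e1 fu fg.
have -> : e = k * (2 * e') + 2 * (2 * e').
  by rewrite /e'; field; rewrite gt_eqF// addr_gt0// mulr_gt0.
have ule : (sqint mu u <= (2 * e')%:E + 2%:E * sqint mu f)%E.
  apply: le_trans (sqint_le_sub mu mu_ mf) _.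
  by rewrite sqint_subC EFinM leeD2r// lee_wpmul2l.
have fle : (k%:E * sqint mu f <= (2 * e')%:E + 2%:E * sqint mu g)%E.
  rewrite -(bP fL); apply: le_trans (sqint_le_sub mu mF mg) _.
  by rewrite EFinM leeD2r// lee_wpmul2l.
apply: (@le_trans _ _ (k%:E * ((2 * e')%:E + 2%:E * sqint mu f))%E).
  by rewrite lee_wpmul2l// lee_fin ltW.
rewrite ge0_muleDr ?mule_ge0 ?sqint_ge0//; last by rewrite lee_fin mulr_ge0// ltW.
rewrite muleCA.
apply: (@le_trans _ _ ((k * (2 * e'))%:E + 2%:E * ((2 * e')%:E + 2%:E * sqint mu g))%E).
  by rewrite -EFinM leeD2l// lee_wpmul2l.
rewrite ge0_muleDr ?mule_ge0 ?sqint_ge0//; last by rewrite lee_fin mulr_ge0// ltW.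
by rewrite !muleA -!EFinM addeA -EFinD addeC -natrM.
Qed.

(** Approximants f and h of the same u are close to each other, hence so are their transforms, by
    Plancherel for f - h. *)
Lemma ft_graph_fun u g g' : ft_graph u g -> ft_graph u g' ->
  {ae mu, forall x, g x = g' x}.
Proof.
move=> ug ug'; have [[mu_ uoo] [mg goo] _] := ug; have [_ [mg' goo'] _] := ug'.
suff : sqint mu (fun x => g x - g' x) = 0%E.
  move/(sqint_eq0 (cmeasB mg mg')); apply: filterS => x /eqP.
  by rewrite subr_eq0 => /eqP.
apply/eqP; rewrite eq_le sqint_ge0 andbT; apply/lee_addgt0Pr => e e0; rewrite add0e.
(* 6 + 16 k counts the copies of e' along the chain from g through the two transforms to g'. *)
have e1 : 0 < e / (6 + 16 * k) by rewrite divr_gt0// addr_gt0// mulr_gt0.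
have [f [fL [mf foo] mF fu fg]] := ft_graph_near ug e1.
have [h [hL [mh hoo] mH hu hg]] := ft_graph_near ug' e1.
set e' := e / _ in e1 fu fg hu hg.
have e'0 := ltW e1.
have -> : e = 2 * e' + 2 * (2 * (k * (2 * e' + 2 * e')) + 2 * e').
  by rewrite /e'; field; rewrite gt_eqF// addr_gt0// mulr_gt0.
apply: le_trans (sqint_sub_le mu mg mF mg') _.
rewrite sqint_subC [leRHS]EFinD; apply: leeD; first by rewrite EFinM lee_wpmul2l.
rewrite EFinM lee_wpmul2l//.
apply: le_trans (sqint_sub_le mu mF mH mg') _.
rewrite [leRHS]EFinD; apply: leeD; last by rewrite EFinM lee_wpmul2l.
rewrite EFinM lee_wpmul2l//.
have -> : sqint mu (fun x => ft f x - ft h x) = sqint mu (ft (fun x => f x - h x)).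
  by apply: eq_integral => x _; rewrite /ft (phase_ftB mb x fL hL).
rewrite (bP (cL1B fL hL)) EFinM lee_wpmul2l ?lee_fin ?(ltW k0)//.
apply: le_trans (sqint_sub_le mu mf mu_ mh) _.
by rewrite [leRHS]EFinD; apply: leeD; rewrite EFinM lee_wpmul2l// sqint_subC.
Qed.

(** The preimage is 1 / k times the adjoint transform of g, an absolutely convergent integral since
    g is in L1. Its truncations to sets of finite measure are in L1 and approximate it; that their
    transforms approach g follows from the adjoint relation, without any inversion formula. *)
Lemma ft_graph_surj g : cL1 mu g -> cL2 mu g -> exists u, ft_graph u g.
Proof.
move=> gL gL2; have [mg goo] := gL2.
pose fts := phase_ft mu (fun x xi => - b xi x).
(* Symmetry of the phase makes the adjoint the transform with phase -b, which obeys Plancherel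
   too. *)
have ftsE : fts = phase_ft mu (fun x xi => - b x xi).
  by congr phase_ft; apply/funext => x; apply/funext => y; rewrite bC.
have mfts : cmeas (fts g).
  rewrite ftsE; apply: cmeas_phase_ft => //.
  exact: (measurableT_comp _ mb).
have Pfts : sqint mu (fts g) = (k%:E * sqint mu g)%E.
  by rewrite ftsE (plancherel_conj mb bP).
pose u x := (k^-1)%:C * fts g x.
have mu_ : cmeas u by apply: cmeasM => //; exact: cmeas_cst.
have Su : sqint mu u = ((k^-1)%:E * sqint mu g)%E.
  rewrite /sqint; under eq_integral do rewrite sqnM sqn_real.
  rewrite ge0_intZl ?sqr_ge0//; last 2 first.
  - by move=> x; exact: sqn_ge0.
  - exact: measurable_sqn.
  by rewrite -/(sqint mu (fts g)) Pfts muleA -EFinM expr2 -mulrA mulVf ?mulr1// gt_eqF.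
have uoo : (sqint mu u < +oo)%E.
  by rewrite Su lte_mul_pinfty// lee_fin invr_ge0 ltW.
have /sigma_finiteP[F [TF ndF Foo]] := sigma_finiteT mu.
have mF n : measurable (F n) by case: (Foo n).
pose f_ n x := (\1_(F n) x)%:C * u x.
have mf n : cmeas (f_ n) by exact: cmeas_indic.
have f_le n x : sqn (f_ n x) <= sqn (u x).
  rewrite sqnM sqn_real indicE; case: (_ \in _) => /=.
    by rewrite expr1n mul1r.
  by rewrite expr0n mul0r sqn_ge0.
have fL2 n : cL2 mu (f_ n).
  split=> //; apply: le_lt_trans uoo; apply: ge0_int_le => //.
  - by move=> x; exact: sqn_ge0.
  - exact: measurable_sqn.
  - exact: measurable_sqn.
have fL n : cL1 mu (f_ n).
  by apply: cL1_fin_supp => //; case: (Foo n).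
have fu : (fun n => sqint mu (fun x => f_ n x - u x)) @ \oo --> 0%E.
  have mD n : measurable_fun setT (fun x => (sqn (f_ n x - u x))%:E).
    by apply/measurable_EFinP; exact: measurable_sqn (cmeasB (mf n) mu_).
  have m0 : measurable_fun setT (cst 0%E : T -> \bar R) by exact: measurable_cst.
  have iu : mu.-integrable setT (EFin \o (fun x => sqn (u x))).
    by apply: integrable_ge0P => //; [move=> x; exact: sqn_ge0|exact: measurable_sqn].
  (* The bound is |u|^2: at each point [f_ n] equals u from some n on, and before that the
     difference is -u. *)
  have := @dominated_convergence _ T R mu setT measurableT
    (fun n x => (sqn (f_ n x - u x))%:E) (cst 0%E) (EFin \o (fun x => sqn (u x))) mD m0.
  case.
  - apply: aeW => x _.
    have : setT x by []; rewrite TF => -[N _ FNx].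
    apply: (@cvg_near_cst _ _ _ _ _ eventually_filter).
    exists N => // n /= Nn; rewrite /f_ indicE mem_set ?mul1r ?subrr ?sqn0//.
    by move: x FNx; exact/subsetPset/ndF.
  - exact: iu.
  - apply: aeW => x n _ /=; rewrite lee_fin ger0_norm ?sqn_ge0//.
    rewrite /f_ indicE; case: (_ \in _) => /=.
      by rewrite mul1r subrr sqn0 sqn_ge0.
    by rewrite mul0r sub0r sqnN.
  - by move=> _ _; rewrite integral0.
exists u; split => //; exists f_; split => //.
have ftL2 n : cL2 mu (ft (f_ n)).
  split; first exact: (cmeas_phase_ft mu mb (mf n)).
  by rewrite (bP (fL n)) lte_mul_pinfty ?lee_fin ?(ltW k0)//; case: (fL2 n).
(* Expand both squares: the adjoint relation matches the cross terms, and the squared norm of g is k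
   times that of u. *)
have E n : sqint mu (fun x => ft (f_ n) x - g x) =
    (k%:E * sqint mu (fun x => (f_ n x - u x)%R))%E.
  rewrite (sqintB_expand (ftL2 n) gL2) (sqintB_expand (fL2 n) (conj mu_ uoo)).
  rewrite (phase_ft_adjoint mb (fL n) gL) (bP (fL n)) -EFinM; congr EFin.
  have -> : sqint mu g = (k%:E * sqint mu u)%E.
    by rewrite Su muleA -EFinM divff ?mul1e// gt_eqF.
  have -> : cint mu (fun x => f_ n x * conjc (fts g x)) =
      k%:C * cint mu (fun x => f_ n x * conjc (u x)).
    rewrite -cintZ; last exact: (cL1_mulJ (fL2 n) (conj mu_ uoo)).
    have kV : k%:C * (k^-1)%:C = 1 :> R[i] by rewrite -rmorphM/= divff ?gt_eqF.
    apply: eq_cint => x; rewrite /u conjM conjc_real (mulrCA (f_ n x)).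
    by rewrite [RHS]mulrA kV mul1r.
  have [_ foo] := fL2 n.
  have -> z : Re (k%:C * z) = k * Re z by rewrite ReM/= mul0r subr0.
  move: (Re _) => I; rewrite !fineM ?ge0_fin_numE ?sqint_ge0 ?ltry ?lee_fin ?(ltW k0)//=; ring.
under eq_fun do rewrite E.
rewrite -(mule0 k%:E); exact: cvgeZl.
Qed.

End fourier_graph.

(** * The transform on spacetime *)

Section fourier4.
Context {R : realType}.
Notation mu := (@lebesgue_measure R).
Notation mu4 := (lebesgue4 R).
Implicit Types f g u v : spacetime R -> R[i].

Lemma L2norm_ge0 f : (0 <= L2norm f)%E.
Proof. exact: Lnorm_ge0. Qed.

Lemma sqr_L2norm f : (L2norm f * L2norm f = sqint mu4 f)%E.
Proof.
have E : (L2norm f `^ 2 = sqint mu4 f)%E.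
  rewrite /L2norm poweR_Lnorm//; apply: eq_integral => x _.
  rewrite gee0_abs ?lee_fin ?normc_ge0// poweR_EFin powR_mulrn ?normc_ge0//.
  by rewrite sqr_normc.
rewrite -E; case: (L2norm f) (L2norm_ge0 f) => [r||] //.
  by rewrite lee_fin => r0; rewrite poweR_EFin -EFinM powR_mulrn// expr2.
by move=> _; rewrite mulyy poweRyr.
Qed.

Lemma L2norm_lty f : (L2norm f < +oo)%E = (sqint mu4 f < +oo)%E.
Proof.
rewrite -sqr_L2norm; have := L2norm_ge0 f; case: (L2norm f) => [r||] //.
by rewrite -EFinM !ltry.
Qed.

Lemma L2norm_le f (r : R) : 0 <= r ->
  (L2norm f <= r%:E)%E = (sqint mu4 f <= (r ^+ 2)%:E)%E.
Proof.
move=> r0; rewrite -sqr_L2norm; have := L2norm_ge0 f; case: (L2norm f) => [t||] //.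
by rewrite lee_fin => t0; rewrite -EFinM !lee_fin -expr2 ler_sqr.
Qed.

Lemma L2norm_cvg0 (F : nat -> spacetime R -> R[i]) :
  ((fun n => L2norm (F n)) @ \oo --> 0%E) <->
  ((fun n => sqint mu4 (F n)) @ \oo --> 0%E).
Proof.
rewrite (ecvg0P (fun n => L2norm_ge0 _)) (ecvg0P (fun n => sqint_ge0 _ _)).
split=> H e e0.
  have se : 0 < Num.sqrt e by rewrite sqrtr_gt0.
  apply: filterS (H _ se) => n.
  by rewrite L2norm_le ?sqrtr_ge0// sqr_sqrtr// ltW.
have ee : 0 < e ^+ 2 by rewrite exprn_gt0.
by apply: filterS (H _ ee) => n; rewrite L2norm_le// ltW.
Qed.

Lemma inL2E f : inL2 f <-> cL2 mu4 f.
Proof. by rewrite /inL2 /cL2 L2norm_lty. Qed.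

Lemma is_fourierE u g : is_fourier u g <-> ft_graph mu4 (@dot4 R) u g.
Proof.
split.
  move=> [/inL2E uL /inL2E gL [f_ [fL /L2norm_cvg0 fu /L2norm_cvg0 fg]]].
  split=> //; exists f_; split => // n.
  by have [f1 /inL2E f2] := fL n.
move=> [uL gL [f_ [fL fu fg]]]; split; [exact/inL2E|exact/inL2E|].
exists f_; split; [|exact/L2norm_cvg0|exact/L2norm_cvg0] => n.
by have [f1 f2] := fL n; split; [exact: f1|exact/inL2E].
Qed.

(* This is (2 pi)^4, but only its positivity matters. *)
Definition planch4 : R := (2 * qint) * ((2 * qint * (2 * qint)) * (2 * qint)).

Lemma planch4_gt0 : 0 < planch4.
Proof.
have q : 0 < 2 * qint :> R by rewrite mulr_gt0// qint_gt0.
exact: (mulr_gt0 q (mulr_gt0 (mulr_gt0 q q) q)).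
Qed.

Lemma measurable_dot : measurable_fun setT
  (fun z : space3 R * space3 R => dot z.1 z.2).
Proof.
apply: measurable_funD; last by apply: measurable_funM; mproj.
by apply: measurable_funD; apply: measurable_funM; mproj.
Qed.

Lemma measurable_dot4 : measurable_fun setT
  (fun z : spacetime R * spacetime R => dot4 z.1 z.2).
Proof.
apply: measurable_funD; first by apply: measurable_funM; mproj.
by apply: (measurableT_comp measurable_dot (g := fun z => (z.1.2, z.2.2))); mproj.
Qed.

Lemma dot4C (X Y : spacetime R) : dot4 X Y = dot4 Y X.
Proof. by rewrite /dot4 /dot; ring. Qed.

(** The tensor products follow the nesting of [lebesgue4], with time as the left factor of space;
    [planch4] is bracketed accordingly. *)
Lemma plancherel4 : plancherel mu4 (@dot4 R) planch4.
Proof.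
have q : 0 <= 2 * qint :> R by rewrite ltW// mulr_gt0// qint_gt0.
have m1 := @measurable_phase1d R.
have P1 := @plancherel1 R.
have P2 := plancherel_tensor m1 m1 q q P1 P1.
have m2 : measurable_fun setT (fun z : (measurableTypeR R * measurableTypeR R) *
    (measurableTypeR R * measurableTypeR R) =>
    phase1 z.1.1 z.2.1 + phase1 z.1.2 z.2.2 : R).
  by apply: measurable_funD; apply: measurable_funM; mproj.
have P3 := plancherel_tensor m2 m1 (mulr_ge0 q q) q P2 P1.
exact: (plancherel_tensor m1 measurable_dot q (mulr_ge0 (mulr_ge0 q q) q) P1 P3).
Qed.

End fourier4.

(** * The angle and the line integrals *)

Section angle_facts.
Context {R : realType}.
Implicit Types a : space3 R.

(** The Taylor bounds serve only up to 1, so the angle is halved: w = y / 2 <= 1 because pi <= 4,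
    and sin y = 2 sin w cos w with sin w >= w / 2 and cos w >= 1 / 2. *)
Lemma sin_lower (y : R) : 0 <= y -> y <= pi / 2 -> y / 4 <= sin y.
Proof.
move=> y0 ypi; have pi4 : pi <= 4 :> R by have := @pihalf_02 R; lra.
set w := y / 2.
have -> : y = w + w by rewrite /w; lra.
have w0 : 0 <= w by rewrite divr_ge0.
have w1 : w <= 1 by rewrite /w; lra.
have w2 : w ^+ 2 <= 1 by rewrite expr_le1.
rewrite sinD.
have S := sin_ge w0.
have C := onemcos_le w.
have s1 : w / 2 <= sin w by apply: le_trans S; nra.
have c1 : 2^-1 <= cos w by lra.
nra.
Qed.

(** For t = cos theta the root is the chord 2 sin (theta / 2), and theta / 2 lies in the range of
    [sin_lower]. *)
Lemma acos_le_sqrt (t : R) : -1 <= t <= 1 -> acos t <= 4 * Num.sqrt (2 - 2 * t).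
Proof.
move=> t1.
have p0 := acos_ge0 t1; have pp := acos_lepi t1.
have E : 1 - t = 2 * sin (acos t / 2) ^+ 2.
  by rewrite -cos_double acosK// in_itv.
have -> : 2 - 2 * t = (2 * sin (acos t / 2)) ^+ 2.
  by move: E; move: (sin _) => s E; lra.
have L := @sin_lower (acos t / 2) _ _.
have {}L : acos t / 2 / 4 <= sin (acos t / 2).
  by apply: L; rewrite ?divr_ge0// ler_pM2r.
rewrite sqrtr_sqr ger0_norm; first by lra.
by rewrite mulr_ge0// (le_trans _ L)// !divr_ge0.
Qed.

Lemma dot_ge0 a : 0 <= dot a a.
Proof. by rewrite /dot -!expr2 !addr_ge0 ?sqr_ge0. Qed.

Lemma enorm_ge0 a : 0 <= enorm a.
Proof. exact: sqrtr_ge0. Qed.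

Lemma sqr_enorm a : enorm a ^+ 2 = dot a a.
Proof. by rewrite sqr_sqrtr// dot_ge0. Qed.

Lemma dot_le a b : `|dot a b| <= enorm a * enorm b.
Proof.
rewrite -(@ler_pXn2r _ 2) ?nnegrE ?mulr_ge0 ?enorm_ge0// exprMn !sqr_enorm.
rewrite real_normK ?num_real// /dot -subr_ge0.
have -> : (a.1.1 * a.1.1 + a.1.2 * a.1.2 + a.2 * a.2) *
  (b.1.1 * b.1.1 + b.1.2 * b.1.2 + b.2 * b.2) -
  (a.1.1 * b.1.1 + a.1.2 * b.1.2 + a.2 * b.2) ^+ 2 =
  (a.1.1 * b.1.2 - a.1.2 * b.1.1) ^+ 2 + (a.1.1 * b.2 - a.2 * b.1.1) ^+ 2 +
  (a.1.2 * b.2 - a.2 * b.1.2) ^+ 2 by ring.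
by rewrite !addr_ge0 ?sqr_ge0.
Qed.

Lemma angle_arg a b : -1 <= dot a b / (enorm a * enorm b) <= 1.
Proof.
rewrite -ler_norml normrM normfV (ger0_norm (mulr_ge0 (enorm_ge0 a) (enorm_ge0 b))).
(* For a zero vector the quotient is 0 by convention, so the argument of [acos] is admissible for
   all vectors. *)
have [->|n0] := eqVneq (enorm a * enorm b) 0; first by rewrite invr0 mulr0.
by rewrite ler_pdivrMr ?mul1r ?dot_le// lt_neqAle eq_sym n0 mulr_ge0 ?enorm_ge0.
Qed.

Lemma angle_ge0 a b : 0 <= angle a b.
Proof. exact/acos_ge0/angle_arg. Qed.

Lemma angle_lepi a b : angle a b <= pi.
Proof. exact/acos_lepi/angle_arg. Qed.

Lemma enorm_pm (s : bool) a : enorm (scale3 (pm s) a) = enorm a.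
Proof. by rewrite /enorm /dot /scale3 /=; congr Num.sqrt; case: s => /=; ring. Qed.

(* the i-th component of the difference of the unit vectors *)
Definition udiff (s1 s2 : bool) (na nb x y : R) : R := pm s1 * x / na - pm s2 * y / nb.

(* the chord |e1 - e2| is 2 sin(theta / 2) *)
Lemma angle_le s1 s2 a b : 0 < enorm a -> 0 < enorm b ->
  angle (scale3 (pm s1) a) (scale3 (pm s2) b) <=
  4 * (`|udiff s1 s2 (enorm a) (enorm b) a.1.1 b.1.1| +
       `|udiff s1 s2 (enorm a) (enorm b) a.1.2 b.1.2| +
       `|udiff s1 s2 (enorm a) (enorm b) a.2 b.2|).
Proof.
move=> a0 b0; rewrite /angle; apply: le_trans (acos_le_sqrt (angle_arg _ _)) _.
rewrite ler_wpM2l// !enorm_pm.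
set d1 := udiff _ _ _ _ _ _; set d2 := udiff _ _ _ _ _ _; set d3 := udiff _ _ _ _ _ _.
have -> : 2 - 2 * (dot (scale3 (pm s1) a) (scale3 (pm s2) b) / (enorm a * enorm b)) =
    d1 ^+ 2 + d2 ^+ 2 + d3 ^+ 2.
  have Ea := sqr_enorm a; have Eb := sqr_enorm b.
  have P s : pm s ^+ 2 = 1 :> R by case: s; rewrite /= ?expr1n ?sqrrN ?expr1n.
  rewrite /d1 /d2 /d3 /udiff.
  move: Ea Eb a0 b0; rewrite /dot /scale3/=.
  move: (enorm a) (enorm b) => na nb Ea Eb a0 b0.
  transitivity (pm s1 ^+ 2 * (na ^+ 2 / na ^+ 2) + pm s2 ^+ 2 * (nb ^+ 2 / nb ^+ 2) -
    2 * ((pm s1 * a.1.1 * (pm s2 * b.1.1) + pm s1 * a.1.2 * (pm s2 * b.1.2) +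
      pm s1 * a.2 * (pm s2 * b.2)) / (na * nb))).
    by rewrite !P !mul1r !divff ?expf_neq0 ?gt_eqF//; lra.
  rewrite {1}Ea {1}Eb; field.
  by rewrite !gt_eqF.
rewrite -[leRHS]ger0_norm ?addr_ge0// -sqrtr_sqr ler_sqrt ?sqr_ge0//.
rewrite -(real_normK (num_real d1)) -(real_normK (num_real d2)) -(real_normK (num_real d3)).
move: (normr_ge0 d1) (normr_ge0 d2) (normr_ge0 d3).
move: `|d1| `|d2| `|d3| => x y z x0 y0 z0.
have := mulr_ge0 x0 y0; have := mulr_ge0 x0 z0; have := mulr_ge0 y0 z0; nra.
Qed.

(** [acos] decreases on [-1, 1]; composed with the clamp to that interval it is monotone on the
    whole line, hence measurable. *)
Lemma measurable_acos_arg d (T : measurableType d) (h : T -> R) :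
  measurable_fun setT h -> (forall x, -1 <= h x <= 1) ->
  measurable_fun setT (fun x => acos (h x)).
Proof.
move=> mh h1.
pose clamp (t : R) := Num.max (-1) (Num.min 1 t).
have clamp_itv t : -1 <= clamp t <= 1.
  by rewrite /clamp le_max lexx/= ge_max ge_min lexx/= andbT; lra.
have ma : measurable_fun setT (fun t => acos (clamp t)).
  apply: nonincreasing_measurable => // x y xy.
  rewrite leNgt; apply/negP => lt.
  have : cos (acos (clamp y)) < cos (acos (clamp x)).
    by rewrite ltr_cos// in_itv/= acos_ge0 ?acos_lepi.
  rewrite !acosK ?in_itv//= ltNge => /negP; apply.
  by rewrite /clamp ge_max !le_max lexx/= le_min !ge_min lexx xy !orbT.
under eq_fun => x.
  rewrite (_ : h x = clamp (h x)); last first.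
    by have /andP[? ?] := h1 x; rewrite /clamp min_r// max_r.
  over.
exact: (measurableT_comp ma mh).
Qed.

End angle_facts.

(** * Total variation along an interval *)

Section variation.
Context {R : realType}.
Notation mu := (@lebesgue_measure R).
Implicit Types (F f : R -> R).

Lemma int_norm_derive_le F f (M a b : R) :
  (forall x : R, is_derive x 1 F (f x)) -> continuous f ->
  (forall x, `|F x| <= M) -> a <= b ->
  (forall x, a <= x <= b -> 0 <= f x) \/ (forall x, a <= x <= b -> f x <= 0) ->
  (\int[mu]_(x in `[a, b]) `|f x|%:E <= (2 * M)%:E)%E.
Proof.
move=> dF cf FM + sg.
have M0 : 0 <= M by exact: le_trans (normr_ge0 _) (FM 0).
wlog f0 : F f dF cf FM sg / (forall x, a <= x <= b -> 0 <= f x).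
  move=> H; have [f0|f0] := sg; first exact: H f0.
  rewrite (_ : (\int[mu]_(x in _) _ = \int[mu]_(x in `[a, b]) `|- f x|%:E)%E).
    apply: (H (fun x => - F x)).
    - by move=> x; apply: cvgN; exact: cf.
    - by move=> x; rewrite normrN.
    - by left => x xab; rewrite oppr_ge0 f0.
    - by move=> x xab; rewrite oppr_ge0 f0.
  by apply: eq_integral => x _; rewrite normrN.
rewrite le_eqVlt => /predU1P[<-|ab].
  by rewrite set_itv1 integral_set1 lee_fin mulr_ge0.
have -> : (\int[mu]_(x in `[a, b]) `|f x|%:E = \int[mu]_(x in `[a, b]) (f x)%:E)%E.
  apply: eq_integral => x; rewrite inE/= in_itv/= => xab.
  by rewrite ger0_norm// f0.
have cF : continuous F.
  by move=> x; apply/differentiable_continuous/derivable1_diffP; apply: ex_derive.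
rewrite (@continuous_FTC2 R f F a b)//.
- rewrite -EFinB lee_fin; have := FM a; have := FM b.
  by rewrite !ler_norml => /andP[_ ?] /andP[? _]; lra.
- exact: continuous_subspaceT.
- split.
  + by move=> x _; apply: ex_derive.
  + by apply: cvg_at_right_filter; exact: cF.
  + by apply: cvg_at_left_filter; exact: cF.
- by move=> x _; rewrite derive1E; apply: derive_val.
Qed.

(* a derivative whose sign is that of an affine function changes sign once *)
Lemma int_norm_derive_affine_le F f (M a b al be : R) :
  (forall x : R, is_derive x 1 F (f x)) -> continuous f ->
  (forall x, `|F x| <= M) ->
  (forall x, (0 <= al * x + be -> 0 <= f x) /\ (al * x + be <= 0 -> f x <= 0)) ->
  (\int[mu]_(x in `[a, b]) `|f x|%:E <= (4 * M)%:E)%E.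
Proof.
move=> dF cf FM sg.
have M0 : 0 <= M by exact: le_trans (normr_ge0 _) (FM 0).
have [ab|ba] := leP a b; last first.
  by rewrite set_itv_ge ?integral_set0 ?lee_fin ?mulr_ge0// bnd_simp -ltNge.
have one : ((2 * M)%:E <= (4 * M)%:E)%E by rewrite lee_fin; lra.
(* The zero of the affine function, meaningful only for nonzero [al]; for [al] = 0 the sign is
   constant. *)
pose m := - be / al.
have half c d : c <= d -> al = 0 \/ d <= m \/ m <= c ->
    (\int[mu]_(x in `[c, d]) `|f x|%:E <= (2 * M)%:E)%E.
  move=> cd H; apply: (int_norm_derive_le dF cf FM cd).
  have [al0|aln] := eqVneq al 0.
    have [be0|be0] := leP 0 be.
      by left => x _; apply (sg x).1; rewrite al0 mul0r add0r.
    by right => x _; apply (sg x).2; rewrite al0 mul0r add0r ltW.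
  have E x : al * x + be = al * (x - m) by rewrite /m; field.
  have [ap|an] := ltP 0 al; last first.
    have {}an : al < 0 by rewrite lt_neqAle aln.
    case: H => [/eqP|[dm|mc]]; first by rewrite (negbTE aln).
      left => x /andP[_ xd]; apply (sg x).1; rewrite E nmulr_rge0// subr_le0.
      exact: le_trans dm.
    right => x /andP[cx _]; apply (sg x).2; rewrite E nmulr_rle0// subr_ge0.
    exact: le_trans cx.
  case: H => [/eqP|[dm|mc]]; first by rewrite (negbTE aln).
    right => x /andP[_ xd]; apply (sg x).2; rewrite E pmulr_rle0// subr_le0.
    exact: le_trans dm.
  left => x /andP[cx _]; apply (sg x).1; rewrite E pmulr_rge0// subr_ge0.
  exact: le_trans cx.
have [al0|aln] := eqVneq al 0; first by apply: le_trans (half a b ab _) one; left.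
have [mb|mb] := leP b m; first by apply: le_trans (half a b ab _) one; right; left.
have [ma|ma] := leP m a; first by apply: le_trans (half a b ab _) one; right; right.
have mf : measurable_fun (setT : set R) (fun x => `|f x|%:E).
  apply/measurable_EFinP; apply: measurableT_comp => //.
  exact: continuous_measurable_fun.
rewrite (@itv_bndbnd_setU _ _ _ (BRight m)); last 2 first.
- by rewrite bnd_simp ltW.
- by rewrite bnd_simp ltW.
rewrite ge0_integral_setU//=; last 2 first.
- exact: measurable_funTS.
- apply/disj_setPS => y [/=]; rewrite 2!in_itv/= => /andP[_ ym] /andP[].
  by rewrite ltNge ym.
have -> : (4 * M)%:E = ((2 * M)%:E + (2 * M)%:E)%E by rewrite -EFinD; congr EFin; lra.
apply: leeD.
  by apply: half; [exact: ltW|right; left].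
rewrite integral_itv_obnd_cbnd; last exact: measurable_funTS.
by apply: half; [exact: ltW|right; right].
Qed.

End variation.

(** * The derivative of the phase on a line parallel to an axis *)

Section line.
Context {R : realType}.
Notation mu := (@lebesgue_measure R).

(** The left side is the increasing function s / sqrt (s^2 + 1) at s = x / a, the right side the
    same function at y / c. *)
Lemma ratio_le (a c x y : R) : 0 < a -> 0 < c -> x * c <= y * a ->
  x / Num.sqrt (x ^+ 2 + a ^+ 2) <= y / Num.sqrt (y ^+ 2 + c ^+ 2).
Proof.
move=> a0 c0.
have a2 : 0 < a ^+ 2 by rewrite exprn_gt0.
have c2 : 0 < c ^+ 2 by rewrite exprn_gt0.
have sq z w : 0 < w -> 0 < z ^+ 2 + w :> R by move=> w0; rewrite ltr_wpDl ?sqr_ge0.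
set s := Num.sqrt (x ^+ 2 + _); set t := Num.sqrt (y ^+ 2 + _).
have s0 : 0 < s by rewrite sqrtr_gt0 sq.
have t0 : 0 < t by rewrite sqrtr_gt0 sq.
have s2 : s ^+ 2 = x ^+ 2 + a ^+ 2 by rewrite sqr_sqrtr// ltW// sq.
have t2 : t ^+ 2 = y ^+ 2 + c ^+ 2 by rewrite sqr_sqrtr// ltW// sq.
move=> H; rewrite ler_pdivrMr// mulrAC ler_pdivlMr//.
have [x0|x0] := leP x 0; have [y0|y0] := leP 0 y.
- by apply: (@le_trans _ _ 0); [rewrite mulr_le0_ge0// ltW|rewrite mulr_ge0// ltW].
- have xc : x * c < 0 by apply: le_lt_trans H _; rewrite nmulr_rlt0.
  rewrite -lerN2 -!mulNr -(@ler_pXn2r _ 2) ?nnegrE//; last 2 first.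
  + by rewrite mulr_ge0 ?oppr_ge0 ?x0 ?(ltW y0) ?(ltW s0) ?(ltW t0).
  + by rewrite mulr_ge0 ?oppr_ge0 ?x0 ?(ltW y0) ?(ltW s0) ?(ltW t0).
  rewrite !exprMn !sqrrN s2 t2 !mulrDr [y ^+ 2 * x ^+ 2]mulrC lerD2l -!exprMn.
  have ya : y * a <= 0 by rewrite mulr_le0_ge0 ?(ltW y0) ?(ltW a0).
  by rewrite -(sqrrN (y * a)) -(sqrrN (x * c)) ler_pXn2r ?nnegrE ?oppr_ge0 ?lerN2 ?(ltW xc).
- have ya : 0 <= y * a by rewrite mulr_ge0// ltW.
  rewrite -(@ler_pXn2r _ 2) ?nnegrE ?(mulr_ge0 (ltW x0) (ltW t0)) ?(mulr_ge0 y0 (ltW s0))//.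
  rewrite !exprMn s2 t2 !mulrDr [y ^+ 2 * x ^+ 2]mulrC lerD2l -!exprMn.
  by rewrite ler_pXn2r ?nnegrE ?ya ?(mulr_ge0 (ltW x0) (ltW c0)).
- have : 0 < y * a by apply: lt_le_trans H; rewrite mulr_gt0.
  by rewrite pmulr_lgt0// ltNge ltW.
Qed.

Variables (s1 s2 : bool) (p q x0 tau dl : R).
Hypotheses (p0 : 0 < p) (q0 : 0 < q) (dl0 : 0 < dl).

(* At most 2, and at least 1 where |v - tau| <= dl, so that it majorizes the
   indicator of that interval; wt \o phi times phi' has an explicit primitive. *)
Definition wt v : R := 2 / (1 + ((v - tau) / dl) ^+ 2).

(** Here x is the running coordinate of xi1 and x0 that of xi0, while p and q are the squared
    distances of the line from 0 and from xi0. Both are positive, so the norms [n1] and [n2] are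
    smooth on the line. *)
Let n1 x : R := Num.sqrt (x ^+ 2 + p).
Let n2 x : R := Num.sqrt ((x0 - x) ^+ 2 + q).
Let phi x := pm s1 * n1 x + pm s2 * n2 x.
Let D x := udiff s1 s2 (n1 x) (n2 x) x (x0 - x).

Let pos1 x : 0 < x ^+ 2 + p. Proof. by rewrite ltr_wpDl ?sqr_ge0. Qed.
Let pos2 x : 0 < (x0 - x) ^+ 2 + q. Proof. by rewrite ltr_wpDl ?sqr_ge0. Qed.
Let n1_gt0 x : 0 < n1 x. Proof. by rewrite sqrtr_gt0. Qed.
Let n2_gt0 x : 0 < n2 x. Proof. by rewrite sqrtr_gt0. Qed.

Lemma is_derive_phi (x : R) : is_derive x 1 phi (D x).
Proof.
have d1 : is_derive x 1 n1 ((2 * n1 x)^-1 * (2 * x)).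
  have H := is_derive1_sqrt (pos1 x).
  apply: (@is_derive1_comp _ Num.sqrt (fun x => x ^+ 2 + p)).
  by apply: is_derive_eq; rewrite /GRing.scale/=; ring.
have d2 : is_derive x 1 n2 ((2 * n2 x)^-1 * (- (2 * (x0 - x)))).
  have H := is_derive1_sqrt (pos2 x).
  apply: (@is_derive1_comp _ Num.sqrt (fun x => (x0 - x) ^+ 2 + q)).
  by apply: is_derive_eq; rewrite /GRing.scale/=; ring.
rewrite /phi; apply: is_derive_eq.
rewrite /D /udiff /GRing.scale/=; field.
by rewrite !gt_eqF.
Qed.

Let F x := 2 * dl * atan ((phi x - tau) / dl).

Let dF (x : R) : is_derive x 1 F (D x * wt (phi x)).
Proof.
have dphi := is_derive_phi x.
have du : is_derive x 1 (fun x => (phi x - tau) / dl) (D x / dl).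
  by apply: is_derive_eq; rewrite /GRing.scale/=; ring.
have da : is_derive x 1 (atan \o (fun x => (phi x - tau) / dl))
    ((1 + ((phi x - tau) / dl) ^+ 2)^-1 * (D x / dl)).
  exact: is_derive1_comp.
rewrite /F; apply: is_derive_eq; rewrite /wt /GRing.scale/=.
have : 1 + ((phi x - tau) / dl) ^+ 2 != 0.
  by rewrite gt_eqF// ltr_wpDr ?sqr_ge0.
move: (1 + _) => z z0; field; by rewrite z0 gt_eqF.
Qed.

Let F_le x : `|F x| <= pi * dl.
Proof.
rewrite /F normrM (gtr0_norm (mulr_gt0 (ltr0n R 2) dl0)).
have : `|atan ((phi x - tau) / dl)| <= pi / 2.
  by rewrite ler_norml !ltW ?atan_gtNpi2 ?atan_ltpi2.
move: `|_| => z zpi; rewrite [leLHS](_ : _ = 2 * z * dl); last by ring.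
by rewrite ler_wpM2r ?(ltW dl0)//; lra.
Qed.

Let cn (r s : R) : continuous (fun x : R => Num.sqrt ((r - x) ^+ 2 + s)).
Proof.
move=> x; apply: continuous_comp; last exact: sqrt_continuous.
apply: cvgD; last exact: cvg_cst.
by under eq_fun do rewrite expr2; apply: cvgM; apply: cvgB;
  try exact: cvg_cst; exact: cvg_id.
Qed.

Let cn1 : continuous n1.
Proof.
rewrite (_ : n1 = fun x => Num.sqrt ((0 - x) ^+ 2 + p)); first exact: cn.
by apply/funext => x; rewrite sub0r sqrrN.
Qed.

Let cf : continuous (fun x => D x * wt (phi x)).
Proof.
move=> x.
have c1 : n1 y @[y --> x] --> n1 x by exact: cn1.
have c2 : n2 y @[y --> x] --> n2 x by exact: cn.
have cphi : phi y @[y --> x] --> phi x.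
  by apply: cvgD; apply: cvgM; try exact: cvg_cst.
apply: cvgM.
  apply: cvgB.
    apply: cvgM; first by apply: cvgM; [exact: cvg_cst|exact: cvg_id].
    by apply: cvgV => //; rewrite gt_eqF.
  apply: cvgM; first by apply: cvgM; [exact: cvg_cst|apply: cvgB; [exact: cvg_cst|exact: cvg_id]].
  by apply: cvgV => //; rewrite gt_eqF// n2_gt0.
apply: cvgM; first exact: cvg_cst.
apply: cvgV; first by rewrite gt_eqF// ltr_wpDr ?sqr_ge0.
apply: cvgD; first exact: cvg_cst.
under eq_fun do rewrite expr2.
by apply: cvgM; apply: cvgM; try exact: cvg_cst; apply: cvgB => //; exact: cvg_cst.
Qed.

Lemma wt_ge0 v : 0 <= wt v.
Proof. by rewrite divr_ge0// addr_ge0 ?sqr_ge0. Qed.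

Let a := Num.sqrt p.
Let c := Num.sqrt q.
Let a0 : 0 < a. Proof. by rewrite sqrtr_gt0. Qed.
Let c0 : 0 < c. Proof. by rewrite sqrtr_gt0. Qed.

Let ratio x y : (x * c <= y * a -> x / Num.sqrt (x ^+ 2 + p) <= y / Num.sqrt (y ^+ 2 + q)) /\
  (y * a <= x * c -> y / Num.sqrt (y ^+ 2 + q) <= x / Num.sqrt (x ^+ 2 + p)).
Proof.
have <- : a ^+ 2 = p by rewrite sqr_sqrtr// ltW.
have <- : c ^+ 2 = q by rewrite sqr_sqrtr// ltW.
by split; exact: ratio_le.
Qed.

(** Let d be the product of the two signs and y = d (x0 - x). Up to the sign [s1], D is the
    difference of x / sqrt (x^2 + a^2) and y / sqrt (y^2 + c^2); by [ratio] that difference has the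
    sign of x c - y a, which is affine in x. *)
Let sign_D : exists al be, forall x,
  (0 <= al * x + be -> 0 <= D x) /\ (al * x + be <= 0 -> D x <= 0).
Proof.
pose e : R := pm s1; pose d : R := pm s1 * pm s2.
have e1 : e = 1 \/ e = -1 by rewrite /e; case: s1; [left|right].
have d1 : d = 1 \/ d = -1.
  by rewrite /d; case: s1; case: s2; rewrite /= ?mulr1 ?mul1r ?mulrNN ?mulr1; auto.
have DE x : D x = e * (x / n1 x - d * (x0 - x) / n2 x).
  rewrite /D /udiff /e /d; have : pm s1 ^+ 2 = 1 :> R by case: s1; rewrite /= ?sqrrN expr1n.
  rewrite expr2 => ee.
  transitivity (pm s1 * (x / n1 x) - (pm s1 * pm s1) * (pm s2 * (x0 - x) / n2 x)).
    by rewrite ee; ring.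
  by ring.
have n2E x : n2 x = Num.sqrt ((d * (x0 - x)) ^+ 2 + q).
  by rewrite exprMn (_ : d ^+ 2 = 1) ?mul1r//; case: d1 => ->; rewrite ?sqrrN expr1n.
(* The slope vanishes for opposite signs and a = c, so a constant affine function has to be
   allowed. *)
exists (e * (c + d * a)), (- (e * d * x0 * a)) => x.
have -> : e * (c + d * a) * x - e * d * x0 * a = e * (x * c - d * (x0 - x) * a) by ring.
rewrite DE n2E /n1; have [r1 r2] := ratio x (d * (x0 - x)).
by case: e1 => ->; rewrite ?mul1r ?mulN1r; split; rewrite ?oppr_ge0 ?oppr_le0 ?subr_ge0 ?subr_le0.
Qed.

Lemma line_le (u v : R) :
  (\int[mu]_(x in `[u, v]) (`|D x| * wt (phi x))%:E <= (4 * (pi * dl))%:E)%E.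
Proof.
have [al [be S]] := sign_D.
rewrite (_ : (\int[mu]_(x in _) _ =
    \int[mu]_(x in `[u, v]) `|D x * wt (phi x)|%:E)%E); last first.
  by apply: eq_integral => x _; rewrite normrM (ger0_norm (wt_ge0 _)).
apply: (int_norm_derive_affine_le u v dF cf F_le (al := al) (be := be)) => x.
by have [S1 S2] := S x; split=> H; [apply: mulr_ge0|apply: mulr_le0_ge0];
  rewrite ?wt_ge0 ?S1 ?S2.
Qed.

End line.

(** * Lines over a square of transverse coordinates *)

Section slab.
Context {R : realType}.
Notation mu := (@lebesgue_measure R).
Notation Rm := (measurableTypeR R).
Variables (s1 s2 : bool) (tau dl : R).
Hypothesis dl0 : 0 < dl.

(** The coordinates are anonymous, with t running along the line and u, v fixed, so that one
    function serves all three axes; (u0, v0, t0) is xi0 in the same order. *)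
Definition line_fun (u0 v0 t0 u v t : R) : R :=
  let A := Num.sqrt (t ^+ 2 + (u ^+ 2 + v ^+ 2)) in
  let B := Num.sqrt ((t0 - t) ^+ 2 + ((u0 - u) ^+ 2 + (v0 - v) ^+ 2)) in
  `|udiff s1 s2 A B t (t0 - t)| * wt tau dl (pm s1 * A + pm s2 * B).

Lemma line_fun_ge0 u0 v0 t0 u v t : 0 <= line_fun u0 v0 t0 u v t.
Proof. by rewrite mulr_ge0 ?wt_ge0. Qed.

Lemma measurable_line_fun d (T : measurableType d) (u0 v0 t0 : R) (u v t : T -> R) :
  measurable_fun setT u -> measurable_fun setT v -> measurable_fun setT t ->
  measurable_fun setT (fun x => line_fun u0 v0 t0 (u x) (v x) (t x)).
Proof.
move=> mu_ mv mt.
have mA : measurable_fun setT (fun x => Num.sqrt (t x ^+ 2 + (u x ^+ 2 + v x ^+ 2))).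
  apply: measurable_sqrtc; apply: measurable_funD; first exact: measurable_funX.
  by apply: measurable_funD; exact: measurable_funX.
have mB : measurable_fun setT (fun x =>
    Num.sqrt ((t0 - t x) ^+ 2 + ((u0 - u x) ^+ 2 + (v0 - v x) ^+ 2))).
  apply: measurable_sqrtc; apply: measurable_funD.
    by apply: measurable_funX; exact: measurable_funB.
  by apply: measurable_funD; apply: measurable_funX; exact: measurable_funB.
apply: measurable_funM.
  apply: measurableT_comp => //; apply: measurable_funB; apply: measurable_funM.
  - exact: measurable_funM.
  - by apply: measurable_invr_ge0 => // x; exact: sqrtr_ge0.
  - by apply: measurable_funM => //; exact: measurable_funB.
  - by apply: measurable_invr_ge0 => // x; exact: sqrtr_ge0.
apply: measurable_funM => //; apply: measurable_invr_ge0; last first.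
  by move=> x; rewrite addr_ge0 ?sqr_ge0.
apply: measurable_funD => //; apply: measurable_funX; apply: measurable_funM => //.
apply: measurable_funB => //.
by apply: measurable_funD; exact: measurable_funM.
Qed.

Definition ind (c r x : R) : R := \1_(`[c - r, c + r]%classic) x.

Lemma ind_ge0 c r x : 0 <= ind c r x.
Proof. by rewrite /ind indicE. Qed.

Lemma measurable_ind d (T : measurableType d) (c r : R) (u : T -> R) :
  measurable_fun setT u -> measurable_fun setT (fun x => ind c r (u x)).
Proof. by move=> mu_; apply: measurableT_comp => //; exact: measurable_indic. Qed.

Lemma int_ind c r : 0 <= r -> (\int[mu]_x (ind c r x)%:E = (2 * r)%:E)%E.
Proof.
move=> r0; rewrite /ind integral_indic// setIT.
rewrite [LHS](@lebesgue_measure_itv R `[c - r, c + r])/= lte_fin.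
case: ltP => [_|]; first by rewrite -EFinB; congr EFin; ring.
by move=> H; congr EFin; lra.
Qed.

Variables (u0 v0 t0 cu cv ct r : R).
Hypothesis r0 : 0 < r.

Definition slab_fun (u v t : R) : R :=
  line_fun u0 v0 t0 u v t * (ind cu r u * (ind cv r v * ind ct r t)).

Lemma slab_fun_ge0 u v t : 0 <= slab_fun u v t.
Proof. by rewrite mulr_ge0 ?line_fun_ge0// mulr_ge0 ?ind_ge0// mulr_ge0 ?ind_ge0. Qed.

Lemma measurable_slab_fun d (T : measurableType d) (u v t : T -> R) :
  measurable_fun setT u -> measurable_fun setT v -> measurable_fun setT t ->
  measurable_fun setT (fun x => slab_fun (u x) (v x) (t x)).
Proof.
move=> mu_ mv mt; apply: measurable_funM; first exact: measurable_line_fun.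
by apply: measurable_funM; [|apply: measurable_funM]; exact: measurable_ind.
Qed.

Lemma slab_inner_le u v : u != 0 -> u != u0 ->
  (\int[mu]_t (slab_fun u v t)%:E <= (4 * (pi * dl) * (ind cu r u * ind cv r v))%:E)%E.
Proof.
move=> un0 uu0.
have p0 : 0 < u ^+ 2 + v ^+ 2.
  by rewrite ltr_pwDl ?sqr_ge0// lt_neqAle eq_sym sqrf_eq0 un0 sqr_ge0.
have q0 : 0 < (u0 - u) ^+ 2 + (v0 - v) ^+ 2.
  by rewrite ltr_pwDl ?sqr_ge0// lt_neqAle eq_sym sqrf_eq0 subr_eq0 eq_sym uu0 sqr_ge0.
have i0 : 0 <= ind cu r u * ind cv r v by rewrite mulr_ge0 ?ind_ge0.
have ml : measurable_fun (setT : set Rm) (fun t => line_fun u0 v0 t0 u v t).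
  by apply: measurable_line_fun => //; exact: measurable_id.
have E t : slab_fun u v t =
    (ind cu r u * ind cv r v) * (line_fun u0 v0 t0 u v t * ind ct r t).
  by rewrite /slab_fun; ring.
under eq_integral do rewrite E.
rewrite ge0_intZl//; last 2 first.
- by move=> t; rewrite mulr_ge0 ?line_fun_ge0 ?ind_ge0.
- by apply: measurable_funM => //; apply: measurable_ind; exact: measurable_id.
rewrite [in leRHS]mulrC [leRHS]EFinM lee_wpmul2l ?lee_fin//.
rewrite (_ : (\int[mu]_t _ = \int[mu]_(t in `[(ct - r)%R, (ct + r)%R]) (line_fun u0 v0 t0 u v t)%:E)%E).
  exact: line_le.
rewrite [RHS]integral_mkcond; apply: eq_integral => t _.
rewrite patchE /ind indicE; case: ifPn => _; first by rewrite mulr1.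
by rewrite mulr0.
Qed.

Lemma slab_le :
  (\int[mu]_u \int[mu]_v \int[mu]_t (slab_fun u v t)%:E
   <= (4 * (pi * dl) * ((2 * r) * (2 * r)))%:E)%E.
Proof.
have pd0 : 0 <= 4 * (pi * dl) by rewrite mulr_ge0// mulr_ge0 ?pi_ge0 ?ltW.
have mS : measurable_fun setT (fun z : (Rm * Rm) * Rm => (slab_fun z.1.1 z.1.2 z.2)%:E).
  by apply/measurable_EFinP; apply: measurable_slab_fun; mproj.
have mPhi := measurable_fun_fubini_tonelli_F (m2 := mu) _ mS
  (fun z => (slab_fun_ge0 z.1.1 z.1.2 z.2 : (0 <= (slab_fun _ _ _)%:E)%E)).
have Phi0 (z : Rm * Rm) : (0 <= fubini_F mu (fun z : (Rm * Rm) * Rm =>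
    (slab_fun z.1.1 z.1.2 z.2)%:E) z)%E.
  by apply: int_ge0 => t; exact: slab_fun_ge0.
have mPsi := measurable_fun_fubini_tonelli_F (m2 := mu) _ mPhi Phi0.
have mi (c : R) : measurable_fun (setT : set Rm) (ind c r).
  by apply: measurable_indic.
apply: (@le_trans _ _ (\int[mu]_u ((4 * (pi * dl) * (2 * r)) * ind cu r u)%:E)%E).
  apply: ae_ge0_le_integral => //.
  - by move=> u _; apply: integral_ge0 => v _; apply: int_ge0 => t; exact: slab_fun_ge0.
  - by move=> u _; rewrite lee_fin mulr_ge0 ?ind_ge0// mulr_ge0// mulr_ge0// ltW.
  - by apply/measurable_EFinP; exact: measurable_funM.
  (* The planes u = 0 and u = u0 contain every line that meets a singular point of the phase. *)
  exists [set 0; u0]; split.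
  - by apply: measurableU; exact: measurable_set1.
  - apply/eqP; rewrite eq_le measure_ge0 andbT.
    apply: le_trans (measureU2 _ _ _) _; [exact: measurable_set1|exact: measurable_set1|].
    by rewrite [X in (X + _)%E](lebesgue_measure_set1 0) [X in (_ + X)%E](lebesgue_measure_set1 u0) adde0.
  - move=> u /=; apply: contra_notP => /not_orP[/eqP un0 /eqP uu0] _.
    apply: (@le_trans _ _ (\int[mu]_v ((4 * (pi * dl) * ind cu r u) * ind cv r v)%:E)%E).
      apply: ge0_le_integral => //.
      + by move=> v _; apply: int_ge0 => t; exact: slab_fun_ge0.
      + by apply: (measurableT_comp mPhi (g := fun v => (u, v))); mproj.
      + by apply/measurable_EFinP; exact: measurable_funM.
      + by move=> v _; rewrite -mulrA; exact: slab_inner_le.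
    rewrite (ge0_intZl mu (mulr_ge0 pd0 (ind_ge0 cu r u)) (ind_ge0 cv r) (mi cv)).
    rewrite int_ind ?(ltW r0)// -EFinM lee_fin le_eqVlt; apply/orP; left; apply/eqP; ring.
have r20 : 0 <= 2 * r by rewrite mulr_ge0// ltW.
rewrite (ge0_intZl mu (mulr_ge0 pd0 r20) (ind_ge0 cu r) (mi cu)).
rewrite int_ind ?(ltW r0)// -EFinM lee_fin le_eqVlt; apply/orP; left; apply/eqP; ring.
Qed.

End slab.

(** * The angle on the ball, by integration along the three axes *)

Section kernel_bound.
Context {R : realType}.
Notation mu := (@lebesgue_measure R).
Notation Rm := (measurableTypeR R).
Notation mu2 := (sf_product (mu : {sigma_finite_measure set Rm -> \bar R}) mu).
Notation mu3 := (sf_product (sf_product (mu : {sigma_finite_measure set Rm -> \bar R}) mu) mu).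
Notation mu4 := (lebesgue4 R).

Section tonelli3.
Variable H : R -> R -> R -> R.
Hypothesis H0 : forall x y z, 0 <= H x y z.
Hypothesis mH : forall d (T : measurableType d) (u v t : T -> R),
  measurable_fun setT u -> measurable_fun setT v -> measurable_fun setT t ->
  measurable_fun setT (fun p => H (u p) (v p) (t p)).

Let mH3 : measurable_fun setT (fun p : space3 R => (H p.1.1 p.1.2 p.2)%:E).
Proof. by apply/measurable_EFinP; apply: mH; mproj. Qed.

Let H30 (p : space3 R) : (0 <= (H p.1.1 p.1.2 p.2)%:E)%E.
Proof. by rewrite lee_fin. Qed.

(** The three orders of integration make each coordinate innermost once. [mH] quantifies over the
    source of the coordinates, so that one hypothesis covers the whole space and its sections. *)
Lemma tonelli3_xyz : (\int[mu3]_p (H p.1.1 p.1.2 p.2)%:E =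
  \int[mu]_x \int[mu]_y \int[mu]_z (H x y z)%:E)%E.
Proof.
rewrite [LHS](fubini_tonelli1 (m1 := mu2) (m2 := mu) _ mH3 H30).
have m2F := measurable_fun_fubini_tonelli_F (m2 := mu) _ mH3 H30.
rewrite [LHS](fubini_tonelli1 (m1 := mu) (m2 := mu) _ m2F)//.
by move=> p; exact: int_ge0.
Qed.

Lemma tonelli3_zxy : (\int[mu3]_p (H p.1.1 p.1.2 p.2)%:E =
  \int[mu]_z \int[mu]_x \int[mu]_y (H x y z)%:E)%E.
Proof.
rewrite [LHS](fubini_tonelli2 (m1 := mu2) (m2 := mu) _ mH3 H30).
apply: eq_integral => z _.
rewrite [LHS](fubini_tonelli1 (m1 := mu) (m2 := mu)
  (fun p : Rm * Rm => (H p.1 p.2 z)%:E))//.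
- by apply/measurable_EFinP; apply: mH; mproj.
- by move=> p; rewrite lee_fin.
Qed.

Lemma tonelli3_zyx : (\int[mu3]_p (H p.1.1 p.1.2 p.2)%:E =
  \int[mu]_z \int[mu]_y \int[mu]_x (H x y z)%:E)%E.
Proof.
rewrite [LHS](fubini_tonelli2 (m1 := mu2) (m2 := mu) _ mH3 H30).
apply: eq_integral => z _.
rewrite [LHS](fubini_tonelli2 (m1 := mu) (m2 := mu)
  (fun p : Rm * Rm => (H p.1 p.2 z)%:E))//.
- by apply/measurable_EFinP; apply: mH; mproj.
- by move=> p; rewrite lee_fin.
Qed.

End tonelli3.

Variables (s1 s2 : bool) (tau dl : R) (a c : space3 R) (r : R).
Hypotheses (dl0 : 0 < dl) (r0 : 0 < r).

(* slab_fun in the three coordinate directions; the last variable is the one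
   that is integrated first *)
Definition slab3 (x y z : R) : R :=
  slab_fun s1 s2 tau dl a.1.1 a.1.2 a.2 c.1.1 c.1.2 c.2 r x y z +
  slab_fun s1 s2 tau dl a.2 a.1.1 a.1.2 c.2 c.1.1 c.1.2 r z x y +
  slab_fun s1 s2 tau dl a.2 a.1.2 a.1.1 c.2 c.1.2 c.1.1 r z y x.

Lemma slab3_ge0 x y z : 0 <= slab3 x y z.
Proof. by rewrite !addr_ge0 ?slab_fun_ge0. Qed.

Lemma measurable_slab3 d (T : measurableType d) (u v t : T -> R) :
  measurable_fun setT u -> measurable_fun setT v -> measurable_fun setT t ->
  measurable_fun setT (fun p => slab3 (u p) (v p) (t p)).
Proof.
move=> mu_ mv mt; apply: measurable_funD; last exact: measurable_slab_fun.
by apply: measurable_funD; exact: measurable_slab_fun.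
Qed.

Lemma int_slab3 : (\int[mu3]_p (slab3 p.1.1 p.1.2 p.2)%:E
  <= (48 * (pi * dl * r ^+ 2))%:E)%E.
Proof.
have m1 := @measurable_slab_fun R s1 s2 tau dl.
(* 48 = 3 * 16: three axes, each with 4 from the line and 4 r^2 from the square. *)
have K : ((4 * (pi * dl) * ((2 * r) * (2 * r)))%:E +
    (4 * (pi * dl) * ((2 * r) * (2 * r)))%:E + (4 * (pi * dl) * ((2 * r) * (2 * r)))%:E
    = (48 * (pi * dl * r ^+ 2))%:E)%E.
  by rewrite -!EFinD; congr EFin; ring.
rewrite -K {K} /slab3.
rewrite ge0_intD; last 4 first.
- by move=> p; rewrite addr_ge0 ?slab_fun_ge0.
- by move=> p; rewrite slab_fun_ge0.
- by apply: measurable_funD; apply: m1; mproj.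
- by apply: m1; mproj.
rewrite ge0_intD; last 4 first.
- by move=> p; rewrite slab_fun_ge0.
- by move=> p; rewrite slab_fun_ge0.
- by apply: m1; mproj.
- by apply: m1; mproj.
apply: leeD; first apply: leeD.
- rewrite (tonelli3_xyz (H := fun x y z =>
    slab_fun s1 s2 tau dl a.1.1 a.1.2 a.2 c.1.1 c.1.2 c.2 r x y z)).
  + exact: slab_le.
  + by move=> x y z; exact: slab_fun_ge0.
  + by move=> d T u v t mu_ mv mt; exact: m1.
- rewrite (tonelli3_zxy (H := fun x y z =>
    slab_fun s1 s2 tau dl a.2 a.1.1 a.1.2 c.2 c.1.1 c.1.2 r z x y)).
  + exact: slab_le.
  + by move=> x y z; exact: slab_fun_ge0.
  + by move=> d T u v t mu_ mv mt; exact: m1.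
- rewrite (tonelli3_zyx (H := fun x y z =>
    slab_fun s1 s2 tau dl a.2 a.1.2 a.1.1 c.2 c.1.2 c.1.1 r z y x)).
  + exact: slab_le.
  + by move=> x y z; exact: slab_fun_ge0.
  + by move=> d T u v t mu_ mv mt; exact: m1.
Qed.

Let na (p : space3 R) := enorm p.
Let nb (p : space3 R) := enorm (sub3 a p).

Lemma sub_ball_ind (p : space3 R) : eball c r p ->
  [/\ ind c.1.1 r p.1.1 = 1, ind c.1.2 r p.1.2 = 1 & ind c.2 r p.2 = 1].
Proof.
rewrite /eball/= => H.
have h : dot (sub3 p c) (sub3 p c) < r ^+ 2.
  by rewrite -sqr_enorm ltr_sqr ?nnegrE ?enorm_ge0 ?ltW.
have K (x y : R) : (x - y) ^+ 2 < r ^+ 2 -> ind y r x = 1.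
  rewrite -[(x - y) ^+ 2]real_normK ?num_real// ltr_sqr ?nnegrE ?(ltW r0)//.
  rewrite ltr_norml => /andP[? ?]; rewrite /ind indicE mem_set//= in_itv/=.
  by apply/andP; split; lra.
move: h; rewrite /dot /sub3/= -!expr2 => h.
have := sqr_ge0 (p.1.1 - c.1.1); have := sqr_ge0 (p.1.2 - c.1.2); have := sqr_ge0 (p.2 - c.2).
by move=> ? ? ?; split; apply: K; lra.
Qed.

(** On the ball the three indicators are 1, and the weight is at least 1 because the phase is within
    [dl] of [tau]; so each component of the difference of unit vectors is below its slab. *)
Lemma angle_le_slab3 (p : space3 R) : eball c r p -> 0 < enorm p -> 0 < enorm (sub3 a p) ->
  `|pm s1 * enorm p + pm s2 * enorm (sub3 a p) - tau| <= dl ->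
  angle (scale3 (pm s1) p) (scale3 (pm s2) (sub3 a p)) <=
  4 * slab3 p.1.1 p.1.2 p.2.
Proof.
move=> /sub_ball_ind[i1 i2 i3] p0 q0 fdl.
apply: le_trans (angle_le s1 s2 p0 q0) _; rewrite ler_wpM2l//.
have w1 : 1 <= wt tau dl (pm s1 * enorm p + pm s2 * enorm (sub3 a p)).
  rewrite /wt ler_pdivlMr ?mul1r; last by rewrite ltr_wpDr ?sqr_ge0.
  have : ((pm s1 * enorm p + pm s2 * enorm (sub3 a p) - tau) / dl) ^+ 2 <= 1.
    rewrite -[leLHS]real_normK ?num_real// expr_le1// normrM normfV (gtr0_norm dl0).
    by rewrite ler_pdivrMr// mul1r.
  lra.
rewrite /slab3 /slab_fun i1 i2 i3 !mulr1 /line_fun.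
(* The norms are rewritten with each axis in turn as the running coordinate, to match the arguments
   of [line_fun]. *)
have E1 : enorm p = Num.sqrt (p.2 ^+ 2 + (p.1.1 ^+ 2 + p.1.2 ^+ 2)).
  by rewrite /enorm /dot; congr Num.sqrt; ring.
have E2 : enorm p = Num.sqrt (p.1.2 ^+ 2 + (p.2 ^+ 2 + p.1.1 ^+ 2)).
  by rewrite /enorm /dot; congr Num.sqrt; ring.
have E3 : enorm p = Num.sqrt (p.1.1 ^+ 2 + (p.2 ^+ 2 + p.1.2 ^+ 2)).
  by rewrite /enorm /dot; congr Num.sqrt; ring.
have F1 : enorm (sub3 a p) =
    Num.sqrt ((a.2 - p.2) ^+ 2 + ((a.1.1 - p.1.1) ^+ 2 + (a.1.2 - p.1.2) ^+ 2)).
  by rewrite /enorm /dot/=; congr Num.sqrt; ring.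
have F2 : enorm (sub3 a p) =
    Num.sqrt ((a.1.2 - p.1.2) ^+ 2 + ((a.2 - p.2) ^+ 2 + (a.1.1 - p.1.1) ^+ 2)).
  by rewrite /enorm /dot/=; congr Num.sqrt; ring.
have F3 : enorm (sub3 a p) =
    Num.sqrt ((a.1.1 - p.1.1) ^+ 2 + ((a.2 - p.2) ^+ 2 + (a.1.2 - p.1.2) ^+ 2)).
  by rewrite /enorm /dot/=; congr Num.sqrt; ring.
rewrite -{}E1 -{}E2 -{}E3 -{}F1 -{}F2 -{}F3 -!mulrDl.
rewrite [leRHS](_ : _ = (`|udiff s1 s2 (enorm p) (enorm (sub3 a p)) p.1.1 (a.1.1 - p.1.1)| +
  `|udiff s1 s2 (enorm p) (enorm (sub3 a p)) p.1.2 (a.1.2 - p.1.2)| +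
  `|udiff s1 s2 (enorm p) (enorm (sub3 a p)) p.2 (a.2 - p.2)|) *
  wt tau dl (pm s1 * enorm p + pm s2 * enorm (sub3 a p))); last by ring.
by rewrite ler_peMr// !addr_ge0.
Qed.

End kernel_bound.

Lemma sfX_lty d1 d2 (T1 : measurableType d1) (T2 : measurableType d2) (R : realType)
    (m1 : {sigma_finite_measure set T1 -> \bar R})
    (m2 : {sigma_finite_measure set T2 -> \bar R}) (A : set T1) (B : set T2) :
  measurable A -> measurable B -> (m1 A < +oo)%E -> (m2 B < +oo)%E ->
  (sf_product m1 m2 (A `*` B) < +oo)%E.
Proof.
move=> mA mB Aoo Boo; rewrite [X in (X < _)%E]product_measure1E//.
by rewrite lte_mul_pinfty ?ge0_fin_numE.
Qed.

(** * Measurability and finite measure of the supports *)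

Section spacetime_measurable.
Context {R : realType}.
Notation mu := (@lebesgue_measure R).
Notation mu4 := (lebesgue4 R).

Lemma measurable_dotc d (T : measurableType d) (f g : T -> space3 R) :
  measurable_fun setT f -> measurable_fun setT g ->
  measurable_fun setT (fun x => dot (f x) (g x)).
Proof.
move=> mf mg; apply: (measurableT_comp (@measurable_dot R) (g := fun x => (f x, g x))).
exact: measurable_fun_pair.
Qed.

Lemma measurable_enorm d (T : measurableType d) (f : T -> space3 R) :
  measurable_fun setT f -> measurable_fun setT (fun x => enorm (f x)).
Proof. by move=> mf; apply: measurable_sqrtc; exact: measurable_dotc. Qed.

Lemma measurable_scale3 d (T : measurableType d) (k : R) (f : T -> space3 R) :
  measurable_fun setT f -> measurable_fun setT (fun x => scale3 k (f x)).
Proof.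
move=> mf; rewrite /scale3.
have m2 : measurable_fun setT (fun x => (f x).2) by apply: (measurableT_comp measurable_snd).
have m1 : measurable_fun setT (fun x => (f x).1) by apply: (measurableT_comp measurable_fst).
have m11 : measurable_fun setT (fun x => (f x).1.1) by apply: (measurableT_comp measurable_fst m1).
have m12 : measurable_fun setT (fun x => (f x).1.2) by apply: (measurableT_comp measurable_snd m1).
by apply: measurable_fun_pair; [apply: measurable_fun_pair|]; exact: measurable_funM.
Qed.

Lemma measurable_sub3 d (T : measurableType d) (f g : T -> space3 R) :
  measurable_fun setT f -> measurable_fun setT g ->
  measurable_fun setT (fun x => sub3 (f x) (g x)).
Proof.
move=> mf mg; rewrite /sub3.
have m2 h : measurable_fun setT h -> measurable_fun setT (fun x : T => (h x : space3 R).2).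
  by move=> mh; apply: (measurableT_comp measurable_snd).
have m1 h : measurable_fun setT h -> measurable_fun setT (fun x : T => (h x : space3 R).1).
  by move=> mh; apply: (measurableT_comp measurable_fst).
have m11 h : measurable_fun setT h -> measurable_fun setT (fun x : T => (h x : space3 R).1.1).
  by move=> /m1 mh; apply: (measurableT_comp measurable_fst mh).
have m12 h : measurable_fun setT h -> measurable_fun setT (fun x : T => (h x : space3 R).1.2).
  by move=> /m1 mh; apply: (measurableT_comp measurable_snd mh).
by apply: measurable_fun_pair; [apply: measurable_fun_pair|]; apply: measurable_funB;
  (exact: m11 || exact: m12 || exact: m2).
Qed.

Lemma measurable_sub4 d (T : measurableType d) (f g : T -> spacetime R) :
  measurable_fun setT f -> measurable_fun setT g ->
  measurable_fun setT (fun x => sub4 (f x) (g x)).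
Proof.
move=> mf mg; apply: measurable_fun_pair.
  by apply: measurable_funB; [apply: (measurableT_comp measurable_fst mf)|
    apply: (measurableT_comp measurable_fst mg)].
by apply: measurable_sub3; [apply: (measurableT_comp measurable_snd mf)|
  apply: (measurableT_comp measurable_snd mg)].
Qed.

Lemma measurable_angle d (T : measurableType d) (f g : T -> space3 R) :
  measurable_fun setT f -> measurable_fun setT g ->
  measurable_fun setT (fun x => angle (f x) (g x)).
Proof.
move=> mf mg; apply: measurable_acos_arg; last by move=> x; exact: angle_arg.
apply: measurable_funM; first exact: measurable_dotc.
apply: measurable_invr_ge0; last by move=> x; rewrite mulr_ge0 ?enorm_ge0.
by apply: measurable_funM; exact: measurable_enorm.
Qed.

Lemma measurable_Kset s N L : measurable (Kset s N L : set (spacetime R)).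
Proof.
have me : measurable_fun setT (fun X : spacetime R => enorm X.2).
  by apply: measurable_enorm; mproj.
have mt : measurable_fun setT (fun X : spacetime R => `|- X.1 + pm s * enorm X.2|).
  apply: measurableT_comp => //; apply: measurable_funD.
    by apply: measurableT_comp => //; mproj.
  exact: measurable_funM.
rewrite (_ : Kset s N L = ((fun X : spacetime R => enorm X.2) @^-1` `]N / 2, N]) `&`
  ((fun X : spacetime R => `|- X.1 + pm s * enorm X.2|) @^-1` `]-oo, L])); last first.
  by apply/seteqP; split => X; rewrite /Kset/= !in_itv.
apply: measurableI.
  by rewrite -[X in measurable X]setTI; exact: me.
by rewrite -[X in measurable X]setTI; exact: mt.
Qed.

Lemma measurable_eball (c : space3 R) r : measurable (eball c r).
Proof.
have me : measurable_fun setT (fun x : space3 R => enorm (sub3 x c)).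
  by apply: measurable_enorm; apply: measurable_sub3 => //; exact: measurable_id.
rewrite (_ : eball c r = (fun x : space3 R => enorm (sub3 x c)) @^-1` `]-oo, r[).
  by rewrite -[X in measurable X]setTI; exact: me.
by apply/seteqP; split => X; rewrite /eball/= in_itv.
Qed.

(** The set lies in a box, since |tau| <= |xi| + L <= N + L. Finite measure turns L2 functions with
    this support into L1 functions. *)
Lemma Kset_lty s N L : (mu4 (Kset s N L : set (spacetime R)) < +oo)%E.
Proof.
pose I (a : R) : set (measurableTypeR R) := `[- a, a]%classic.
have mI a : measurable (I a) by exact: measurable_itv.
have Ioo a : (mu (I a) < +oo)%E.
  by rewrite (lebesgue_measure_itv `[- a, a]%R)/= lte_fin; case: ifP => _; rewrite ?ltry.
have le : Kset s N L `<=` I (N + L) `*` ((I N `*` I N) `*` I N).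
  move=> X [/andP[_ XN] XL].
  have n2 : dot X.2 X.2 <= N ^+ 2.
    by rewrite -sqr_enorm ler_sqr ?nnegrE ?enorm_ge0// (le_trans (enorm_ge0 _) XN).
  have N0 := le_trans (enorm_ge0 _) XN.
  have K (x : R) : x ^+ 2 <= N ^+ 2 -> I N x.
    rewrite -[x ^+ 2]real_normK ?num_real// ler_sqr ?nnegrE// ler_norml /I/=.
    by rewrite in_itv.
  move: n2; rewrite /dot -!expr2 => n2.
  have := sqr_ge0 X.2.1.1; have := sqr_ge0 X.2.1.2; have := sqr_ge0 X.2.2 => h1 h2 h3.
  split; last by split; [split|] => /=; apply: K; lra.
  rewrite /I/= in_itv/=; move: XL; rewrite ler_norml => /andP[l1 l2].
  have := enorm_ge0 X.2; move: l1 l2; rewrite /pm; case: s => l1 l2 e0; apply/andP; split; lra.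
have mB : measurable (I (N + L) `*` ((I N `*` I N) `*` I N) : set (spacetime R)).
  by do !apply: measurableX.
apply: le_lt_trans (le_measure _ _ _ le) _; rewrite ?inE//; first exact: measurable_Kset.
have mX := measurableX (mI N) (mI N).
have sq := sfX_lty (mI N) (mI N) (Ioo N) (Ioo N).
exact: (sfX_lty (mI _) (measurableX mX (mI N)) (Ioo _) (sfX_lty mX (mI N) sq (Ioo N))).
Qed.

End spacetime_measurable.

(** * The kernel bound, uniform in X0 *)

Section kernel4.
Context {R : realType}.
Notation mu := (@lebesgue_measure R).
Notation mu3 := (sf_product (sf_product (mu : {sigma_finite_measure set (measurableTypeR R) -> \bar R}) mu) mu).
Notation mu4 := (lebesgue4 R).
Variables (s1 s2 : bool) (N1 N2 L1 L2 r : R) (c : space3 R).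
Hypotheses (N10 : 0 < N1) (N20 : 0 < N2) (L10 : 0 < L1) (L20 : 0 < L2) (r0 : 0 < r).

Definition theta12 (X0 X1 : spacetime R) : R :=
  angle (scale3 (pm s1) X1.2) (scale3 (pm s2) (sub4 X0 X1).2).

Lemma theta12_ge0 X0 X1 : 0 <= theta12 X0 X1.
Proof. exact: angle_ge0. Qed.

Lemma measurable_theta12 :
  measurable_fun setT (fun z : spacetime R * spacetime R => theta12 z.1 z.2).
Proof.
apply: measurable_angle; apply: measurable_scale3; first by mproj.
apply: (measurableT_comp measurable_snd (g := fun z : spacetime R * spacetime R => sub4 z.1 z.2)).
by apply: measurable_sub4; mproj.
Qed.

Definition supp1 : set (spacetime R) := (setT `*` eball c r) `&` Kset s1 N1 L1.
Definition supp2 : set (spacetime R) := Kset s2 N2 L2.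

Lemma measurable_supp1 : measurable supp1.
Proof.
apply: measurableI; last exact: measurable_Kset.
by apply: measurableX => //; exact: measurable_eball.
Qed.

Definition kern (X0 X1 : spacetime R) : R :=
  theta12 X0 X1 * (\1_supp1 X1 * \1_supp2 (sub4 X0 X1)).

Lemma kern_ge0 X0 X1 : 0 <= kern X0 X1.
Proof. by rewrite mulr_ge0 ?theta12_ge0// mulr_ge0 ?indicE. Qed.

Lemma measurable_kern X0 : measurable_fun setT (kern X0).
Proof.
apply: measurable_funM.
  by apply: (measurableT_comp measurable_theta12 (g := fun X => (X0, X))); mproj.
apply: measurable_funM; first exact: measurable_indic measurable_supp1.
have mi : measurable_fun setT (\1_supp2 : spacetime R -> R) by exact: measurable_indic (measurable_Kset _ _ _).
apply: (measurableT_comp mi (g := fun X => sub4 X0 X)).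
by apply: measurable_sub4 => //; exact: measurable_id.
Qed.

Let Lm := Num.min L1 L2.
Let dl := L1 + L2.
Let dl0 : 0 < dl. Proof. exact: addr_gt0. Qed.
Let Lm0 : 0 <= Lm. Proof. by rewrite le_min !ltW. Qed.

Lemma min_mul_add : Lm * dl <= 2 * (L1 * L2).
Proof. rewrite /Lm /dl; have [h|h] := leP L1 L2.
  by rewrite mulrDr mulr_natl mulr2n lerD2r ler_wpM2l// ltW.
by rewrite mulrDr mulr_natl mulr2n [L2 * L1]mulrC lerD2l ler_wpM2r// ltW.
Qed.

(** K1 confines tau1 to an interval of radius L1 about the first value, K2 to one of radius L2 about
    the second; the centre of the shorter interval is kept. *)
Let cc (X0 : spacetime R) (p : space3 R) : R :=
  if L1 <= L2 then pm s1 * enorm p else X0.1 - pm s2 * enorm (sub3 X0.2 p).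

Let measurable_cc X0 : measurable_fun setT (cc X0).
Proof.
rewrite /cc; case: (L1 <= L2).
  by apply: measurable_funM => //; apply: measurable_enorm; exact: measurable_id.
apply: measurable_funB => //; apply: measurable_funM => //.
by apply: measurable_enorm; apply: measurable_sub3 => //; exact: measurable_id.
Qed.

Let bnd (X0 X1 : spacetime R) : R :=
  4 * slab3 s1 s2 X0.1 dl X0.2 c r X1.2.1.1 X1.2.1.2 X1.2.2 * ind 0 Lm (X1.1 - cc X0 X1.2).

Let bnd_ge0 X0 X1 : 0 <= bnd X0 X1.
Proof. by rewrite mulr_ge0 ?ind_ge0// mulr_ge0// slab3_ge0. Qed.

Let measurable_bnd X0 : measurable_fun setT (bnd X0).
Proof.
apply: measurable_funM.
  by apply: measurable_funM => //; apply: measurable_slab3; mproj.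
apply: measurable_ind; apply: measurable_funB; first by mproj.
by apply: (measurableT_comp (measurable_cc X0)); mproj.
Qed.

Let kern_le_bnd X0 X1 : kern X0 X1 <= bnd X0 X1.
Proof.
rewrite /kern !indicE.
have [/set_mem[[_ Xb] [/andP[X1n _] X1L]]|_] := boolP (X1 \in supp1); last first.
  by rewrite mul0r mulr0.
have [/set_mem[/andP[X2n _] X2L]|_] := boolP (sub4 X0 X1 \in supp2); last first.
  by rewrite !mulr0.
rewrite !mulr1.
(* The lower frequency bounds N1 / 2 and N2 / 2 enter here: both vectors are nonzero, so the chord
   estimate applies. *)
have e1 : 0 < enorm X1.2 by apply: lt_trans X1n; rewrite divr_gt0.
have e2 : 0 < enorm (sub3 X0.2 X1.2) by apply: lt_trans X2n; rewrite divr_gt0.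
have fdl : `|pm s1 * enorm X1.2 + pm s2 * enorm (sub3 X0.2 X1.2) - X0.1| <= dl.
  rewrite /dl; apply: le_trans (lerD X1L X2L); apply: le_trans (ler_normD _ _).
  by rewrite le_eqVlt; apply/orP; left; apply/eqP; congr `|_|; rewrite /sub4/=; ring.
have H := angle_le_slab3 dl0 r0 Xb e1 e2 fdl.
rewrite /bnd /ind indicE mem_set ?mulr1//= in_itv/= sub0r add0r -ler_norml /cc /Lm.
case: (leP L1 L2) => _.
  by rewrite -normrN opprB addrC.
move: X2L; rewrite /sub4/=; apply: le_trans.
by rewrite le_eqVlt; apply/orP; left; apply/eqP; congr `|_|; ring.
Qed.

Lemma kern_le X0 :
  (\int[mu4]_X (kern X0 X)%:E <= (768 * pi * (r ^+ 2 * L1 * L2))%:E)%E.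
Proof.
apply: (@le_trans _ _ (\int[mu4]_X (bnd X0 X)%:E)%E).
  apply: ge0_int_le => //; [exact: kern_ge0|exact: measurable_kern].
have mS : measurable_fun setT (fun p : space3 R => slab3 s1 s2 X0.1 dl X0.2 c r p.1.1 p.1.2 p.2).
  by apply: measurable_slab3; mproj.
rewrite [leLHS](fubini_tonelli2 (m1 := mu) (m2 := mu3)); last 2 first.
- by apply/measurable_EFinP; exact: measurable_bnd.
- by move=> X; rewrite lee_fin bnd_ge0.
have E p : fubini_G mu (fun X => (bnd X0 X)%:E) p =
    ((8 * Lm) * slab3 s1 s2 X0.1 dl X0.2 c r p.1.1 p.1.2 p.2)%:E.
  rewrite /fubini_G /bnd /=.
  have mi : measurable_fun (setT : set (measurableTypeR R)) (fun t => (ind 0 Lm t)%:E).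
    by apply/measurable_EFinP; apply: measurable_indic.
  rewrite ge0_intZl; last 3 first.
  - by rewrite mulr_ge0// slab3_ge0.
  - by move=> t; exact: ind_ge0.
  - apply: measurable_ind; apply: measurable_funB => //; exact: measurable_id.
  rewrite (mpres_int (mpres_shift (cc X0 p)) mi) int_ind// -EFinM; congr EFin; ring.
under eq_integral do rewrite E.
rewrite ge0_intZl//; last 2 first.
- by rewrite mulr_ge0.
- by move=> p; exact: slab3_ge0.
apply: (@le_trans _ _ ((8 * Lm)%:E * (48 * (pi * dl * r ^+ 2))%:E)%E).
  by rewrite lee_wpmul2l ?lee_fin ?mulr_ge0//; exact: int_slab3.
rewrite -EFinM lee_fin.
(* 384 = 8 * 48: a 4 from the angle against the slabs, a 2 from the length 2 [Lm] of the interval of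
   tau1, and 48 from [int_slab3]. *)
rewrite [leLHS](_ : _ = 384 * (pi * r ^+ 2) * (Lm * dl)); last by ring.
rewrite [leRHS](_ : _ = 384 * (pi * r ^+ 2) * (2 * (L1 * L2))); last by ring.
apply: ler_wpM2l; last exact: min_mul_add.
exact: (mulr_ge0 (ler0n _ 384) (mulr_ge0 (pi_ge0 R) (sqr_ge0 r))).
Qed.

End kernel4.

(** * The bilinear estimate *)

Section cauchy_schwarz.
Context d (T : measurableType d) {R : realType}.
Variable mu : {measure set T -> \bar R}.

(** The inequality 2 a b <= t a^2 + b^2 / t is integrated and then optimized in t; in this form it
    makes sense for infinite integrals too. *)
Lemma cauchy_schwarz (a b : T -> R) (M : R) : 0 < M ->
  (forall x, 0 <= a x) -> (forall x, 0 <= b x) ->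
  measurable_fun setT a -> measurable_fun setT b ->
  (\int[mu]_x (a x ^+ 2)%:E <= M%:E)%E ->
  ((\int[mu]_x (a x * b x)%:E) * (\int[mu]_x (a x * b x)%:E) <= M%:E * \int[mu]_x (b x ^+ 2)%:E)%E.
Proof.
move=> M0 a0 b0 ma mb aM.
have ma2 : measurable_fun setT (fun x => a x ^+ 2) by exact: measurable_funX.
have mb2 : measurable_fun setT (fun x => b x ^+ 2) by exact: measurable_funX.
have mab : measurable_fun setT (fun x => a x * b x) by exact: measurable_funM.
have B0 : (0 <= \int[mu]_x (b x ^+ 2)%:E)%E by apply: int_ge0 => x; exact: sqr_ge0.
have I0 : (0 <= \int[mu]_x (a x * b x)%:E)%E by apply: int_ge0 => x; exact: mulr_ge0.
have H t : 0 < t -> (2%:E * \int[mu]_x (a x * b x)%:E <=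
    t%:E * M%:E + t^-1%:E * \int[mu]_x (b x ^+ 2)%:E)%E.
  move=> t0; have t1 : 0 <= t^-1 by rewrite invr_ge0 ltW.
  rewrite -ge0_intZl//; last by move=> x; exact: mulr_ge0.
  apply: (@le_trans _ _ (\int[mu]_x (t * a x ^+ 2 + t^-1 * b x ^+ 2)%:E)%E).
    apply: ge0_int_le.
    - by move=> x; rewrite mulr_ge0// mulr_ge0.
    - move=> x; rewrite -subr_ge0.
      rewrite (_ : _ - _ = t^-1 * (t * a x - b x) ^+ 2); last by field; rewrite gt_eqF.
      by rewrite mulr_ge0// sqr_ge0.
    - exact: measurable_funM.
    - by apply: measurable_funD; exact: measurable_funM.
  rewrite ge0_intD; last 4 first.
  - by move=> x; rewrite mulr_ge0 ?sqr_ge0// ltW.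
  - by move=> x; rewrite mulr_ge0 ?sqr_ge0.
  - exact: measurable_funM.
  - exact: measurable_funM.
  rewrite !ge0_intZl//; try (by move=> x; exact: sqr_ge0); last exact: ltW.
  by rewrite leeD2r// lee_wpmul2l// lee_fin ltW.
move: H B0 I0; case: (\int[mu]_x (b x ^+ 2)%:E)%E => [B| |]//; last first.
  by move=> _ _ _; rewrite gt0_muley ?lte_fin// leey.
case: (\int[mu]_x (a x * b x)%:E)%E => [I| |]//; last first.
  by move=> /(_ 1 ltr01); rewrite gt0_muley ?lte_fin// -!EFinM -EFinD leye_eq.
rewrite lee_fin -!EFinM => H B0; rewrite !lee_fin => I0.
have [I00|Ip] := leP I 0.
  by rewrite (le_anti (introT andP (conj I00 I0))) mul0r mulr_ge0// ltW.
(* The optimal order of t: the bound becomes 2 I <= I + M B / I. *)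
have := H (I / M) (divr_gt0 Ip M0); rewrite -!EFinM -EFinD lee_fin.
rewrite divfK ?gt_eqF// invf_div mulrAC => h.
have : I <= M * B / I by lra.
by rewrite ler_pdivlMr.
Qed.

End cauchy_schwarz.

(** * The bilinear integral of two transforms *)

Section bilinear.
Context {R : realType}.
Notation mu := (@lebesgue_measure R).
Notation mu4 := (lebesgue4 R).

Lemma mpres_sub4 (X0 : spacetime R) : mpres mu4 (fun X => sub4 X0 X).
Proof.
exact: (mpres_prod (mpres_csub X0.1)
  (mpres_prod (mpres_prod (mpres_csub X0.2.1.1) (mpres_csub X0.2.1.2)) (mpres_csub X0.2.2))).
Qed.

Lemma mpres_sub4r (X1 : spacetime R) : mpres mu4 (fun X => sub4 X X1).
Proof.
exact: (mpres_prod (mpres_shift X1.1)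
  (mpres_prod (mpres_prod (mpres_shift X1.2.1.1) (mpres_shift X1.2.1.2)) (mpres_shift X1.2.2))).
Qed.

Section convolution.
Variables h1 h2 : spacetime R -> R.
Hypotheses (h10 : forall x, 0 <= h1 x) (h20 : forall x, 0 <= h2 x).
Hypotheses (mh1 : measurable_fun setT h1) (mh2 : measurable_fun setT h2).

Let mz : measurable_fun setT
  (fun z : spacetime R * spacetime R => h1 z.2 * h2 (sub4 z.1 z.2)).
Proof.
apply: measurable_funM; first by apply: measurableT_comp.
apply: (measurableT_comp mh2 (g := fun z : spacetime R * spacetime R => sub4 z.1 z.2)).
by apply: measurable_sub4; mproj.
Qed.

Lemma measurable_conv : measurable_fun setT
  (fun X0 => \int[mu4]_X1 (h1 X1 * h2 (sub4 X0 X1))%:E)%E.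
Proof.
apply: (measurable_fun_fubini_tonelli_F (m2 := mu4)
  (fun z => (h1 z.2 * h2 (sub4 z.1 z.2))%:E)).
  exact/measurable_EFinP.
by move=> z; rewrite lee_fin mulr_ge0.
Qed.

(** After exchanging the integrals, translation invariance makes the inner one independent of X1 up
    to the factor [h1 X1]. *)
Lemma int_conv :
  (\int[mu4]_X0 \int[mu4]_X1 (h1 X1 * h2 (sub4 X0 X1))%:E =
   (\int[mu4]_X (h1 X)%:E) * (\int[mu4]_X (h2 X)%:E))%E.
Proof.
rewrite (fubini_tonelli (m1 := mu4) (m2 := mu4) (fun z => (h1 z.2 * h2 (sub4 z.1 z.2))%:E)).
- have E X1 : (\int[mu4]_X0 (h1 X1 * h2 (sub4 X0 X1))%:E = (\int[mu4]_X (h2 X)%:E) * (h1 X1)%:E)%E.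
    rewrite ge0_intZl//; last first.
      apply: (measurableT_comp mh2 (g := fun z : spacetime R => sub4 z X1)).
      by case: (mpres_sub4r X1).
    by rewrite (mpres_ge0_int (mpres_sub4r X1) (f := fun X => (h2 X)%:E)) 1?muleC//;
      exact/measurable_EFinP.
  under eq_integral do rewrite E.
  rewrite ge0_integralZl 1?muleC//.
- exact/measurable_EFinP.
- by move=> X _; rewrite lee_fin.
- exact: int_ge0.
- exact/measurable_EFinP.
- by move=> z; rewrite lee_fin mulr_ge0.
Qed.

End convolution.

Variables (s1 s2 : bool) (N1 N2 L1 L2 r : R) (c : space3 R).
Hypotheses (N10 : 0 < N1) (N20 : 0 < N2) (L10 : 0 < L1) (L20 : 0 < L2) (r0 : 0 < r).
Let M : R := 768 * pi * (r ^+ 2 * L1 * L2).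
Let M0 : 0 < M. Proof.
have k0 : 0 < 768 :> R by rewrite ltr0n.
exact: (mulr_gt0 (mulr_gt0 k0 (pi_gt0 R)) (mulr_gt0 (mulr_gt0 (exprn_gt0 2 r0) L10) L20)).
Qed.
Let S1 := supp1 s1 N1 L1 r c.
Let S2 := supp2 s2 N2 L2.
Variables g1 g2 : spacetime R -> R[i].
Hypotheses (g1L : cL2 mu4 g1) (g2L : cL2 mu4 g2).
Hypothesis g1S : {ae mu4, forall X, ~ S1 X -> g1 X = 0}.
Hypothesis g2S : {ae mu4, forall X, ~ S2 X -> g2 X = 0}.

Let F (z : spacetime R * spacetime R) : R[i] :=
  (Num.sqrt (theta12 s1 s2 z.1 z.2))%:C * g1 z.2 * g2 (sub4 z.1 z.2).
Let G := bilinear_integral s1 s2 g1 g2.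

Let GE X0 : G X0 = cint mu4 (fun X1 => F (X0, X1)).
Proof. by []. Qed.

Let cmeasF : cmeas F.
Proof.
apply: cmeasM.
  apply: cmeasM.
    by apply: cmeas_real; apply: measurable_sqrtc; exact: measurable_theta12.
  by exact: (cmeas_comp (h := snd) measurable_snd g1L.1).
apply: (cmeas_comp (h := fun z : spacetime R * spacetime R => sub4 z.1 z.2) _ g2L.1).
by apply: measurable_sub4; mproj.
Qed.

Lemma cmeas_bilinear : cmeas G.
Proof. exact: (cmeas_cint2 mu4 cmeasF). Qed.

(** Cauchy-Schwarz with the factors sqrt [kern] and |g1| |g2|. The support conditions hold almost
    everywhere, so the indicators inside [kern] may be inserted up to a null set of X1. *)
Lemma sqn_bilinear_le X0 : ((sqn (G X0))%:E <=
  M%:E * \int[mu4]_X1 (sqn (g1 X1) * sqn (g2 (sub4 X0 X1)))%:E)%E.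
Proof.
have mk := measurable_kern s1 s2 N1 N2 L1 L2 r c X0.
pose a X1 := Num.sqrt (kern s1 s2 N1 N2 L1 L2 r c X0 X1).
pose b X1 := normc (g1 X1) * normc (g2 (sub4 X0 X1)).
have mg2 : cmeas (fun X1 => g2 (sub4 X0 X1)).
  by apply: (cmeas_comp _ g2L.1); case: (mpres_sub4 X0).
have ma : measurable_fun setT a by exact: measurable_sqrtc.
have mb : measurable_fun setT b.
  by apply: measurable_funM; apply: measurable_normc; [exact: g1L.1|].
have mF : cmeas (fun X1 => F (X0, X1)) by exact: cmeas_pair1.
have le : (absint mu4 (fun X1 => F (X0, X1)) <= \int[mu4]_X1 (a X1 * b X1)%:E)%E.
  rewrite le_eqVlt; apply/orP; left; apply/eqP.
  apply: ae_eq_integral => //.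
  - by apply/measurable_EFinP; exact: measurable_normc.
  - by apply/measurable_EFinP; exact: measurable_funM.
  (* The reflection X1 -> X0 - X1 preserves measure, so the exceptional null set of g2 pulls back to
     a null set. *)
  have := mpres_ae (mpres_sub4 X0) g2S.
  apply: filterS2 g1S => X1 h1 h2 _; congr EFin.
  rewrite /F /a /b /kern !Normc.normcM normc_real ger0_norm ?sqrtr_ge0// -mulrA.
  rewrite !indicE.
  have [/set_mem i1|/negP n1] := boolP (X1 \in supp1 s1 N1 L1 r c); last first.
    by rewrite h1 => [|/mem_set//]; rewrite Normc.normc0 !mul0r !mulr0.
  have [/set_mem i2|/negP n2] := boolP (sub4 X0 X1 \in supp2 s2 N2 L2); last first.
    by rewrite h2 => [|/mem_set//]; rewrite Normc.normc0 !mulr0.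
  by rewrite !mulr1.
have CS := cauchy_schwarz (mu := mu4) M0 (fun x => sqrtr_ge0 _)
  (fun x => mulr_ge0 (normc_ge0 _) (normc_ge0 _)) ma mb.
have h : ((\int[mu4]_X1 (a X1 * b X1)%:E) * (\int[mu4]_X1 (a X1 * b X1)%:E)
    <= M%:E * \int[mu4]_x (b x ^+ 2)%:E)%E.
  apply: CS; rewrite /a.
  under eq_integral do rewrite sqr_sqrtr ?kern_ge0//.
  exact: kern_le.
have n := normc_cint_le mu4 mF.
have {}n := le_trans n le.
have n0 : (0 <= (normc (G X0))%:E)%E by rewrite lee_fin normc_ge0.
have := lee_pmul n0 n0 n n; rewrite -EFinM -expr2 sqr_normc => {}n.
apply: (le_trans n); apply: (le_trans h).
rewrite le_eqVlt; apply/orP; left; apply/eqP; congr (_ * _)%E.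
by apply: eq_integral => X1 _; rewrite /b exprMn !sqr_normc.
Qed.

Lemma sqint_bilinear_le : (sqint mu4 G <= M%:E * (sqint mu4 g1 * sqint mu4 g2))%E.
Proof.
have m1 := measurable_sqn g1L.1; have m2 := measurable_sqn g2L.1.
rewrite -(int_conv (fun X => sqn_ge0 _) (fun X => sqn_ge0 _) m1 m2).
have mc := measurable_conv (fun X => sqn_ge0 _) (fun X => sqn_ge0 _) m1 m2.
rewrite -ge0_integralZl//; last 2 first.
- by move=> X _; apply: int_ge0 => Y; rewrite mulr_ge0 ?sqn_ge0.
- exact: ltW.
apply: ge0_le_integral => //.
- by move=> X _; rewrite lee_fin sqn_ge0.
- by apply/measurable_EFinP; apply: measurable_sqn; exact: cmeas_bilinear.
- exact: measurable_funeM.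
- by move=> X _; exact: sqn_bilinear_le.
Qed.

Lemma cL2_bilinear : cL2 mu4 G.
Proof.
split; first exact: cmeas_bilinear.
apply: le_lt_trans sqint_bilinear_le _.
have [_ i1] := g1L; have [_ i2] := g2L.
rewrite lte_mul_pinfty ?lee_fin ?(ltW M0)//.
by rewrite lte_mul_pinfty ?ge0_fin_numE ?sqint_ge0.
Qed.

(** The root of the angle is at most sqrt pi, and a convolution of L1 functions is in L1. This is
    what [ft_graph_surj] demands for the existence of the output. *)
Lemma cL1_bilinear : cL1 mu4 g1 -> cL1 mu4 g2 -> cL1 mu4 G.
Proof.
move=> /cL1P[m1 i1] /cL1P[m2 i2].
apply/cL1P; split; first exact: cmeas_bilinear.
have n1 := measurable_normc m1; have n2 := measurable_normc m2.
have mc := measurable_conv (fun X => normc_ge0 _) (fun X => normc_ge0 _) n1 n2.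
apply: (@le_lt_trans _ _ (\int[mu4]_X0 ((Num.sqrt pi)%:E *
    \int[mu4]_X1 (normc (g1 X1) * normc (g2 (sub4 X0 X1)))%:E))%E).
  apply: ge0_le_integral => //.
  - by move=> X _; rewrite lee_fin normc_ge0.
  - by apply/measurable_EFinP; apply: measurable_normc; exact: cmeas_bilinear.
  - exact: measurable_funeM.
  move=> X0 _; have mF : cmeas (fun X1 => F (X0, X1)) by exact: cmeas_pair1.
  apply: (le_trans (normc_cint_le mu4 mF)).
  have mg2 : cmeas (fun X1 => g2 (sub4 X0 X1)).
    by apply: (cmeas_comp _ m2); case: (mpres_sub4 X0).
  have mp : measurable_fun setT (fun X1 => normc (g1 X1) * normc (g2 (sub4 X0 X1))).
    by apply: measurable_funM => //; exact: measurable_normc.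
  rewrite -ge0_intZl ?sqrtr_ge0//; last by move=> X; rewrite mulr_ge0 ?normc_ge0.
  apply: ge0_int_le.
  - by move=> X; exact: normc_ge0.
  - move=> X; rewrite /F !Normc.normcM normc_real ger0_norm ?sqrtr_ge0// -mulrA.
    rewrite ler_wpM2r ?mulr_ge0 ?normc_ge0// ler_wsqrtr//; exact: angle_lepi.
  - exact: measurable_normc.
  - exact: measurable_funM.
rewrite ge0_integralZl//; last by move=> X _; apply: int_ge0 => Y; rewrite mulr_ge0 ?normc_ge0.
rewrite (int_conv (fun X => normc_ge0 _) (fun X => normc_ge0 _) n1 n2).
apply: lte_mul_pinfty => //.
apply: lte_mul_pinfty => //; first exact: absint_ge0.
by rewrite ge0_fin_numE//; exact: absint_ge0.
Qed.

End bilinear.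

(** * Existence of the output and the estimate in physical space *)

Section estimate.
Context {R : realType}.
Notation mu4 := (lebesgue4 R).
Implicit Types f g u v : spacetime R -> R[i].

Lemma measurable_slab c r : measurable (setT `*` eball c r : set (spacetime R)).
Proof. by apply: measurableX => //; exact: measurable_eball. Qed.

Lemma ae_fin_supp_cL1 g (S : set (spacetime R)) : measurable S ->
  (mu4 S < +oo)%E -> cL2 mu4 g -> {ae mu4, forall X, ~ S X -> g X = 0} -> cL1 mu4 g.
Proof.
move=> mS Soo [mg goo] gS; apply/cL1P; split=> //.
have /cL1P[ms] := cL1_fin_supp mS Soo mg goo.
apply: le_lt_trans; rewrite le_eqVlt; apply/orP; left; apply/eqP.
apply: ae_eq_integral => //.
- by apply/measurable_EFinP; exact: measurable_normc.
- by apply/measurable_EFinP; exact: measurable_normc.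
apply: filterS gS => X h _; congr EFin; rewrite indicE.
have [_|/negP n] := boolP (X \in S); first by rewrite mul1r.
by rewrite h ?mulr0// => /mem_set.
Qed.

Lemma sqint_indic_le (A : set (spacetime R)) g : measurable A -> cmeas g ->
  (sqint mu4 (fun X => ((\1_A X)%:C * g X)%R) <= sqint mu4 g)%E.
Proof.
move=> mA mg; apply: ge0_int_le; last exact: measurable_sqn.
- by move=> X; exact: sqn_ge0.
- move=> X; rewrite sqnM sqn_real indicE; case: (_ \in _) => /=.
    by rewrite expr1n mul1r.
  by rewrite expr0n mul0r sqn_ge0.
- by apply: measurable_sqn; exact: cmeas_indic.
Qed.

Lemma cL2_indic (A : set (spacetime R)) g : measurable A -> cL2 mu4 g ->
  cL2 mu4 (fun X => (\1_A X)%:C * g X).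
Proof.
move=> mA [mg goo]; split; first exact: cmeas_indic.
exact: le_lt_trans (sqint_indic_le mA mg) goo.
Qed.

Variables (N1 N2 L1 L2 : R) (s1 s2 : bool) (r : R) (c : space3 R).
Hypotheses (N10 : 0 < N1) (N20 : 0 < N2) (L10 : 0 < L1) (L20 : 0 < L2) (r0 : 0 < r).
Let A : set (spacetime R) := setT `*` eball c r.
Let mA : measurable A := @measurable_slab c r.
Let P := r ^+ 2 * L1 * L2.
Variables u1 u2 : spacetime R -> R[i].
Hypotheses (u1S : fourier_supp u1 (Kset s1 N1 L1))
           (u2S : fourier_supp u2 (Kset s2 N2 L2)).

Let indic_supp g : {ae mu4, forall X, ~ Kset s1 N1 L1 X -> g X = 0} ->
  {ae mu4, forall X, ~ supp1 s1 N1 L1 r c X -> (\1_A X)%:C * g X = 0}.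
Proof.
apply: filterS => X h nS; rewrite indicE.
have [/set_mem XA|_] := boolP (X \in A); last by rewrite mul0r.
by rewrite h ?mulr0// => XK; exact: nS.
Qed.

(** The supports have finite measure, so the two factors are in L1 as well as L2, and hence so is
    the bilinear integral; [ft_graph_surj] then yields both [Pu1] and [v]. *)
Lemma bilinear_exists : exists Pu1 v : spacetime R -> R[i],
  is_multiplier A u1 Pu1 /\ is_bilinear s1 s2 Pu1 u2 v.
Proof.
have [g1 /is_fourierE u1g1 g1S] := u1S; have [g2 /is_fourierE u2g2 g2S] := u2S.
have [_ g1L _] := u1g1; have [_ g2L _] := u2g2.
have AL := cL2_indic mA g1L; have AS := indic_supp g1S.
pose gA X := (\1_A X)%:C * g1 X.
have AL1 : cL1 mu4 gA.
  apply: (ae_fin_supp_cL1 (measurable_supp1 s1 N1 L1 r c)) AL AS.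
  apply: le_lt_trans (Kset_lty s1 N1 L1).
  apply: le_measure; rewrite ?inE; [exact: measurable_supp1|exact: measurable_Kset|].
  by move=> X [].
have g2L1 := ae_fin_supp_cL1 (measurable_Kset s2 N2 L2) (Kset_lty s2 N2 L2) g2L g2S.
have [Pu1 PA] := ft_graph_surj (@measurable_dot4 R) (@dot4C R) (@planch4_gt0 R)
  (@plancherel4 R) AL1 AL.
have GL1 := cL1_bilinear s1 s2 AL g2L AL1 g2L1.
have [v vG] := ft_graph_surj (@measurable_dot4 R) (@dot4C R) (@planch4_gt0 R)
  (@plancherel4 R) GL1 (cL2_bilinear N10 N20 L10 L20 r0 AL g2L AS g2S).
exists Pu1, v; split; first by exists g1; exact/is_fourierE.
by exists gA, g2; split; exact/is_fourierE.
Qed.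

(** 64 = 4^3, a factor 4 for each of the three passages between a function and its transform.
    Plancherel's constant comes in once for each input and is divided out once for the output. *)
Lemma bilinear_estimate Pu1 v :
  is_multiplier A u1 Pu1 -> is_bilinear s1 s2 Pu1 u2 v ->
  (sqint mu4 v <= (64 * planch4 * (768 * pi) * P)%:E * (sqint mu4 u1 * sqint mu4 u2))%E.
Proof.
move=> [g /is_fourierE u1g /is_fourierE Pg].
move=> [g1 [g2 [/is_fourierE Pg1 /is_fourierE u2g2 /is_fourierE vG]]].
have [h1 /is_fourierE u1h1 h1S] := u1S; have [h2 /is_fourierE u2h2 h2S] := u2S.
have [_ gL _] := u1g; have [_ g1L _] := Pg1; have [_ g2L _] := u2g2; have [_ AL _] := Pg.
have k0 := @planch4_gt0 R.
have fun4 := ft_graph_fun (@measurable_dot4 R) k0 (@plancherel4 R).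
have le4 := ft_graph_le (@measurable_dot4 R) k0 (@plancherel4 R).
have ge4 := ft_graph_ge (@measurable_dot4 R) k0 (@plancherel4 R).
(* The transform used by the multiplier and the one with the support property are two
   representatives of one class, so the support carries over almost everywhere. *)
have gS : {ae mu4, forall X, ~ Kset s1 N1 L1 X -> g X = 0}.
  by apply: filterS2 (fun4 _ _ _ u1g u1h1) h1S => X ->.
have g2S : {ae mu4, forall X, ~ supp2 s2 N2 L2 X -> g2 X = 0}.
  by apply: filterS2 (fun4 _ _ _ u2g2 u2h2) h2S => X ->.
have g1A := fun4 _ _ _ Pg1 Pg.
have g1S : {ae mu4, forall X, ~ supp1 s1 N1 L1 r c X -> g1 X = 0}.
  by apply: filterS2 g1A (indic_supp gS) => X ->.
have S1 : (sqint mu4 g1 <= (4 * planch4)%:E * sqint mu4 u1)%E.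
  rewrite (sqint_ae g1L.1 AL.1 g1A).
  exact: le_trans (sqint_indic_le mA gL.1) (le4 _ _ u1g).
have S2 := le4 _ _ u2g2.
have SG := sqint_bilinear_le N10 N20 L10 L20 r0 g1L g2L g1S g2S.
have Sv := ge4 _ _ vG.
have fin f : cL2 mu4 f -> exists2 x : R, 0 <= x & sqint mu4 f = x%:E.
  move=> [_ foo]; exists (fine (sqint mu4 f)); first by rewrite fine_ge0// sqint_ge0.
  by rewrite fineK// ge0_fin_numE// sqint_ge0.
have [u1L _ _] := u1g; have [u2L _ _] := u2g2; have [vL GL _] := vG.
move: S1 S2 SG Sv.
have [x1 x10 ->] := fin _ u1L; have [x2 x20 ->] := fin _ u2L.
have [y1 y10 ->] := fin _ g1L; have [y2 y20 ->] := fin _ g2L.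
have [w w0 ->] := fin _ vL; have [z z0 ->] := fin _ GL.
rewrite -!EFinM !lee_fin -/P => S1 S2 SG Sv.
have M0 : 0 <= 768 * pi * P.
  apply: (mulr_ge0 (mulr_ge0 (ler0n R 768) (pi_ge0 R))).
  exact: (mulr_ge0 (mulr_ge0 (sqr_ge0 r) (ltW L10)) (ltW L20)).
move: M0 SG; set M := 768 * pi * P => M0 SG.
rewrite -(ler_pM2l k0); apply: (le_trans Sv).
apply: (@le_trans _ _ (4 * (M * (4 * planch4 * x1 * (4 * planch4 * x2))))).
  rewrite ler_wpM2l//; apply: (le_trans SG); rewrite ler_wpM2l//.
  exact: ler_pM.
by rewrite le_eqVlt; apply/orP; left; apply/eqP; rewrite /M; ring.
Qed.

End estimate.

Theorem theorem2p4 (R : realType) :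
  exists C : R,
    forall (N1 N2 L1 L2 : R) (s1 s2 : bool) (r : R) (c : space3 R)
           (u1 u2 : spacetime R -> R[i]),
      0 < N1 -> 0 < N2 -> 0 < L1 -> 0 < L2 -> 0 < r ->
      inL2 u1 -> inL2 u2 ->
      fourier_supp u1 (Kset s1 N1 L1) ->
      fourier_supp u2 (Kset s2 N2 L2) ->
      (exists Pu1 v : spacetime R -> R[i],
         is_multiplier (setT `*` eball c r) u1 Pu1 /\
         is_bilinear s1 s2 Pu1 u2 v) /\
      (forall Pu1 v : spacetime R -> R[i],
         is_multiplier (setT `*` eball c r) u1 Pu1 ->
         is_bilinear s1 s2 Pu1 u2 v ->
         (L2norm v <= (C * Num.sqrt (r ^+ 2 * L1 * L2))%:E
                        * L2norm u1 * L2norm u2)%E).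
Proof.
(* The constant for squared norms; its square root serves for the norms. *)
pose K : R := 64 * planch4 * (768 * pi).
have K0 : 0 <= K.
  exact: (mulr_ge0 (mulr_ge0 (ler0n R 64) (ltW (@planch4_gt0 R)))
    (mulr_ge0 (ler0n R 768) (pi_ge0 R))).
exists (Num.sqrt K) => N1 N2 L1 L2 s1 s2 r c u1 u2 N10 N20 L10 L20 r0 u1L u2L u1S u2S.
split; first exact: (bilinear_exists c N10 N20 L10 L20 r0 u1S u2S).
move=> Pu1 v mPu1 bv.
have H := bilinear_estimate N10 N20 L10 L20 r0 u1S u2S mPu1 bv.
have P0 : 0 <= r ^+ 2 * L1 * L2.
  exact: (mulr_ge0 (mulr_ge0 (sqr_ge0 r) (ltW L10)) (ltW L20)).
have [_ u1oo] := u1L; have [_ u2oo] := u2L.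
move: u1oo u2oo H (L2norm_ge0 u1) (L2norm_ge0 u2); rewrite -/K -!sqr_L2norm.
case: (L2norm u1) => [a| |]//; case: (L2norm u2) => [b| |]// _ _ H a0 b0.
move: H a0 b0; rewrite -!EFinM !lee_fin => H a0 b0.
rewrite L2norm_le; last by rewrite !mulr_ge0 ?sqrtr_ge0.
rewrite -sqr_L2norm; apply: (le_trans H); rewrite lee_fin !exprMn.
rewrite !sqr_sqrtr// -!expr2 -!mulrA lexx//.
Qed.
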